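(* Let $\mathbf{x}_1,\dots,\mathbf{x}_n$ be i.i.d. $N_p(\mathbf{0},\boldsymbol{\Sigma})$ with $\boldsymbol{\Sigma}=(r^{|i-j|})_{1\le i,j\le p}$, $r=r_n\in[0,1)$, $p=p_n\to\infty$, $\log p=o(n^{1/5})$, $\limsup_n r_n<1$, and $\lim_{n\to\infty} r\sqrt n/\sqrt{\log p}=2-\sqrt2$. Set $$\kappa_n=\frac{r\sqrt n}{\sqrt{\log p}}-(2-\sqrt2),\qquad \lambda_n=\sqrt2(\log p)\kappa_n+\Big(\tfrac{1}{\sqrt8}-\tfrac12\Big)\log\log p .$$ Let $a_n=2\sqrt{n\log p}$, $b_n=4\log p-\tfrac12[\log\log p+\log(4\pi)]$, $K_1=\tfrac1{2\sqrt2}$, $c_n=\frac{\sqrt{2n\log p}}{1-r^2}$, $d_n=\frac{r\sqrt{2n\log p}}{1-r^2}+2\log p-\tfrac12[\log\log p+\log(4\pi)]$, and $K_2=(\tfrac12-\tfrac1{\sqrt8})\log(4\pi)$. (i) If $\lambda_n\to-\infty$, then $a_n\mathcal{L}_n-b_n$ converges weakly to the distribution with cdf $\exp(-K_1e^{-x})$. (ii) If $\lambda_n\to\lambda\in\mathbb{R}$, then $a_n\mathcal{L}_n-b_n$ converges weakly to the distribution with cdf $$F(x)=\exp\big(-K_1e^{-x}\big)\cdot\exp\big(-e^{-x/\sqrt2-K_2+\lambda}\big).$$ (iii) If $\lambda_n\to\infty$, then $c_n\mathcal{L}_n-d_n$ converges weakly to the distribution with cdf $\exp(-e^{-x})$.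
   Context: Write $\mathbf{x}_k=(x_{k1},\dots,x_{kp})^T$. For $1\le i<j\le p$ define $$\hat\rho_{i,j}=\frac{\sum_{k=1}^n x_{ki}x_{kj}}{\sqrt{\sum_{k=1}^n x_{ki}^2\sum_{k=1}^n x_{kj}^2}},\qquad \mathcal{L}_n=\max_{1\le i<j\le p}\hat\rho_{i,j}.$$ All quantities $r,p$ may depend on $n$; limits are as $n\to\infty$. *)

(* Defs.v *)
From HB Require Import structures.
From mathcomp Require Import all_boot all_order all_algebra.
From mathcomp Require Import all_classical all_reals all_analysis.
Set Implicit Arguments.
Unset Strict Implicit.
Unset Printing Implicit Defensive.
Import Order.TTheory GRing.Theory Num.Theory.
Import numFieldNormedType.Exports.
Local Open Scope classical_set_scope.
Local Open Scope ring_scope.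

Definition ar1_cov {R : realType} (p : nat) (r : R) : 'M[R]_p :=
  \matrix_(i < p, j < p) r ^+ `|(i : nat) - (j : nat)|.

(* Mutual independence of a finite family (indexed by a finType I) of
   real random variables: product rule for every choice of Borel sets
   (choosing setT for some indices gives every finite subfamily). *)
Definition mutually_independent {d} {T : measurableType d} {R : realType}
    (P : probability T R) (I : finType) (X : I -> T -> R) : Prop :=
  forall A : I -> set R, (forall i, measurable (A i)) ->
    P (\bigcap_(i in [set: I]) (X i @^-1` A i)) =
    (\prod_(i : I) P (X i @^-1` A i))%E.

Definition iid_std_normal {d} {T : measurableType d} {R : realType}
    (P : probability T R) (I : finType) (z : I -> T -> R) : Prop :=
  (forall i, measurable_fun [set: T] (z i)) /\
  (forall i (A : set R), measurable A ->
      P (z i @^-1` A) = normal_prob 0 1 A) /\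
  mutually_independent P z.

(* x_1..x_n i.i.d. N_p(0, Sigma): x_k = M z_k with M M^T = Sigma and z_k
   i.i.d. standard normal vectors. x k i is the i-th coordinate of x_k. *)
Definition gauss_sample {R : realType} (n p : nat) (M : 'M[R]_p)
    (z : 'I_n * 'I_p -> R) : 'I_n -> 'I_p -> R :=
  fun k i => \sum_(j < p) M i j * z (k, j).

Definition rho_hat {R : realType} (n p : nat) (x : 'I_n -> 'I_p -> R)
    (i j : 'I_p) : R :=
  (\sum_(k < n) x k i * x k j) /
  Num.sqrt ((\sum_(k < n) x k i ^+ 2) * (\sum_(k < n) x k j ^+ 2)).

(* L_n = max_{1 <= i < j <= p} rho_{i,j}.  Since |rho| <= 1, starting the
   max at -1 does not change the value whenever p >= 2. *)
Definition Lmax {R : realType} (n p : nat) (x : 'I_n -> 'I_p -> R) : R :=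
  \big[Num.max/-1]_(i < p) \big[Num.max/-1]_(j < p | (i < j)%N)
     rho_hat x i j.

(* Main.v *)
(** With [s = sqrt (1 - r^2)], orthogonal invariance of the Gaussian measure turns the
    sample columns into an autoregression [X_0 = W_0], [X_(j+1) = r X_j + s W_(j+1)] with
    i.i.d. standard normal innovation vectors [W_j].  The columns are exposed one after
    the other.  Given [X_0, ..., X_j], each [<X_i / |X_i|, W_(j+1)>] is standard normal, and
    as long as all norms are close to [sqrt n] and no correlation exceeds [u = t / sqrt n],
    the pair [(i, j+1)] exceeds [u] essentially when this variable exceeds [t] if [i < j],
    and [t - r sqrt n] if [i = j].  The union bound, respectively Bonferroni's inequality,
    over [i] makes the probability that no correlation exceeds [u] satisfy a recursion in
    [j], so that it is asymptotically [exp (- (p^2/2 gtail t + p gtail (t - r sqrt n)))].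
    Mills' ratio evaluates both terms: at the normalisation [(a_n, b_n)] the first one tends
    to [K1 exp (- x)] and the second one is governed by [lambda_n]; at [(c_n, d_n)] with
    [lambda_n -> +oo] only the adjacent pairs survive. *)

Require Import Defs.
From HB Require Import structures.
From mathcomp Require Import all_boot all_order all_algebra.
From mathcomp Require Import all_classical all_reals all_analysis.
From mathcomp Require Import measurable_realfun zify ring lra.
Import Order.TTheory GRing.Theory Num.Theory.
Import numFieldNormedType.Exports.
Set Implicit Arguments.
Unset Strict Implicit.
Unset Printing Implicit Defensive.
Local Open Scope classical_set_scope.
Local Open Scope ring_scope.

(** * Rotation invariance of the planar Gaussian measure *)

(** Given the past the projections of the new column are exactly Gaussian, but a correlation also
    contains the norm of the new column, which the past does not determine. It is replaced by
    deterministic bounds with a relative tolerance of order [eta = sqrt (log p / n)]. This scale is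
    large enough for the exceptional events: a squared innovation norm off by a factor [1 +- 4 eta],
    or a projection above [4 eta sqrt n], has probability o(1/p) per column. It is small enough for
    the tails: the thresholds move by [O(eta sqrt (log p))], which leaves their limits unchanged
    once [(log p) eta] tends to 0, and the growth condition on [p] ensures this. As
    [2 - sqrt 2 < 1], also [r <= eta] eventually, so that the tolerances reproduce themselves from
    column to column instead of accumulating.

    The value [2 - sqrt 2] is critical: at [t] close to [2 sqrt (log p)] there are about [p^2 / 2]
    far pairs of probability [p^-2], while the shift by [r sqrt n] leaves about [p] adjacent pairs
    the threshold [sqrt (2 log p)], of probability [p^-1]. Only factors of lower order decide, and
    [lambda_n] collects them. *)

Section lebesgue_plane.
Context {R : realType}.
Local Open Scope ereal_scope.
Local Notation mu := (@lebesgue_measure R).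
Local Notation I2 f := (\int[mu]_x \int[mu]_y f (x, y)).

Lemma lebesgue_measure_shift (a : R) (A : set R) : measurable A ->
  pushforward mu (fun x : measurableTypeR R => x + a : measurableTypeR R)%R A
  = mu A.
Proof.
move=> mA; have mS : measurable_fun [set: measurableTypeR R]
    (fun x : measurableTypeR R => x + a : measurableTypeR R)%R.
  exact: measurable_funD.
apply/esym/lebesgue_measure_unique => //= _ [[x y]] _ <-.
rewrite /pushforward.
have -> : (fun z : R => z + a)%R @^-1` [set` `]x, y]%R] = [set` `](x - a), (y - a)]%R].
  by apply/seteqP; split => z /=; rewrite !in_itv/= ltrBlDr lerBrDr.
rewrite !lebesgue_measure_itv/= !lte_fin ltrD2r; case: ifP => // _.
by rewrite -!EFinD; congr EFin; lra.
Qed.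

Lemma ge0_integral_shift (a : R) (f : R -> \bar R) :
  measurable_fun [set: R] f -> (forall x, 0 <= f x) ->
  \int[mu]_x f (x + a)%R = \int[mu]_x f x.
Proof.
move=> mf f0.
have mS : measurable_fun [set: measurableTypeR R] (fun x : measurableTypeR R => x + a : measurableTypeR R)%R.
  exact: measurable_funD.
rewrite [RHS](eq_measure_integral
  (pushforward mu (fun x : measurableTypeR R => x + a : measurableTypeR R)%R)); last first.
  by move=> A mA _; rewrite /= lebesgue_measure_shift.
by rewrite ge0_integral_pushforward.
Qed.

Lemma ge0_integral_shear1 (a : R) (f : R * R -> \bar R) :
  measurable_fun [set: R * R] f -> (forall x, 0 <= f x) ->
  I2 (fun z : R * R => f (z.1 + a * z.2, z.2)%R) = I2 f.
Proof.
move=> mf f0 /=.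
have mfs : measurable_fun [set: R * R] (fun z : R * R => f (z.1 + a * z.2, z.2)%R).
  apply: measurableT_comp => //; apply/measurable_fun_pairP; split => /=.
    by apply: measurable_funD => //; apply: measurable_funM.
  exact: measurable_snd.
rewrite (@fubini_tonelli _ _ _ _ _ mu mu _ mfs (fun z => f0 _)).
rewrite (@fubini_tonelli _ _ _ _ _ mu mu _ mf f0).
apply: eq_integral => y _ /=.
rewrite (ge0_integral_shift (a * y)%R (f := fun x => f (x, y)))//.
exact: measurableT_comp.
Qed.

Lemma ge0_integral_shear2 (a : R) (f : R * R -> \bar R) :
  measurable_fun [set: R * R] f -> (forall x, 0 <= f x) ->
  I2 (fun z : R * R => f (z.1, z.2 + a * z.1)%R) = I2 f.
Proof.
move=> mf f0 /=; apply: eq_integral => x _ /=.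
rewrite (ge0_integral_shift (a * x)%R (f := fun y => f (x, y)))//.
exact: measurableT_comp.
Qed.

(* A rotation by an angle other than pi is a product of three shears. *)
Lemma ge0_integral_rotate_shear (c s : R) (f : R * R -> \bar R) :
  (c ^+ 2 + s ^+ 2 = 1)%R -> c != (-1)%R ->
  measurable_fun [set: R * R] f -> (forall x, 0 <= f x) ->
  I2 (fun z : R * R => f (c * z.1 - s * z.2, s * z.1 + c * z.2)%R) = I2 f.
Proof.
move=> cs c1 mf f0.
have c10 : (1 + c != 0)%R by rewrite addrC addr_eq0.
(* [t] is the tangent of half the angle; the three shears have the slopes [- t], [s], [- t]. *)
pose t := (s / (1 + c))%R.
have st : (s * t = 1 - c)%R.
  rewrite /t mulrA -expr2; apply: (mulIf c10); rewrite divfK//; lra.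
have tc : (t * (1 + c) = s)%R by rewrite /t divfK.
pose f1 (z : R * R) := f (z.1 + - t * z.2, z.2)%R.
pose f2 (z : R * R) := f1 (z.1, z.2 + s * z.1)%R.
have m1 : measurable_fun [set: R * R] f1.
  apply: measurableT_comp => //; apply/measurable_fun_pairP; split => /=.
    by apply: measurable_funD => //; apply: measurable_funM.
  exact: measurable_snd.
have m2 : measurable_fun [set: R * R] f2.
  apply: measurableT_comp => //; apply/measurable_fun_pairP; split => /=.
    exact: measurable_fst.
  by apply: measurable_funD => //; apply: measurable_funM.
transitivity (I2 (fun z : R * R => f2 (z.1 + - t * z.2, z.2)%R)).
  apply: eq_integral => x _; apply: eq_integral => y _ /=.
  rewrite /f2 /f1 /=; congr (f (_, _)).
    have -> : (x + - t * y + - t * (y + s * (x + - t * y)) =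
      x - (s * t) * x - t * (1 + (1 - s * t)) * y)%R by ring.
    rewrite st (_ : 1 + (1 - (1 - c)) = 1 + c)%R; last by ring.
    by rewrite tc; ring.
  have -> : (y + s * (x + - t * y) = s * x + (1 - s * t) * y)%R by ring.
  by rewrite st; ring.
rewrite (ge0_integral_shear1 (- t)%R m2 (fun _ => f0 _)).
apply: (eq_trans _ (ge0_integral_shear1 (- t)%R mf f0)).
exact: (ge0_integral_shear2 s m1 (fun _ => f0 _)).
Qed.

Lemma ge0_integral_rotate (c s : R) (f : R * R -> \bar R) :
  (c ^+ 2 + s ^+ 2 = 1)%R ->
  measurable_fun [set: R * R] f -> (forall x, 0 <= f x) ->
  I2 (fun z : R * R => f (c * z.1 - s * z.2, s * z.1 + c * z.2)%R) = I2 f.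
Proof.
move=> cs mf f0; have [cN1|cN1] := eqVneq c (-1)%R; last first.
  exact: ge0_integral_rotate_shear.
(* The rotation by pi is the square of a quarter turn. *)
have s0 : s = 0%R.
  by apply/eqP; rewrite -sqrf_eq0; apply/eqP; move: cs; rewrite cN1 => ?; lra.
pose g (z : R * R) := f (0 * z.1 - 1 * z.2, 1 * z.1 + 0 * z.2)%R.
have o1 : (0 ^+ 2 + 1 ^+ 2 = 1 :> R)%R by ring.
have mg : measurable_fun [set: R * R] g.
  apply: measurableT_comp => //; apply/measurable_fun_pairP; split => /=.
    by apply: measurable_funB; apply: measurable_funM.
  by apply: measurable_funD; apply: measurable_funM.
have o0' : (0 : R)%R != (-1)%R by rewrite eq_sym oppr_eq0 oner_eq0.
rewrite -[RHS](ge0_integral_rotate_shear o1 o0' mf f0).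
rewrite -[RHS](ge0_integral_rotate_shear o1 o0' mg (fun _ => f0 _)).
apply: eq_integral => x _; apply: eq_integral => y _ /=.
by rewrite /g /= cN1 s0; congr (f (_, _)); ring.
Qed.

End lebesgue_plane.

(** * The standard Gaussian measure on the plane *)

Section gaussian.
Context {R : realType}.
Local Open Scope ereal_scope.
Local Notation mu := (@lebesgue_measure R).
Local Notation gam := (@normal_prob R 0 1).

(** The Radon-Nikodym derivative is only known through its integrals; it equals the density almost
    everywhere because both integrate to [normal_prob m s] on every measurable set. *)
Lemma ge0_integral_normal_prob (m s : R) (f : R -> \bar R) :
  measurable_fun [set: R] f -> (forall x, 0 <= f x) ->
  \int[normal_prob m s]_x f x = \int[mu]_x (f x * (normal_pdf m s x)%:E).
Proof.
move=> mf f0.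
have dom := @normal_prob_dominates R m s.
rewrite -(Radon_Nikodym_SigmaFinite.change_of_variables dom)//.
apply: ae_eq_integral => //.
- apply: emeasurable_funM => //.
  exact: measurable_int (Radon_Nikodym_SigmaFinite.f_integrable _).
- apply: emeasurable_funM => //; apply/measurable_EFinP.
  exact: measurable_normal_pdf.
- apply: ae_eqe_mul2l; apply: integral_ae_eq => //.
  + exact: Radon_Nikodym_SigmaFinite.f_integrable.
  + by apply/measurable_EFinP; exact: measurable_normal_pdf.
  + by move=> A _ mA; rewrite -Radon_Nikodym_SigmaFinite.f_integral.
Qed.

Lemma normal_pdf01 (x : R) :
  normal_pdf 0 1 x = (normal_peak 1 * expR (- (x ^+ 2) / 2))%R.
Proof.
by rewrite normal_pdfE ?oner_eq0// /normal_fun subr0 expr1n.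
Qed.

Lemma gaussian_plane (B : set (R * R)) : measurable B ->
  (gam \x gam) B = \int[mu]_x \int[mu]_y
    ((\1_B (x, y) * (normal_pdf 0 1 x * normal_pdf 0 1 y))%:E).
Proof.
move=> mB.
have mI : measurable_fun [set: R * R] (fun z => (\1_B z : R)%:E).
  by apply/measurable_EFinP; exact: measurable_indic.
transitivity (\int[gam \x gam]_z (\1_B z)%:E).
  by rewrite (integral_indic (gam \x gam) measurableT mB) setIT.
rewrite (fubini_tonelli1 (m1 := gam) (m2 := gam) (fun z => (\1_B z)%:E))//=; last first.
rewrite ge0_integral_normal_prob/=; last 2 first.
- by apply: measurable_fun_fubini_tonelli_F.
- by move=> x; apply: integral_ge0 => y _; rewrite lee_fin.
apply: eq_integral => x _.
rewrite /fubini_F ge0_integral_normal_prob//=; last first.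
  exact: (measurableT_comp mI).
rewrite -ge0_integralZr//=.
- by apply: eq_integral => y _; rewrite -!EFinM; congr EFin; ring.
- apply: emeasurable_funM; first exact: (measurableT_comp mI).
  by apply/measurable_EFinP; exact: measurable_normal_pdf.
- by move=> y _; rewrite -EFinM lee_fin mulr_ge0// normal_pdf_ge0.
- by rewrite lee_fin normal_pdf_ge0.
Qed.

(** The product density depends on the distance to the origin only, so the invariance of the
    Lebesgue integral under rotations carries over. *)
Lemma gaussian_plane_rotate (c s : R) (B : set (R * R)) :
  (c ^+ 2 + s ^+ 2 = 1)%R -> measurable B ->
  (gam \x gam) [set z | B (c * z.1 - s * z.2, s * z.1 + c * z.2)%R] =
  (gam \x gam) B.
Proof.
move=> cs mB.
have mrot : measurable_fun [set: R * R]
    (fun z : R * R => (c * z.1 - s * z.2, s * z.1 + c * z.2)%R).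
  apply/measurable_fun_pairP; split => /=.
    by apply: measurable_funB; apply: measurable_funM.
  by apply: measurable_funD; apply: measurable_funM.
have mrB : measurable [set z : R * R | B (c * z.1 - s * z.2, s * z.1 + c * z.2)%R].
  by rewrite -[X in measurable X]setTI; exact: mrot.
rewrite (gaussian_plane mrB) (gaussian_plane mB).
pose f (z : R * R) := ((\1_B z * (normal_pdf 0 1 z.1 * normal_pdf 0 1 z.2))%:E).
rewrite -(ge0_integral_rotate (f := f) cs); last 2 first.
- apply/measurable_EFinP; apply: measurable_funM; first exact: measurable_indic.
  by apply: measurable_funM; apply: measurableT_comp => //; exact: measurable_normal_pdf.
- by move=> z; rewrite lee_fin mulr_ge0// mulr_ge0// normal_pdf_ge0.
apply: eq_integral => x _; apply: eq_integral => y _; rewrite /f /=.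
congr (_ * _)%:E; rewrite !normal_pdf01.
have E2 k a b : (k * expR a * (k * expR b) = k ^+ 2 * expR (a + b) :> R)%R.
  by rewrite expRD; ring.
rewrite !E2; congr (_ * expR _)%R.
have -> : ((c * x - s * y) ^+ 2 = c ^+ 2 * x ^+ 2 - 2 * c * s * x * y + s ^+ 2 * y ^+ 2)%R by ring.
have -> : ((s * x + c * y) ^+ 2 = s ^+ 2 * x ^+ 2 + 2 * c * s * x * y + c ^+ 2 * y ^+ 2)%R by ring.
have -> : (s ^+ 2 = 1 - c ^+ 2)%R by lra.
by field.
Qed.

End gaussian.

(** * Independence from the past *)

Section past.
Context d (T : measurableType d) (R : realType) (P : probability T R).
Context (I : finType) (z : I -> T -> R).
Local Open Scope ereal_scope.
Local Notation gam := (@normal_prob R 0 1).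

(** Intersections, rather than single preimages, are taken as generators of [past J] in order to
    have a pi-system: the product rule holds on it by assumption and extends from there. *)
Definition cylinders (J : {set I}) : set (set T) :=
  [set A | exists B : I -> set R, (forall i, measurable (B i)) /\
    A = \bigcap_(i in [set i | i \in J]) (z i @^-1` B i)].

Definition past (J : {set I}) := g_sigma_algebraType (cylinders J).

Hypothesis mz : forall i, measurable_fun [set: T] (z i).

Lemma measurable_preimage_coord i (B : set R) : measurable B ->
  measurable (z i @^-1` B).
Proof. by move=> mB; rewrite -[X in measurable X]setTI; exact: mz. Qed.

Lemma cylinders_measurable (J : {set I}) : cylinders J `<=` @measurable _ T.
Proof.
move=> A [B [mB ->]]; apply: fin_bigcap_measurable => //.
by move=> i _; exact: measurable_preimage_coord.
Qed.

Lemma past_measurable (J : {set I}) (A : set T) :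
  measurable (A : set (past J)) -> measurable A.
Proof.
exact: (smallest_sub (@sigma_algebra_measurable _ T) (@cylinders_measurable J)).
Qed.

Lemma measurable_fun_past d' (U : measurableType d') (J : {set I}) (f : T -> U) :
  measurable_fun [set: past J] f -> measurable_fun [set: T] f.
Proof.
move=> mf _ B mB; apply: (@past_measurable J); exact: mf.
Qed.

Lemma cylinder_setT (J : {set I}) : cylinders J setT.
Proof.
exists (fun=> setT); split => //.
by apply/seteqP; split => // t _ i _.
Qed.

Lemma cylinders_setI (J : {set I}) : setI_closed (cylinders J).
Proof.
move=> _ _ [B [mB ->]] [C [mC ->]].
exists (fun i => B i `&` C i); split; first by move=> i; exact: measurableI.
by rewrite -bigcapI; apply: eq_bigcapr => i _; rewrite preimage_setI.
Qed.

Lemma measurable_coord_past (J : {set I}) i : i \in J ->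
  measurable_fun [set: past J] (z i).
Proof.
move=> iJ _ B mB; rewrite setTI; apply: sub_sigma_algebra.
exists (fun k => if k == i then B else setT); split.
  by move=> k; case: ifP.
apply/seteqP; split => [t Bt k _ /=|t /(_ i iJ)/=]; last by rewrite eqxx.
by case: eqP => [->|].
Qed.

Lemma past_subset (J K : {set I}) (A : set T) : J \subset K ->
  measurable (A : set (past J)) -> measurable (A : set (past K)).
Proof.
move=> JK; apply: smallest_sub; first exact: sigma_algebra_measurable.
move=> _ [B [mB ->]]; apply: (@fin_bigcap_measurable _ (past K)) => // i iJ.
rewrite -[X in measurable X]setTI.
by apply: measurable_coord_past => //; exact: (fintype.subsetP JK).
Qed.

Lemma measurable_fun_past_subset d' (U : measurableType d') (J K : {set I})
  (f : T -> U) : J \subset K ->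
  measurable_fun [set: past J] f -> measurable_fun [set: past K] f.
Proof.
move=> JK mf _ B mB; apply: (past_subset JK); exact: mf.
Qed.

Hypothesis Pz : iid_std_normal P z.

Lemma iid_cylinder (J : {set I}) (B : I -> set R) :
  (forall i, measurable (B i)) ->
  P (\bigcap_(i in [set i | i \in J]) (z i @^-1` B i)) = \prod_(i in J) gam (B i).
Proof.
move=> mB; case: Pz => _ [nz iz].
pose C i := if i \in J then B i else setT.
have mC i : measurable (C i) by rewrite /C; case: ifP.
have -> : \bigcap_(i in [set i | i \in J]) (z i @^-1` B i) =
    \bigcap_(i in [set: I]) (z i @^-1` C i).
  apply/seteqP; split => t Bt i => [_|iJ].
    by rewrite /C /=; case: ifPn => // iJ; exact: Bt.
  by have := Bt i Logic.I; rewrite /C /= ifT.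
rewrite iz// [RHS]big_mkcond/=; apply: eq_bigr => i _.
by rewrite nz// /C; case: ifP => // _; rewrite probability_setT.
Qed.

(** As functions of [A] both sides are finite measures that agree on the pi-system [cylinders J],
    hence on the sigma-algebra it generates. *)
Lemma past_indep (J : {set I}) k (A : set T) (B : set R) : k \notin J ->
  measurable (A : set (past J)) -> measurable B ->
  P (A `&` z k @^-1` B) = P A * gam B.
Proof.
move=> kJ mA mB.
have mkB := measurable_preimage_coord k mB.
have g0 : (0 <= fine (gam B))%R by exact: fine_ge0.
have gE : (fine (gam B))%:E = gam B by rewrite fineK// fin_num_measure.
pose m1 := [the {measure set T -> \bar R} of mrestr P mkB].
pose m2 := [the {measure set T -> \bar R} of mscale (NngNum g0) P].
have -> : P A * gam B = m2 A by rewrite /m2 /= /mscale/= gE muleC.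
rewrite -[LHS]/(m1 A).
apply: (g_sigma_algebra_measure_unique (cylinders J) _ (fun=> setT)) => //.
- exact: cylinders_measurable.
- by move=> _; exact: cylinder_setT.
- by rewrite bigcup_const.
- exact: cylinders_setI.
- move=> _ [C [mC ->]]; rewrite /m1 /m2 /= /mrestr /mscale /= gE iid_cylinder//.
  pose K := (k |: J)%SET.
  pose D i := if i == k then B else C i.
  have -> : \bigcap_(i in [set i | i \in J]) (z i @^-1` C i) `&` z k @^-1` B =
      \bigcap_(i in [set i | i \in K]) (z i @^-1` D i).
    apply/seteqP; split => [t [Ct Bt] i /=|t Dt].
      rewrite /K in_setU1 /D /=; case: eqP => [->//|_ /= iJ]; exact: Ct.
    split => [i iJ|]; last first.
      by have := Dt k; rewrite /= /K setU11 /D /= eqxx; apply.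
    have := Dt i; rewrite /= /K in_setU1 (_ : i \in J = true)// orbT /D /=.
    case: eqP => [ik|_]; last exact.
    by move: kJ; rewrite -ik (_ : i \in J = true).
  rewrite iid_cylinder//; last by move=> i; rewrite /D; case: ifP.
  rewrite big_setU1//= /D eqxx; congr (_ * _); apply: eq_bigr => i iJ.
  by case: eqP => // ik; move: kJ; rewrite -ik iJ.
- by move=> _; rewrite /m1 /= /mrestr setTI (le_lt_trans (probability_le1 P mkB))// ltry.
Qed.

(** The space [T] with the smaller sigma-algebra [past J] serves as the state space of the past. By
    [past_indep] its joint law with [z k] is a product measure, and Tonelli's theorem applies. *)
Lemma past_integral (J : {set I}) k (h : past J * R -> \bar R) : k \notin J ->
  measurable_fun [set: past J * R] h -> (forall x, 0 <= h x) ->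
  \int[P]_t h (t, z k t) = \int[P]_t \int[gam]_x h (t, x).
Proof.
move=> kJ mh h0.
have mid : measurable_fun [set: T] (fun t : T => t : past J).
  by move=> _ A mA; rewrite setTI; exact: past_measurable mA.
pose h' : past J * measurableTypeR R -> \bar R := h.
have mh' : measurable_fun [set: past J * measurableTypeR R] h' := mh.
pose zk : T -> measurableTypeR R := z k.
have mzk : measurable_fun [set: T] zk := mz k.
have mpair : measurable_fun [set: T] (fun t : T => (t : past J, zk t)).
  exact: measurable_fun_pair.
pose idp : {mfun T >-> past J} := HB.pack (fun t : T => t : past J)
  (isMeasurableFun.Build _ _ _ _ _ mid).
pose zp : {mfun T >-> (past J * measurableTypeR R)%type} :=
  HB.pack (fun t : T => (t : past J, zk t)) (isMeasurableFun.Build _ _ _ _ _ mpair).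
have E X : measurable X -> (distribution P idp \x gam) X = distribution P zp X.
  apply: product_measure_unique => A B mA mB.
  exact: (past_indep kJ mA (mB : measurable (B : set R))).
rewrite -[LHS](ge0_integral_distribution zp mh' h0).
transitivity (\int[distribution P idp \x gam]_y h' y).
  by apply: eq_measure_integral => A mA _; exact/esym/E.
rewrite (fubini_tonelli1 (m1 := distribution P idp) (m2 := gam) h')//.
rewrite (ge0_integral_distribution idp)//.
- exact: (measurable_fun_fubini_tonelli_F (m2 := gam)).
- by move=> y; apply: integral_ge0 => x _.
Qed.

End past.

(** * Linear functionals of new coordinates with coefficients from the past *)

Section gaussian_halfline.
Context {R : realType}.
Local Open Scope ereal_scope.
Local Notation gam := (@normal_prob R 0 1).

(** The probability that a normal variable of mean [a] and variance [v] is positive. The degenerate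
    case [v = 0] is included and starts the induction of [past_functional]. *)
Definition halfline_prob (a v : R) : \bar R :=
  gam [set x | (0 < a + Num.sqrt v * x)%R].

Lemma measurable_sqrt (D : set R) : measurable_fun D (@Num.sqrt R).
Proof. by apply: measurable_funTS; apply: continuous_measurable_fun; exact: sqrt_continuous. Qed.

Lemma measurable_lt d (T : measurableType d) (f g : T -> R) :
  measurable_fun [set: T] f -> measurable_fun [set: T] g ->
  measurable [set t | (f t < g t)%R].
Proof.
move=> mf mg; rewrite -[X in measurable X]setTI.
exact: (measurable_fun_ltr mf mg measurableT (_ : measurable [set true])).
Qed.

Lemma measurable_le d (T : measurableType d) (f g : T -> R) :
  measurable_fun [set: T] f -> measurable_fun [set: T] g ->
  measurable [set t | (f t <= g t)%R].
Proof.
move=> mf mg; rewrite -[X in measurable X]setTI.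
exact: (measurable_fun_ler mf mg measurableT (_ : measurable [set true])).
Qed.

Lemma measurable_halfline_prob d (T : measurableType d) (a v : T -> R) :
  measurable_fun [set: T] a -> measurable_fun [set: T] v ->
  measurable_fun [set: T] (fun t => halfline_prob (a t) (v t)).
Proof.
move=> ma mv.
pose B : set (T * measurableTypeR R) := [set u | (0 < a u.1 + Num.sqrt (v u.1) * (u.2 : R))%R].
have mB : measurable B.
  apply: measurable_lt => //; apply: measurable_funD.
    exact: measurableT_comp.
  apply: measurable_funM => //.
  apply: measurableT_comp; first exact: measurable_sqrt.
  exact: measurableT_comp.
apply: eq_measurable_fun (measurable_fun_xsection gam mB) => t _ /=.
by rewrite /halfline_prob; congr (gam _); apply/seteqP; split => x;
  rewrite /xsection /= inE.
Qed.

Lemma halfline_prob_ge0 a v : 0 <= halfline_prob a v.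
Proof. exact: measure_ge0. Qed.

(* Rotating the independent pair turns [y x + sqrt v x'] into [sqrt (v + y^2) x]. *)
Lemma halfline_prob_conv (a y v : R) : (0 <= v)%R ->
  \int[gam]_x halfline_prob (a + y * x)%R v = halfline_prob a (v + y ^+ 2)%R.
Proof.
move=> v0.
have [w0|wN0] := eqVneq (v + y ^+ 2)%R 0%R.
  have v00 : v = 0%R by have := sqr_ge0 y; lra.
  have y0 : y = 0%R by apply/eqP; rewrite -sqrf_eq0; apply/eqP; lra.
  rewrite w0 v00 (eq_integral (cst (halfline_prob a 0))); last first.
    by move=> x _; rewrite y0 mul0r addr0.
  have g1 : gam [set: R] = 1 by exact: (probability_setT gam).
  by rewrite (integral_cst _ measurableT) [X in _ * X]g1 mule1.
set w := (v + y ^+ 2)%R in wN0 *.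
have wg : (0 < w)%R by rewrite lt_neqAle eq_sym wN0/= addr_ge0// sqr_ge0.
have sw : (0 < Num.sqrt w)%R by rewrite sqrtr_gt0.
have sw2 : (Num.sqrt w ^+ 2 = w)%R by rewrite sqr_sqrtr// ltW.
have sv2 : (Num.sqrt v ^+ 2 = v)%R by rewrite sqr_sqrtr.
pose c := (y / Num.sqrt w)%R; pose s := (- Num.sqrt v / Num.sqrt w)%R.
have cs : (c ^+ 2 + s ^+ 2 = 1)%R.
  by rewrite /c /s !exprMn sqrrN sv2 exprVn sw2 -mulrDl (addrC _ v) -/w divff.
have mD : measurable ([set u : R * R | (0 < a + Num.sqrt w * u.1)%R]).
  apply: measurable_lt => //; apply: measurable_funD => //.
  exact: measurable_funM.
have <- : (gam \x gam) [set u : R * R | (0 < a + Num.sqrt w * u.1)%R] = halfline_prob a w.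
  rewrite (_ : [set u | _] = [set x | (0 < a + Num.sqrt w * x)%R] `*` setT); last first.
    by apply/seteqP; split => [[x x']|[x x'] []] //=.
  rewrite product_measure1E//= ?probability_setT ?mule1//.
  by apply: measurable_lt => //; apply: measurable_funD => //; exact: measurable_funM.
rewrite -(gaussian_plane_rotate cs mD) /product_measure1 /=.
apply: eq_integral => x _ /=; rewrite /halfline_prob; congr (gam _).
have E x' : (a + Num.sqrt w * (c * x - s * x') = a + y * x + Num.sqrt v * x')%R.
  by rewrite /c /s; field; rewrite gt_eqF.
by apply/seteqP; split => x'; rewrite /xsection /= inE /= E.
Qed.

End gaussian_halfline.

Section past_functional.
Context d (T : measurableType d) (R : realType) (P : probability T R).
Context (I : finType) (z : I -> T -> R) (Pz : iid_std_normal P z).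
Local Open Scope ereal_scope.
Local Notation gam := (@normal_prob R 0 1).
Let mz : forall i, measurable_fun [set: T] (z i) := Pz.1.

(** Given the past, the functional is normal with mean [m] and variance the sum of the [y k ^+ 2].
    In the induction the first coordinate [k] joins the past and [y k * z k] joins the mean;
    integrating [z k] out then moves [y k ^+ 2] into the variance by [halfline_prob_conv]. *)
Lemma past_functional (ks : seq I) (J : {set I}) (E : set T) (m : T -> R)
    (y : I -> T -> R) :
  uniq ks -> (forall k, k \in ks -> k \notin J) ->
  measurable (E : set (past z J)) ->
  measurable_fun [set: past z J] m ->
  (forall k, measurable_fun [set: past z J] (y k)) ->
  P (E `&` [set t | (0 < m t + \sum_(k <- ks) y k t * z k t)%R]) =
  \int[P]_(t in E) halfline_prob (m t) (\sum_(k <- ks) y k t ^+ 2)%R.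
Proof.
elim: ks J m => [|k ks IH] J m.
  move=> _ _ mE mm _.
  have mE' := past_measurable mz mE.
  have mm' := measurable_fun_past mz mm.
  have mA : measurable [set t | (0 < m t)%R] by exact: measurable_lt.
  under eq_set do rewrite big_nil addr0.
  rewrite -[LHS]mul1e -integral_cst; last exact: measurableI.
  rewrite [LHS]integral_mkcond [RHS]integral_mkcond; apply: eq_integral => t _.
  rewrite !patchE in_setI big_nil /halfline_prob sqrtr0.
  case: (t \in E) => //=; rewrite [in RHS](_ : [set x | _] = [set x | 0 < m t]%R); last first.
    by apply/seteqP; split => x //=; rewrite mul0r addr0.
  case: ifPn => [|]; rewrite ?inE ?notin_setE /= => mt.
    by rewrite (_ : [set x | _] = setT) ?probability_setT//; apply/seteqP; split.
  by rewrite (_ : [set x | _] = set0) ?measure0//; apply/seteqP; split.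
move=> /= /andP[kks uks] kJ mE mm my.
have kNJ : k \notin J by apply: kJ; rewrite mem_head.
have JK : J \subset (k |: J)%SET by exact: finset.subsetUr.
have mE' := past_measurable mz mE.
under eq_set do rewrite big_cons addrA.
have kK j : j \in ks -> j \notin (k |: J)%SET.
  move=> jks; rewrite in_setU1 negb_or kJ ?andbT; last by rewrite inE jks orbT.
  by apply/eqP => jk; move: kks; rewrite -jk jks.
have mmK : measurable_fun [set: past z (k |: J)%SET] (fun t => m t + y k t * z k t)%R.
  apply: measurable_funD; first exact: (measurable_fun_past_subset JK).
  apply: measurable_funM; first exact: (measurable_fun_past_subset JK).
  by apply: measurable_coord_past; rewrite setU11.
have myK j : measurable_fun [set: past z (k |: J)%SET] (y j).
  exact: (measurable_fun_past_subset JK).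
rewrite (IH _ _ uks kK (past_subset JK mE) mmK myK).
pose S t := (\sum_(j <- ks) y j t ^+ 2)%R.
have mS : measurable_fun [set: past z J] S.
  by apply: measurable_sum => j; exact: measurable_funX.
pose h (u : past z J * R) := (\1_E u.1)%:E * halfline_prob (m u.1 + y k u.1 * u.2)%R (S u.1).
have mh : measurable_fun [set: past z J * R] h.
  apply: emeasurable_funM.
    by apply/measurable_EFinP; apply: measurableT_comp => //; exact: measurable_indic.
  apply: measurable_halfline_prob; last exact: measurableT_comp.
  apply: measurable_funD; first exact: measurableT_comp.
  by apply: measurable_funM => //; exact: measurableT_comp.
have h0 u : 0 <= h u by rewrite mule_ge0 ?lee_fin ?halfline_prob_ge0.
transitivity (\int[P]_t h (t, z k t)).
  rewrite integral_mkcond; apply: eq_integral => t _.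
  rewrite patchE /h /= indicE; case: ifP => _; first by rewrite mul1e.
  by rewrite mul0e.
rewrite (past_integral mz Pz kNJ mh h0) [RHS]integral_mkcond.
apply: eq_integral => t _; rewrite patchE /h /= indicE.
case: ifP => _; last by under eq_integral do rewrite mul0e; rewrite integral0.
under eq_integral do rewrite mul1e.
have S0 : (0 <= S t)%R by apply: sumr_ge0 => j _; exact: sqr_ge0.
by rewrite (halfline_prob_conv _ _ S0) big_cons addrC.
Qed.

End past_functional.

Section gaussian_tail_functional.
Context d (T : measurableType d) (R : realType) (P : probability T R).
Context (I : finType) (z : I -> T -> R) (Pz : iid_std_normal P z).
Local Notation gam := (@normal_prob R 0 1).
Let mz : forall i, measurable_fun [set: T] (z i) := Pz.1.

Definition gtail (tau : R) : R := fine (gam [set x | tau < x]).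

Lemma measurable_gt (tau : R) : measurable [set x : R | tau < x].
Proof. exact: measurable_lt. Qed.

Lemma measurable_affine_gt (a b : R) : measurable [set x : R | 0 < a + b * x].
Proof.
by apply: measurable_lt => //; apply: measurable_funD => //; exact: measurable_funM.
Qed.

Lemma EFin_gtail (tau : R) : (gtail tau)%:E = gam [set x | tau < x].
Proof.
rewrite /gtail fineK//; apply: fin_num_measure; exact: measurable_gt.
Qed.

Lemma gtail_ge0 (tau : R) : 0 <= gtail tau.
Proof. exact: fine_ge0. Qed.

Lemma EFin_fine_prob (A : set T) : measurable A -> (fine (P A))%:E = P A.
Proof. by move=> mA; rewrite fineK// fin_num_measure. Qed.

Context (ks : seq I) (J : {set I}) (E : set T) (y : I -> T -> R).
Hypotheses (uks : uniq ks) (kJ : forall k, k \in ks -> k \notin J).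
Hypotheses (mE : measurable (E : set (past z J))).
Hypotheses (my : forall k, measurable_fun [set: past z J] (y k)).

Let functional_event (tau : R) : [set t | tau < \sum_(k <- ks) y k t * z k t] =
  [set t | 0 < - tau + \sum_(k <- ks) y k t * z k t].
Proof. by apply/seteqP; split => t /=; rewrite addrC subr_gt0. Qed.

Lemma past_functional_eq (tau : R) :
  (forall t, E t -> \sum_(k <- ks) y k t ^+ 2 = 1) ->
  fine (P (E `&` [set t | tau < \sum_(k <- ks) y k t * z k t])) =
  fine (P E) * gtail tau.
Proof.
move=> y1; have mE' := past_measurable mz mE.
have PF := past_functional Pz uks kJ mE (measurable_cst (- tau)) my.
rewrite functional_event PF.
rewrite -[RHS]/(fine (fine (P E) * gtail tau)%:E) EFinM EFin_gtail EFin_fine_prob//.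
rewrite muleC -(integral_cst P mE'); apply: (congr1 fine).
apply: eq_integral => t; rewrite inE => Et /=.
rewrite y1// /halfline_prob sqrtr1; congr (gam _).
by apply/seteqP; split => x /=; rewrite mul1r addrC subr_gt0.
Qed.

(** For a nonnegative threshold the Gaussian tail increases with the variance, so the largest
    admissible variance bounds it. *)
Lemma past_functional_le (tau v : R) : 0 <= tau -> 0 < v ->
  (forall t, E t -> \sum_(k <- ks) y k t ^+ 2 <= v) ->
  fine (P (E `&` [set t | tau < \sum_(k <- ks) y k t * z k t])) <=
  gtail (tau / Num.sqrt v).
Proof.
move=> tau0 v0 y1; have mE' := past_measurable mz mE.
have PF := past_functional Pz uks kJ mE (measurable_cst (- tau)) my.
have mS : measurable_fun [set: past z J] (fun t => \sum_(k <- ks) y k t ^+ 2).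
  by apply: measurable_sum => j; exact: measurable_funX.
have mh := measurable_halfline_prob (measurable_cst (- tau)) (measurable_fun_past mz mS).
apply: (@le_trans _ _ (fine (P E) * gtail (tau / Num.sqrt v))); last first.
  rewrite ler_piMl ?gtail_ge0// -lee_fin EFin_fine_prob//.
  exact: probability_le1.
rewrite -lee_fin EFinM EFin_gtail !EFin_fine_prob//; last first.
  apply: measurableI => //; apply: measurable_lt => //.
  apply: measurable_sum => j.
  by apply: measurable_funM => //; exact: (measurable_fun_past mz (my j)).
rewrite functional_event PF muleC -(integral_cst P mE').
have mhE : measurable_fun E (fun t => halfline_prob (- tau) (\sum_(k <- ks) y k t ^+ 2)).
  exact: measurable_funTS.
have mcE : measurable_fun E (fun=> gam [set x | tau / Num.sqrt v < x]).
  exact: measurable_cst.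
have h0 t : E t -> (0 <= halfline_prob (- tau) (\sum_(k <- ks) y k t ^+ 2))%E.
  by move=> _; exact: halfline_prob_ge0.
have le_int := @ge0_le_integral _ _ _ P E mE' _ _ h0 mhE mcE.
apply: le_int => t Et; rewrite /halfline_prob /=.
apply: le_measure; rewrite ?inE; [exact: measurable_affine_gt|exact: measurable_gt|].
move=> x /=; rewrite addrC subr_gt0 ltr_pdivrMr ?sqrtr_gt0// => h.
apply: (lt_le_trans h); rewrite mulrC ler_wpM2l// ?ler_wsqrtr ?y1//.
rewrite leNgt; apply/negP => x0; move: h; apply/negP; rewrite -leNgt.
by apply: le_trans tau0; rewrite mulr_ge0_le0 ?sqrtr_ge0// ltW.
Qed.

End gaussian_tail_functional.

(** * Concentration of the squared norm of a Gaussian vector *)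

Section chi_square.
Context d (T : measurableType d) (R : realType) (P : probability T R).
Context (I : finType) (z : I -> T -> R) (Pz : iid_std_normal P z).
Local Notation gam := (@normal_prob R 0 1).
Let mz : forall i, measurable_fun [set: T] (z i) := Pz.1.

Lemma integral_iid_prod (ks : seq I) (f : R -> R) (c : R) : uniq ks ->
  measurable_fun [set: R] f -> (forall x, 0 <= f x) ->
  (\int[gam]_x (f x)%:E = c%:E)%E ->
  (\int[P]_t (\prod_(k <- ks) f (z k t))%:E = (c ^+ size ks)%:E)%E.
Proof.
move=> + mf f0 cE; elim: ks => [_|k ks IH /= /andP[kks uks]].
  under eq_integral do rewrite big_nil.
  by rewrite (integral_cst P measurableT) [X in (_ * X)%E](probability_setT P) mule1.
pose J := [set i | i \in ks]%SET.
have kNJ : k \notin J by rewrite finset.inE.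
have mz' : measurable_fun [set: past z J] (fun t => \prod_(k <- ks) f (z k t)).
  apply: measurable_prod => j jks; apply: measurableT_comp => //.
  by apply: measurable_coord_past; rewrite finset.inE.
pose h (u : past z J * R) := (\prod_(j <- ks) f (z j u.1) * f u.2)%:E.
have mh : measurable_fun [set: past z J * R] h.
  apply/measurable_EFinP; apply: measurable_funM; last exact: measurableT_comp.
  exact: (measurableT_comp mz').
have p0 t : 0 <= \prod_(k <- ks) f (z k t) by apply: prodr_ge0.
have h0 u : (0 <= h u)%E by rewrite lee_fin mulr_ge0.
transitivity (\int[P]_t h (t, z k t))%E.
  by apply: eq_integral => t _; rewrite big_cons /h /= mulrC.
have c0 : (0 <= c%:E)%E by rewrite -cE; apply: integral_ge0 => x _; rewrite lee_fin.
have mp : measurable_fun [set: T] (fun t => (\prod_(k <- ks) f (z k t))%:E).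
  by apply/measurable_EFinP; exact: (measurable_fun_past mz mz').
rewrite (past_integral mz Pz kNJ mh h0) exprSr EFinM -IH//.
rewrite -(ge0_integralZr P measurableT mp (fun t _ => p0 t) c0).
apply: eq_integral => t _; rewrite /h /=.
under eq_integral do rewrite EFinM.
have mf' : measurable_fun [set: R] (fun x => (f x)%:E) by exact/measurable_EFinP.
rewrite -cE; apply: (ge0_integralZl gam measurableT mf' (fun x _ => f0 x)).
by rewrite lee_fin.
Qed.

(** With [s = (1 - 2 th)^(-1/2)], the integrand times the standard density is [s] times the density
    of a centred normal law of standard deviation [s]. *)
Lemma integral_exp_sqr (th : R) : th < 2^-1 ->
  (\int[gam]_x (expR (th * x ^+ 2))%:E = ((Num.sqrt (1 - 2 * th))^-1)%:E)%E.
Proof.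
move=> th1; have s0 : 0 < 1 - 2 * th by lra.
pose s := (Num.sqrt (1 - 2 * th))^-1.
have s_gt0 : 0 < s by rewrite invr_gt0 sqrtr_gt0.
have s2 : s ^+ 2 = (1 - 2 * th)^-1 by rewrite /s exprVn sqr_sqrtr// ltW.
have me : measurable_fun [set: R] (fun x : R => (expR (th * x ^+ 2))%:E).
  by apply/measurable_EFinP/measurableT_comp => //; apply: measurable_funM => //.
have e0 (x : R) : (0 <= (expR (th * x ^+ 2))%:E)%E by rewrite lee_fin expR_ge0.
have mn : measurable_fun [set: R] (fun x : R => (normal_pdf 0 s x)%:E).
  by apply/measurable_EFinP; exact: measurable_normal_pdf.
have n0 (x : R) : [set: R] x -> (0 <= (normal_pdf 0 s x)%:E)%E.
  by rewrite lee_fin normal_pdf_ge0.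
rewrite (ge0_integral_normal_prob 0 1 me e0).
rewrite -/s -[RHS]mule1 -(integral_normal_pdf 0 s).
have sE0 : (0 <= s%:E)%E by rewrite lee_fin ltW.
rewrite -(ge0_integralZl lebesgue_measure measurableT mn n0 sE0).
apply: eq_integral => x _; rewrite -!EFinM; congr EFin.
rewrite normal_pdf01 normal_pdfE ?gt_eqF// /normal_fun subr0 /normal_peak expr1n.
rewrite mul1r -mulrnAr sqrtrM ?sqr_ge0// sqrtr_sqr gtr0_norm// invfM.
rewrite [RHS]mulrA (mulrA s) mulfV ?gt_eqF// mul1r mulrCA -expRD.
by congr (_ * expR _); rewrite s2; field; exact: lt0r_neq0.
Qed.

(** The expansion of [- ln (1 - 2 th) / 2] begins with [th + th ^+ 2]; doubling the quadratic
    coefficient pays for the remainder on this range. *)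
Lemma inv_sqrt_le_expR (th : R) : - 2^-1 <= th <= 8^-1 ->
  (Num.sqrt (1 - 2 * th))^-1 <= expR (th + 2 * th ^+ 2).
Proof.
move=> /andP[th0 th1]; have s0 : 0 < 1 - 2 * th by lra.
rewrite -[leLHS]mul1r ler_pdivrMr ?sqrtr_gt0//.
rewrite -(@ler_pXn2r _ 2)// ?nnegrE ?mulr_ge0 ?expR_ge0 ?sqrtr_ge0//.
rewrite exprMn sqr_sqrtr ?(ltW s0)// expr1n -expRM_natl.
(* After squaring, [expR y >= 1 + y] yields the product [1 - 8 th ^+ 3], which suffices only for
   [th <= 0]. For positive [th] the sharper [expR y >= (1 + y / 2) ^+ 2] is used. *)
have [thn|thp] := leP th 0.
  apply: (@le_trans _ _ ((1 + 2%:R * (th + 2 * th ^+ 2)) * (1 - 2 * th))); last first.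
    by rewrite ler_pM2r//; exact: expR_ge1Dx.
  have : 0 <= (- th) ^+ 3 by rewrite exprn_ge0//; lra.
  by rewrite exprNn => ?; lra.
rewrite expRM_natl; apply: (@le_trans _ _ ((1 + (th + 2 * th ^+ 2)) ^+ 2 * (1 - 2 * th))); last first.
  rewrite ler_pM2r// lerXn2r ?nnegrE ?expR_ge0 ?expR_ge1Dx//.
  by have := sqr_ge0 th; lra.
have -> : (1 + (th + 2 * th ^+ 2)) ^+ 2 * (1 - 2 * th) =
  1 + th ^+ 2 * (1 - 6 * th - 4 * th ^+ 2 - 8 * th ^+ 3) by ring.
rewrite lerDl mulr_ge0 ?sqr_ge0//.
have t2 : th ^+ 2 <= 8^-1 * 8^-1 by rewrite expr2 ler_pM// ltW.
have t3 : th ^+ 3 <= 8^-1 * (8^-1 * 8^-1) by rewrite exprS ler_pM ?sqr_ge0// ltW.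
by lra.
Qed.

(** Markov's inequality for the exponential moment. With [th] kept inside the event one statement
    serves both tails, a negative [th] giving the lower one. *)
Lemma chi_square_chernoff (ks : seq I) (th a : R) : uniq ks ->
  - 2^-1 <= th <= 8^-1 ->
  fine (P [set t | th * a <= th * \sum_(k <- ks) z k t ^+ 2]) <=
  expR ((size ks)%:R * (th + 2 * th ^+ 2) - th * a).
Proof.
move=> uks th8; have th2 : th < 2^-1 by case/andP: th8 => *; lra.
have mS : measurable_fun [set: T] (fun t => \sum_(k <- ks) z k t ^+ 2).
  by apply: measurable_sum => j; exact: measurable_funX.
set A := [set t | _].
have mA : measurable A by apply: measurable_le => //; exact: measurable_funM.
have me : measurable_fun [set: R] (fun x : R => expR (th * x ^+ 2)).
  by apply: measurableT_comp => //; apply: measurable_funM => //.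
have int := integral_iid_prod uks me (fun x => expR_ge0 _) (integral_exp_sqr th2).
rewrite -lee_fin EFin_fine_prob//.
have mp : measurable_fun [set: T] (fun t => (\prod_(k <- ks) expR (th * z k t ^+ 2))%:E).
  apply/measurable_EFinP; apply: measurable_prod => k _; exact: (measurableT_comp me).
have p0 t : (0 <= (\prod_(k <- ks) expR (th * z k t ^+ 2))%:E)%E.
  by rewrite lee_fin; apply: prodr_ge0 => k _; exact: expR_ge0.
have H : (P A <= \int[P]_t ((expR (- th * a))%:E * (\prod_(k <- ks) expR (th * z k t ^+ 2))%:E))%E.
  rewrite -[leLHS]mul1e -(integral_cst P mA) integral_mkcond.
  apply: ge0_le_integral => //.
  - by move=> t _; rewrite patchE; case: ifP => // _; rewrite lee_fin.
  - by apply/(measurable_restrictT _ mA); apply: measurable_cst.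
  - exact: emeasurable_funM.
  - move=> t _; rewrite patchE; case: ifPn => [|_]; last first.
      by rewrite mule_ge0// lee_fin expR_ge0.
    rewrite inE /A /= => h; rewrite -EFinM lee_fin -expR_sum -expRD -mulr_sumr.
    by rewrite -expR0 ler_expR mulNr addrC subr_ge0.
apply: (le_trans H); rewrite (ge0_integralZl P measurableT mp (fun t _ => p0 t)); last first.
  by rewrite lee_fin expR_ge0.
rewrite int -EFinM lee_fin expRD mulrC mulNr ler_pM2r ?expR_gt0//.
rewrite expRM_natl.
by rewrite lerXn2r ?nnegrE ?expR_ge0 ?invr_ge0 ?sqrtr_ge0 ?inv_sqrt_le_expR.
Qed.

Lemma fine_prob_le (A B : set T) : measurable A -> measurable B ->
  A `<=` B -> fine (P A) <= fine (P B).
Proof.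
move=> mA mB AB; apply: fine_le; rewrite ?fin_num_measure//.
by apply: le_measure; rewrite ?inE.
Qed.

Lemma chi_square_concentration (ks : seq I) (e : R) : uniq ks ->
  0 <= e <= 2^-1 ->
  fine (P [set t | (size ks)%:R * (1 + e) <= \sum_(k <- ks) z k t ^+ 2]) <=
    expR (- ((size ks)%:R * e ^+ 2 / 8)) /\
  fine (P [set t | \sum_(k <- ks) z k t ^+ 2 <= (size ks)%:R * (1 - e)]) <=
    expR (- ((size ks)%:R * e ^+ 2 / 8)).
Proof.
move=> uks /andP[e0 e1]; set n : R := (size ks)%:R.
have mS : measurable_fun [set: T] (fun t => \sum_(k <- ks) z k t ^+ 2).
  by apply: measurable_sum => j; exact: measurable_funX.
split.
  (* The exponent per coordinate is [2 th ^+ 2 - th e], minimal at [th = e / 4] with value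
     [- e ^+ 2 / 8]; the lower tail uses [th = - e / 4]. *)
  apply: (@le_trans _ _ (fine (P [set t | e / 4 * (n * (1 + e)) <=
      e / 4 * \sum_(k <- ks) z k t ^+ 2]))); last first.
    apply: (le_trans (@chi_square_chernoff ks _ _ uks _)); first by apply/andP; split; lra.
    by rewrite ler_expR -/n; lra.
  apply: fine_prob_le.
  - exact: measurable_le.
  - by apply: measurable_le => //; exact: measurable_funM.
  - by move=> t /= h; rewrite ler_wpM2l//; lra.
apply: (@le_trans _ _ (fine (P [set t | - e / 4 * (n * (1 - e)) <=
      - e / 4 * \sum_(k <- ks) z k t ^+ 2]))); last first.
  apply: (le_trans (@chi_square_chernoff ks _ _ uks _)); first by apply/andP; split; lra.
  by rewrite ler_expR -/n; lra.
apply: fine_prob_le.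
- exact: measurable_le.
- by apply: measurable_le => //; exact: measurable_funM.
- by move=> t /= h; rewrite ler_wnM2l//; lra.
Qed.

End chi_square.

(** * Orthogonal invariance of i.i.d. Gaussian families *)

Section pair_rotation.
Context {R : realType}.

Definition rotate_pair (K : eqType) (a b : K) (c s : R) (f : K -> R) (i : K) : R :=
  if i == a then c * f a + s * f b else
  if i == b then - s * f a + c * f b else f i.

Lemma rotate_pair_dot (K : finType) (a b : K) (c s : R) (f g : K -> R) :
  a != b -> c ^+ 2 + s ^+ 2 = 1 ->
  \sum_i rotate_pair a b c s f i * rotate_pair a b c s g i = \sum_i f i * g i.
Proof.
move=> ab cs; have ba : b != a by rewrite eq_sym.
rewrite (bigD1 a)//= (bigD1 b)//= [RHS](bigD1 a)//= [in RHS](bigD1 b)//= !addrA.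
congr (_ + _); last first.
  by apply: eq_bigr => i /andP[ia ib]; rewrite /rotate_pair (negbTE ia) (negbTE ib).
rewrite /rotate_pair eqxx (negbTE ba) eqxx.
have -> : (c * f a + s * f b) * (c * g a + s * g b) +
  (- s * f a + c * f b) * (- s * g a + c * g b) =
  (c ^+ 2 + s ^+ 2) * (f a * g a + f b * g b) by ring.
by rewrite cs mul1r.
Qed.

End pair_rotation.

Section iid_rotation.
Context d (T : measurableType d) (R : realType) (P : probability T R).
Context (I : finType).
Local Open Scope ereal_scope.
Local Notation gam := (@normal_prob R 0 1).
Implicit Types (z : I -> T -> R).

Lemma iid_of_cylinders z : (forall i, measurable_fun [set: T] (z i)) ->
  (forall A : I -> set R, (forall i, measurable (A i)) ->
    P (\bigcap_(i in [set: I]) (z i @^-1` A i)) = \prod_i gam (A i)) ->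
  iid_std_normal P z.
Proof.
move=> mz zA.
have marg i (A : set R) : measurable A -> P (z i @^-1` A) = gam A.
  move=> mA; pose B j := if j == i then A else setT.
  have -> : z i @^-1` A = \bigcap_(j in [set: I]) (z j @^-1` B j).
    apply/seteqP; split => [t At j _ /=|t /(_ i Logic.I)/=]; rewrite /B ?eqxx//.
    by case: eqP => // ->.
  rewrite zA; last by move=> j; rewrite /B; case: ifP.
  rewrite (bigD1 i)//= /B eqxx big1 ?mule1// => j /negbTE ->.
  exact: (probability_setT gam).
split => //; split => // A mA; rewrite zA//.
by apply: eq_bigr => i _; rewrite marg.
Qed.

(** The two coordinates are integrated out one after the other: [b] first, with [a] counted as past,
    and then [a]. *)
Lemma iid_pair z (J : {set I}) (a b : I) (C : set T) (B : set (R * R)) :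
  iid_std_normal P z -> a != b -> a \notin J -> b \notin J ->
  measurable (C : set (past z J)) -> measurable B ->
  P (C `&` [set t | B (z a t, z b t)]) = P C * (gam \x gam) B.
Proof.
move=> Pz ab aJ bJ mC mB; have mz := Pz.1.
have mC' := past_measurable mz mC.
have bJ' : b \notin (a |: J)%SET by rewrite in_setU1 negb_or eq_sym ab.
have JK : J \subset (a |: J)%SET by exact: finset.subsetUr.
have mA : measurable [set t | B (z a t, z b t)].
  rewrite -[X in measurable X]setTI.
  exact: (measurable_fun_pair (mz a) (mz b)).
have mza : measurable_fun [set: past z (a |: J)%SET] (z a).
  by apply: measurable_coord_past; rewrite setU11.
have mB1 : measurable_fun [set: R * R] (\1_B : R * R -> R).
  exact: measurable_indic.
pose h (u : past z (a |: J)%SET * R) : \bar R := (\1_C u.1)%:E * (\1_B (z a u.1, u.2))%:E.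
have mh : measurable_fun [set: past z (a |: J)%SET * R] h.
  apply: emeasurable_funM; apply/measurable_EFinP.
    apply: measurableT_comp => //; apply: measurable_indic.
    exact: (past_subset JK).
  have mp : measurable_fun [set: past z (a |: J)%SET * R]
      (fun u => (z a u.1, u.2) : R * R).
    by apply: measurable_fun_pair => //; exact: measurableT_comp.
  exact: (measurableT_comp mB1 mp).
have h0 u : 0 <= h u by rewrite mule_ge0.
have mx : measurable_fun [set: measurableTypeR R] (fun x => gam (xsection B x)).
  exact: (measurable_fun_xsection gam (mB : measurable (B : set (measurableTypeR R * measurableTypeR R)))).
have mx2 : measurable_fun [set: R] (fun x => gam (xsection B x)) := mx.
pose g (u : past z J * R) : \bar R := (\1_C u.1)%:E * gam (xsection B u.2).
have mg : measurable_fun [set: past z J * R] g.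
  apply: emeasurable_funM; last exact: (measurableT_comp mx2 measurable_snd).
  apply/measurable_EFinP.
  by apply: measurableT_comp => //; apply: measurable_indic.
have g0 u : 0 <= g u by rewrite mule_ge0 ?lee_fin ?measure_ge0.
transitivity (\int[P]_t h (t, z b t)).
  rewrite -[LHS]mul1e -(integral_cst P (measurableI _ _ mC' mA)) integral_mkcond.
  apply: eq_integral => t _; rewrite patchE in_setI /h /= !indicE.
  have -> : (t \in [set t | B (z a t, z b t)]) = ((z a t, z b t) \in B).
    by apply/idP/idP; rewrite !inE.
  by case: (t \in C); case: (_ \in B); rewrite -EFinM ?mulr1 ?mulr0 ?mul0r.
rewrite (past_integral mz Pz bJ' mh h0).
transitivity (\int[P]_t g (t, z a t)).
  apply: eq_integral => t _; rewrite /h /g /=.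
  have mi : measurable_fun [set: R] (fun x => (\1_B (z a t, x) : R)%:E).
    apply/measurable_EFinP.
    have mp : measurable_fun [set: R] (fun x => (z a t, x) : R * R).
      exact: measurable_fun_pair.
    exact: (measurableT_comp mB1 mp).
  have i0 (x : R) : [set: R] x -> 0 <= (\1_B (z a t, x) : R)%:E by rewrite lee_fin.
  rewrite (ge0_integralZl gam measurableT mi i0) ?lee_fin//; congr (_ * _).
  have mxs : measurable (xsection B (z a t)) by exact: measurable_xsection.
  rewrite -[RHS]mul1e -(integral_cst gam mxs) [RHS]integral_mkcond.
  apply: eq_integral => x _; rewrite patchE indicE mem_xsection.
  by case: (_ \in B).
rewrite (past_integral mz Pz aJ mg g0) /g /=.
have mg' : measurable_fun [set: R] (fun x => gam (xsection B x)) by [].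
have p0 : 0 <= (gam \x gam) B by exact: measure_ge0.
transitivity (\int[P]_t ((\1_C t)%:E * (gam \x gam) B)).
  apply: eq_integral => t _.
  by rewrite (ge0_integralZl gam measurableT mx) ?lee_fin.
have mi : measurable_fun [set: T] (fun t => (\1_C t : R)%:E).
  by apply/measurable_EFinP; exact: measurable_indic.
have i0 t : [set: T] t -> 0 <= (\1_C t : R)%:E by rewrite lee_fin.
rewrite (ge0_integralZr P measurableT mi i0 p0); congr (_ * _).
by rewrite (integral_indic P measurableT mC') setIT.
Qed.

(** In the product rule only the factors of [a] and [b] are affected: they merge into a rotated
    rectangle, whose measure is that of the rectangle, while the other coordinates form a
    cylinder. *)
Lemma iid_rotate_pair z (a b : I) (c s : R) :
  a != b -> (c ^+ 2 + s ^+ 2 = 1)%R -> iid_std_normal P z ->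
  iid_std_normal P (fun i t => rotate_pair a b c s (z ^~ t) i).
Proof.
move=> ab cs Pz; have mz := Pz.1.
have ba : b == a = false by rewrite eq_sym (negbTE ab).
apply: iid_of_cylinders => [i|A mA].
  rewrite /rotate_pair; case: (i == a); last case: (i == b) => //.
    by apply: measurable_funD; exact: measurable_funM.
  by apply: measurable_funD; exact: measurable_funM.
pose J := [set i | (i != a) && (i != b)]%SET.
pose C := \bigcap_(i in [set i | i \in J]) (z i @^-1` A i).
pose B := [set u : R * R | (A a `*` A b) (c * u.1 - - s * u.2, - s * u.1 + c * u.2)%R].
have -> : \bigcap_(i in [set: I]) ((fun t => rotate_pair a b c s (z^~ t) i) @^-1` A i) =
    C `&` [set t | B (z a t, z b t)].
  apply/seteqP; split => [t At|t [Ct [/= Ba Bb]] i _ /=].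
    split => [i|]; last split.
    - rewrite /J /= finset.inE => /andP[ia ib].
      by have := At i Logic.I; rewrite /= /rotate_pair (negbTE ia) (negbTE ib).
    - by have := At a Logic.I; rewrite /= /rotate_pair eqxx mulNr opprK.
    - by have := At b Logic.I; rewrite /= /rotate_pair ba eqxx.
  rewrite /rotate_pair; case: eqP => [->|/eqP ia]; first by rewrite mulNr opprK in Ba.
  case: eqP => [->//|/eqP ib]; apply: Ct; by rewrite /J /= finset.inE ia ib.
have cs' : (c ^+ 2 + (- s) ^+ 2 = 1)%R by rewrite sqrrN.
have mAB : measurable (A a `*` A b) by exact: measurableX.
have mB : measurable B.
  rewrite -[X in measurable X]setTI.
  have mrot : measurable_fun [set: R * R] (fun u : R * R =>
      (c * u.1 - - s * u.2, - s * u.1 + c * u.2)%R).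
    apply: measurable_fun_pair.
      by apply: measurable_funB; apply: measurable_funM.
    by apply: measurable_funD; apply: measurable_funM.
  exact: mrot.
have aJ : a \notin J by rewrite finset.inE eqxx.
have bJ : b \notin J by rewrite finset.inE eqxx andbF.
have mC : measurable (C : set (past z J)).
  by apply: sub_sigma_algebra; exists A.
rewrite (iid_pair Pz ab aJ bJ mC mB) (gaussian_plane_rotate cs' mAB).
rewrite /C iid_cylinder// [RHS](bigD1 a)//= [in RHS](bigD1 b) ?ba//=.
rewrite product_measure1E; [|exact: mA|exact: mA].
rewrite muleC -muleA; congr (_ * (_ * _)).
by apply: eq_bigl => i; rewrite finset.inE.
Qed.

(** The half turn of the plane, applied to the strip over [A], negates the first coordinate. *)
Lemma gaussian_opp (A : set R) : measurable A -> gam [set x | A (- x)%R] = gam A.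
Proof.
move=> mA.
have cs : ((-1) ^+ 2 + 0 ^+ 2 = 1 :> R)%R by rewrite sqrrN expr1n expr0n addr0.
have mAT : measurable (A `*` [set: R]) by exact: measurableX.
have mNA : measurable [set x | A (- x)%R].
  have mN : measurable_fun [set: R] (fun x : R => - x)%R by exact: measurable_funN.
  by rewrite -[X in measurable X]setTI; exact: mN.
have g1 : gam [set: R] = 1 by exact: (probability_setT gam).
have <- : (gam \x gam) (A `*` [set: R]) = gam A.
  by rewrite product_measure1E; [rewrite [X in _ * X]g1 mule1|by []|by []].
have <- : (gam \x gam) ([set x | A (- x)%R] `*` [set: R]) = gam [set x | A (- x)%R].
  by rewrite product_measure1E; [rewrite [X in _ * X]g1 mule1|by []|by []].
rewrite -(gaussian_plane_rotate cs mAT); congr ((gam \x gam) _).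
by apply/seteqP; split => [[x y]|[x y]] /=; rewrite mul0r subr0 mulN1r.
Qed.

Lemma iid_sign z (eps : I -> bool) : iid_std_normal P z ->
  iid_std_normal P (fun i t => (-1) ^+ eps i * z i t)%R.
Proof.
move=> Pz; have mz := Pz.1; apply: iid_of_cylinders => [i|A mA].
  exact: measurable_funM.
pose B i := if eps i then [set x | A i (- x)%R] else A i.
have mB i : measurable (B i).
  rewrite /B; case: ifP => // _.
  have mN : measurable_fun [set: R] (fun x : R => - x)%R by exact: measurable_funN.
  by rewrite -[X in measurable X]setTI; exact: mN.
transitivity (P (\bigcap_(i in [set i | i \in [set: I]%SET]) (z i @^-1` B i))).
  congr (P _); apply/seteqP; split => t At i _.
    by have := At i Logic.I; rewrite /= /B; case: (eps i); rewrite ?mulN1r ?mul1r.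
  have := At i; rewrite /= finset.inE => /(_ isT).
  by rewrite /B; case: (eps i); rewrite ?mulN1r ?mul1r.
rewrite iid_cylinder//; apply: eq_big => [i|i _]; first by rewrite finset.inE.
by rewrite /B; case: (eps i) => //; rewrite gaussian_opp.
Qed.

End iid_rotation.

Section orthogonal_invariance.
Context d (T : measurableType d) (R : realType) (P : probability T R).
Context (n p : nat).
Implicit Types (z : 'I_n * 'I_p -> T -> R) (N : 'I_p -> 'I_p -> R).

(** Quantified over all families [z], because simplifying [N] replaces [z] by a rotated or reflected
    family. *)
Definition iid_preserving N := forall z, iid_std_normal P z ->
  iid_std_normal P (fun kj t => \sum_l N kj.2 l * z (kj.1, l) t).

Definition orthonormal_rows N := forall i j, \sum_l N i l * N j l = (i == j)%:R.

Lemma iid_rotate_columns z (a b : 'I_p) (c s : R) :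
  a != b -> c ^+ 2 + s ^+ 2 = 1 -> iid_std_normal P z ->
  iid_std_normal P (fun kj t => rotate_pair a b c s (fun l => z (kj.1, l) t) kj.2).
Proof.
move=> ab cs Pz.
(* Every sample [k] needs its own plane rotation, of the coordinates [(k, a)] and [(k, b)]; [ks]
   lists the samples already treated. *)
pose zz (ks : seq 'I_n) (kj : 'I_n * 'I_p) t :=
  if kj.1 \in ks then rotate_pair a b c s (fun l => z (kj.1, l) t) kj.2 else z kj t.
suff H ks : uniq ks -> iid_std_normal P (zz ks).
  have := H (enum 'I_n) (enum_uniq _); congr iid_std_normal.
  by apply/funext => kj; apply/funext => t; rewrite /zz mem_enum.
elim: ks => [_|k ks IH /= /andP[kks uks]].
  rewrite (_ : zz [::] = z)//.
have kab : (k, a) != (k, b) by rewrite xpair_eqE eqxx.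
have := iid_rotate_pair kab cs (IH uks); congr iid_std_normal.
apply/funext => -[k' j]; apply/funext => t; rewrite /zz /rotate_pair /= !xpair_eqE inE.
rewrite (negbTE kks); case: eqP => [->|_] //=.
by rewrite (negbTE kks).
Qed.

(** Rotating the rows of [N] and the vectors of [z] together leaves their inner products unchanged,
    so a rotation may be moved from [N] to [z]. *)
Lemma iid_preserving_rotate N (a b : 'I_p) (c s : R) :
  a != b -> c ^+ 2 + s ^+ 2 = 1 ->
  iid_preserving (fun i => rotate_pair a b c s (N i)) -> iid_preserving N.
Proof.
move=> ab cs HN z Pz.
have := HN _ (iid_rotate_columns ab cs Pz); congr iid_std_normal.
apply/funext => -[k i]; apply/funext => t /=.
exact: (rotate_pair_dot (N i) (fun l => z (k, l) t) ab cs).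
Qed.

Lemma orthonormal_rows_rotate N (a b : 'I_p) (c s : R) :
  a != b -> c ^+ 2 + s ^+ 2 = 1 -> orthonormal_rows N ->
  orthonormal_rows (fun i => rotate_pair a b c s (N i)).
Proof. by move=> ab cs oN i j; rewrite rotate_pair_dot. Qed.

Lemma iid_preserving_sign N (e : 'I_p -> bool) :
  iid_preserving (fun i l => (-1) ^+ e l * N i l) -> iid_preserving N.
Proof.
move=> HN z Pz.
have := HN _ (iid_sign (fun kj => e kj.2) Pz); congr iid_std_normal.
apply/funext => -[k i]; apply/funext => t /=; apply: eq_bigr => l _.
by rewrite mulrACA -signr_addb addbb mul1r.
Qed.

(* Column rotations turn the rows into basis vectors one after the other. *)
Lemma iid_preserving_orthogonal N : orthonormal_rows N -> iid_preserving N.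
Proof.
(* Induction on the number [m] of rows that are not yet basis vectors. *)
suff H m k : (k + m = p)%N -> forall N, orthonormal_rows N ->
    (forall i l : 'I_p, (i < k)%N -> N i l = (i == l)%:R) -> iid_preserving N.
  by move=> oN; apply: (H p 0%N) => // N' oN'.
move=> {N}.
elim: m k => [|m IH] k.
  rewrite addn0 => kp N oN Nd z Pz.
  suff -> : (fun kj t => \sum_l N kj.2 l * z (kj.1, l) t) = z by [].
  apply/funext => -[a i]; apply/funext => t /=.
  rewrite (bigD1 i)//= Nd ?kp// eqxx mul1r big1 ?addr0// => l li.
  by rewrite Nd ?kp// eq_sym (negbTE li) mul0r.
rewrite addnS -addSn => kmp N oN Nd.
have kp : (k < p)%N by rewrite -kmp leq_addr.
pose k0 := Ordinal kp.
(* Givens elimination inside row [k0]: besides [k0] itself, only the columns in [s] may still carry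
   a nonzero entry. *)
suff H (s : seq 'I_p) : k0 \notin s -> (forall j : 'I_p, j \in s -> (k < j)%N) ->
    forall N, orthonormal_rows N ->
    (forall i l : 'I_p, (i < k)%N -> N i l = (i == l)%:R) ->
    (forall l, l != k0 -> l \notin s -> N k0 l = 0) -> iid_preserving N.
  apply: (H [seq j : 'I_p <- enum 'I_p | (k < j)%N] _ _ N oN Nd).
  - by rewrite mem_filter ltnn.
  - by move=> j; rewrite mem_filter => /andP[].
  (* For [l < k] the entry vanishes by orthogonality to row [l], which is already a basis vector. *)
  - move=> l lk; rewrite mem_filter mem_enum andbT -leqNgt leq_eqVlt => /orP[/eqP lk'|lk'].
      by move: lk; rewrite (_ : l = k0) ?eqxx//; exact: val_inj.
    have := oN l k0; rewrite (negbTE lk) (bigD1 l)//= Nd// eqxx mul1r big1 ?addr0// => j jl.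
    by rewrite Nd// eq_sym (negbTE jl) mul0r.
move=> {N oN Nd}.
elim: s => [_ _ N oN Nd N0|j s IHs ks js N oN Nd N0].
  (* Row [k0] is now supported on column [k0], hence a basis vector up to sign; a sign change of
     that column finishes it. *)
  have N1 : N k0 k0 ^+ 2 = 1.
    have := oN k0 k0; rewrite eqxx (bigD1 k0)//= big1 ?addr0 ?expr2// => l lk.
    by rewrite N0// mul0r.
  have row l : (-1) ^+ ((l == k0) && (N k0 k0 < 0)) * N k0 l = (k0 == l)%:R.
    have [->|lk] := eqVneq l k0; last by rewrite (N0 l)// mulr0.
    move/eqP: N1 => /=; rewrite sqrf_eq1 => /orP[] /eqP ->.
      by rewrite ltr10 mulr1.
    by rewrite ltrN10 expr1 mulrNN mul1r.
  apply: (@iid_preserving_sign _ (fun l => (l == k0) && (N k0 k0 < 0))).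
  apply: (IH k.+1) => //.
    move=> i j; rewrite -(oN i j); apply: eq_bigr => l _.
    by rewrite mulrACA -signr_addb addbb mul1r.
  move=> i l; rewrite ltnS leq_eqVlt => /orP[/eqP ik|ik].
    by rewrite (_ : i = k0) ?row//; exact: val_inj.
  rewrite (Nd i l)//; have [il|_] := eqVneq i l; last by rewrite mulr0.
  by rewrite (_ : (l == k0) = false) ?mulr1//; apply/eqP => lk; move: ik; rewrite il lk ltnn.
move: ks; rewrite inE negb_or => /andP[kj ks].
have [Nj0|NjN0] := eqVneq (N k0 j) 0.
  apply: IHs => //; first by move=> i si; apply: js; rewrite inE si orbT.
  move=> l lk ls; have [->//|lj] := eqVneq l j.
  by apply: N0 => //; rewrite inE negb_or lj.
(* The rotation of the columns [k0] and [j] that collects the weight of both entries in column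
   [k0]. *)
pose q := N k0 k0 ^+ 2 + N k0 j ^+ 2.
have q0 : 0 < q.
  rewrite /q addrC ltr_pwDl ?sqr_ge0//.
  by rewrite lt_neqAle sqr_ge0 andbT eq_sym sqrf_eq0.
have sq : Num.sqrt q != 0 by rewrite gt_eqF// sqrtr_gt0.
pose c := N k0 k0 / Num.sqrt q; pose s' := N k0 j / Num.sqrt q.
have cs : c ^+ 2 + s' ^+ 2 = 1.
  by rewrite /c /s' !exprMn exprVn sqr_sqrtr ?ltW// -mulrDl divff// gt_eqF.
apply: (iid_preserving_rotate kj cs); apply: IHs => //.
- by move=> i si; apply: js; rewrite inE si orbT.
- exact: orthonormal_rows_rotate.
(* The finished rows vanish in the columns [k0] and [j], so the rotation leaves them alone. *)
- move=> i l ik.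
  have ikF : (i == k0) = false by apply/eqP => ik'; move: ik; rewrite ik' ltnn.
  have ijF : (i == j) = false.
    apply/eqP => ij; have := js j (mem_head _ _).
    by rewrite -ij ltnNge (ltnW ik).
  rewrite /rotate_pair !Nd// ikF ijF.
  case: (eqVneq l k0) => [->|_]; first by rewrite ikF !mulr0 addr0.
  by case: (eqVneq l j) => [->|_] //; rewrite ijF !mulr0 addr0.
- move=> l lk ls; rewrite /rotate_pair (negbTE lk).
  have [_|lj] := eqVneq l j.
    by rewrite /c /s'; field.
  by apply: N0 => //; rewrite inE negb_or lj.
Qed.

End orthogonal_invariance.

(** * Exposing the columns one at a time *)

Section real_probability.
Context d (T : measurableType d) (R : realType) (P : probability T R).
Implicit Types A B : set T.

Definition pr A : R := fine (P A).

Lemma EFin_pr A : measurable A -> (pr A)%:E = P A.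
Proof. exact: EFin_fine_prob. Qed.

Lemma pr_ge0 A : 0 <= pr A.
Proof. exact: fine_ge0. Qed.

Lemma pr_le1 A : measurable A -> pr A <= 1.
Proof. by move=> mA; rewrite -lee_fin EFin_pr//; exact: probability_le1. Qed.

Lemma pr_le A B : measurable A -> measurable B -> A `<=` B -> pr A <= pr B.
Proof. exact: fine_prob_le. Qed.

Lemma pr_set0 : pr set0 = 0.
Proof. by rewrite /pr measure0. Qed.

Lemma prUI A B : measurable A -> measurable B ->
  pr (A `|` B) + pr (A `&` B) = pr A + pr B.
Proof.
move=> mA mB; have mAB := measurableI _ _ mA mB.
have mD : measurable (B `\` A) by exact: measurableD.
have E1 : P (A `|` B) = (P A + P (B `\` A))%E.
  rewrite -measureU//; last by rewrite setDE setICA setICr setI0.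
  by rewrite setUDr setDv setD0.
have E2 : P B = (P (A `&` B) + P (B `\` A))%E.
  rewrite -measureU//.
    congr (P _); apply/seteqP; split => [t Bt|t [[]|[]]//].
    by have [At|NAt] := pselect (A t); [left|right].
  by apply/seteqP; split => // t [[At _] [_ /(_ At)]].
apply: EFin_inj; rewrite !EFinD !EFin_pr//; last exact: measurableU.
by rewrite E1 E2 -addeA; congr (_ + _)%E; rewrite addeC.
Qed.

Lemma prU_le A B : measurable A -> measurable B -> pr (A `|` B) <= pr A + pr B.
Proof. by move=> mA mB; rewrite -prUI// lerDl pr_ge0. Qed.

Lemma pr_bigU_le (m : nat) (B : nat -> set T) :
  (forall i, (i < m)%N -> measurable (B i)) ->
  pr (\big[setU/set0]_(i < m) B i) <= \sum_(i < m) pr (B i).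
Proof.
elim: m => [_|m IH mB]; first by rewrite !big_ord0 pr_set0.
rewrite !big_ord_recr/=; apply: (le_trans (prU_le _ _)).
- by apply: bigsetU_measurable => i _; apply: mB; rewrite ltnS ltnW.
- exact: mB.
- by rewrite lerD2r IH// => i im; apply: mB; rewrite ltnS ltnW.
Qed.

Lemma bonferroni (m : nat) (B : nat -> set T) :
  (forall i, (i < m)%N -> measurable (B i)) ->
  \sum_(i < m) pr (B i) - \sum_(k < m) \sum_(i < k) pr (B i `&` B k) <=
  pr (\big[setU/set0]_(i < m) B i).
Proof.
elim: m => [_|m IH mB]; first by rewrite !big_ord0 subr0 pr_set0.
have mB' i : (i < m)%N -> measurable (B i) by move=> im; apply: mB; rewrite ltnS ltnW.
have mm : measurable (B m) by exact: mB.
have mU : measurable (\big[setU/set0]_(i < m) B i).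
  by apply: bigsetU_measurable => i _; exact: mB'.
rewrite !big_ord_recr/=.
have := prUI mU mm; have := IH mB'.
have : pr (\big[setU/set0]_(i < m) B i `&` B m) <= \sum_(i < m) pr (B i `&` B m).
  rewrite big_distrl/=; apply: (@pr_bigU_le m (fun i => B i `&` B m)) => i im.
  by apply: measurableI => //; exact: mB'.
by lra.
Qed.

Lemma measurable_forall_lt (m : nat) (B : nat -> set T) :
  (forall i, (i < m)%N -> measurable (B i)) ->
  measurable [set t | forall i, (i < m)%N -> B i t].
Proof.
move=> mB; rewrite (_ : [set t | _] = \bigcap_(i in `I_m) B i)//.
by apply: fin_bigcap_measurable.
Qed.

Lemma bigsetU_ltP (m : nat) (B : nat -> set T) t :
  (\big[setU/set0]_(i < m) B i) t <-> exists2 i, (i < m)%N & B i t.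
Proof.
rewrite -bigcup_mkord; split => [[i im Bi]|[i im Bi]]; by exists i.
Qed.

End real_probability.

(** * Nearly multiplicative recursions *)

Section recursions.
Context {R : realType}.
Implicit Types (a q : nat -> R).

(** For [0 <= q <= Q < 1] the factor [1 - q] is at least [expR (- (q / (1 - Q)))], which turns the
    product into an exponential. The error [b] is paid once at the start and at most once per
    step. *)
Lemma recursion_lower a q (Q b : R) (m : nat) : 0 <= b -> Q < 1 ->
  (forall j, (j < m)%N -> 0 <= q j <= Q) -> 1 - b <= a 0%N ->
  (forall j, (j < m)%N -> (1 - q j) * a j - b <= a j.+1) ->
  expR (- (\sum_(j < m) q j / (1 - Q))) - m.+1%:R * b <= a m.
Proof.
move=> b0 Q1; elim: m => [_ a0 _|m IH q0 a0 aS].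
  by rewrite big_ord0 oppr0 expR0 mul1r.
have {}IH := IH (fun j jm => q0 j (ltnW jm)) a0 (fun j jm => aS j (ltnW jm)).
have := aS m (ltnSn m); have /andP[qm0 qmQ] := q0 m (ltnSn m).
apply: le_trans; rewrite big_ord_recr/= opprD expRD.
set E := expR (- (\sum_(j < m) _)) in IH *.
have E0 : 0 <= E by exact: expR_ge0.
have q1 : 0 < 1 - Q by lra.
have eq : expR (- (q m / (1 - Q))) <= 1 - q m.
  rewrite expRN -[leRHS]invrK lef_pV2 ?posrE ?expR_gt0 ?invr_gt0//; last lra.
  apply: le_trans (expR_ge1Dx _).
  rewrite -(ler_pM2r (_ : 0 < 1 - q m)) ?mulVf; [|lra|lra].
  rewrite -(ler_pM2r q1) mul1r mulrAC mulrDl mul1r divfK; last lra.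
  rewrite mulrDl.
  have : 0 <= q m * (Q - q m) by rewrite mulr_ge0//; lra.
  by lra.
have H1 : (1 - q m) * (E - m.+1%:R * b) <= (1 - q m) * a m.
  by rewrite ler_wpM2l//; lra.
have H2 : E * expR (- (q m / (1 - Q))) <= E * (1 - q m) by rewrite ler_wpM2l.
have H3 : 0 <= q m * (m.+1%:R * b) by rewrite !mulr_ge0.
rewrite (_ : m.+2%:R = m.+1%:R + 1 :> R); last by rewrite -natr1.
by lra.
Qed.

Lemma recursion_upper a q (b : R) (m : nat) : 0 <= b ->
  (forall j, (j < m)%N -> 0 <= q j <= 1) -> a 0%N <= 1 ->
  (forall j, (j < m)%N -> a j.+1 <= (1 - q j) * a j + b) ->
  a m <= expR (- (\sum_(j < m) q j)) + m%:R * b.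
Proof.
move=> b0; elim: m => [_ a0 _|m IH q0 a0 aS].
  by rewrite big_ord0 oppr0 expR0 mul0r addr0.
have {}IH := IH (fun j jm => q0 j (ltnW jm)) a0 (fun j jm => aS j (ltnW jm)).
have := aS m (ltnSn m); have /andP[qm0 qm1] := q0 m (ltnSn m).
move=> /le_trans; apply; rewrite big_ord_recr/= opprD expRD.
set E := expR (- (\sum_(j < m) _)) in IH *.
have E0 : 0 <= E by exact: expR_ge0.
have eq : 1 - q m <= expR (- q m) by exact: expR_ge1Dx.
have H1 : (1 - q m) * a m <= (1 - q m) * (E + m%:R * b).
  by rewrite ler_wpM2l//; lra.
have H2 : E * (1 - q m) <= E * expR (- q m) by rewrite ler_wpM2l.
have H3 : 0 <= q m * (m%:R * b) by rewrite !mulr_ge0.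
rewrite (_ : m.+1%:R = m%:R + 1 :> R); last by rewrite -natr1.
by lra.
Qed.

End recursions.

(** * Deterministic estimates for one step of the autoregression *)

Section geometry.
Context {R : realType} (n : nat).
Implicit Types (f g : 'I_n -> R) (x w : nat -> 'I_n -> R).

Definition dot f g := \sum_k f k * g k.

Lemma dot_ge0 f : 0 <= dot f f.
Proof. by apply: sumr_ge0 => k _; rewrite -expr2 sqr_ge0. Qed.

Definition norm2 f := Num.sqrt (dot f f).

Lemma norm2_sqr f : norm2 f ^+ 2 = dot f f.
Proof. by rewrite sqr_sqrtr// dot_ge0. Qed.

Lemma norm2_ge0 f : 0 <= norm2 f.
Proof. exact: sqrtr_ge0. Qed.

Definition corr f g := dot f g / Num.sqrt (dot f f * dot g g).

Definition direction f : 'I_n -> R := fun k => f k / norm2 f.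

Lemma dotC f g : dot f g = dot g f.
Proof. by apply: eq_bigr => k _; rewrite mulrC. Qed.

Lemma dot_direction f g : dot (direction f) g = dot f g / norm2 f.
Proof. by rewrite /dot mulr_suml; apply: eq_bigr => k _; rewrite mulrAC. Qed.

Lemma corrE f g : corr f g = dot (direction f) g / norm2 g.
Proof. by rewrite /corr sqrtrM ?dot_ge0// dot_direction invfM mulrA. Qed.

Lemma dot_direction_corr f g : 0 < norm2 g ->
  dot (direction f) g = corr f g * norm2 g.
Proof. by move=> g0; rewrite corrE divfK// gt_eqF. Qed.

Lemma dot_direction_self f : 0 < norm2 f -> dot (direction f) f = norm2 f.
Proof.
by move=> f0; rewrite dot_direction -norm2_sqr expr2 mulfK// gt_eqF.
Qed.

Lemma sum_direction_sqr f : 0 < norm2 f -> \sum_k direction f k ^+ 2 = 1.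
Proof.
move=> f0; transitivity (dot (direction f) f / norm2 f).
  rewrite /dot mulr_suml; apply: eq_bigr => k _.
  by rewrite /direction expr2 mulrA.
by rewrite dot_direction_self// divff// gt_eqF.
Qed.

Lemma sum_direction_add_sqr f g : 0 < norm2 f -> 0 < norm2 g ->
  \sum_k (direction f k + direction g k) ^+ 2 = 2 + 2 * corr f g.
Proof.
move=> f0 g0; have E : \sum_k direction f k * direction g k = corr f g.
  rewrite corrE /dot mulr_suml; apply: eq_bigr => k _.
  by rewrite /direction mulrA.
transitivity (\sum_k direction f k ^+ 2 + \sum_k direction g k ^+ 2 +
    2 * \sum_k direction f k * direction g k).
  by rewrite mulr_sumr -!big_split/=; apply: eq_bigr => k _; ring.
by rewrite E !sum_direction_sqr.
Qed.

Fixpoint ar1 (r s : R) w (j : nat) : 'I_n -> R :=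
  if j is i.+1 then fun k => r * ar1 r s w i k + s * w j k else w 0%N.

Lemma dot_ar1S (r s : R) w f j :
  dot f (ar1 r s w j.+1) = r * dot f (ar1 r s w j) + s * dot f (w j.+1).
Proof.
rewrite /dot !mulr_sumr -big_split/=; apply: eq_bigr => k _.
by rewrite mulrDr !(mulrCA (f k)).
Qed.

(* Tolerances at scale eta: the squared norms are N up to a factor 1 +- 8 eta,
   and the sample correlations are at least - 10 eta. *)
Variables (N eta u r s : R).
Hypotheses (N0 : 0 < N) (eta0 : 0 <= eta <= 100^-1).
Hypotheses (r0 : 0 <= r <= eta) (s0 : 0 < s) (rs : r ^+ 2 + s ^+ 2 = 1).
Hypotheses (u0 : 0 <= u).

Definition norm_ok f := N * (1 - 8 * eta) <= dot f f <= N * (1 + 8 * eta).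
Definition corr_ok f g := - (10 * eta) <= corr f g <= u.

(** The event of interest is only the upper bound [u] on the correlations. The bounds on norms and
    the lower bounds on correlations are added because the analysis of the next column needs
    them. *)
Definition good x j := (forall l, (l < j.+1)%N -> norm_ok (x l)) /\
  (forall l, (l < j.+1)%N -> forall i, (i < l)%N -> corr_ok (x i) (x l)).

Local Notation sN := (Num.sqrt N).

Let sN0 : 0 < sN. Proof. by rewrite sqrtr_gt0. Qed.
Let sN2 : sN ^+ 2 = N. Proof. by rewrite sqr_sqrtr// ltW. Qed.
Let s1 : s <= 1.
Proof.
rewrite -(@ler_pXn2r _ 2)// ?nnegrE ?(ltW s0)// expr1n -rs lerDr.
exact: sqr_ge0.
Qed.

Lemma norm_ok_bounds f : norm_ok f ->
  sN * (1 - 8 * eta) <= norm2 f <= sN * (1 + 8 * eta).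
Proof.
move=> /andP[h1 h2]; have /andP[e0 e1] := eta0.
have ee : 0 <= eta * eta by rewrite mulr_ge0.
have ee1 : eta * eta <= eta * 100^-1 by rewrite ler_wpM2l.
apply/andP; split; rewrite -(@ler_pXn2r _ 2)// ?nnegrE ?norm2_ge0//; last first.
- by rewrite mulr_ge0 ?ltW//; lra.
- rewrite norm2_sqr exprMn sN2; apply: (le_trans h2); rewrite ler_pM2l//.
  by rewrite expr2; lra.
- by rewrite mulr_ge0 ?ltW//; lra.
rewrite norm2_sqr exprMn sN2; apply: le_trans h1; rewrite ler_pM2l//.
by rewrite expr2; lra.
Qed.

Lemma norm_ok_gt0 f : norm_ok f -> 0 < norm2 f.
Proof.
move=> /norm_ok_bounds/andP[+ _]; apply: lt_le_trans.
by rewrite mulr_gt0//; have /andP[e0 e1] := eta0; lra.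
Qed.

Section step.
Variables (w : nat -> 'I_n -> R) (j : nat).
Let x := ar1 r s w.
Hypothesis xj : good x j.
Local Notation V i := (dot (direction (x i)) (w j.+1)).

Let xj_ok : norm_ok (x j). Proof. by apply xj.1. Qed.

Lemma good_gt0 i : (i < j.+1)%N -> 0 < norm2 (x i).
Proof. by move=> ij; apply: norm_ok_gt0; apply xj.1. Qed.

Let corrS i : corr (x i) (x j.+1) =
  (r * dot (direction (x i)) (x j) + s * V i) / norm2 (x j.+1).
Proof. by rewrite corrE dot_ar1S. Qed.

(** The tolerance does not accumulate: the deviation of [x j] enters with the factor
    [r ^+ 2 <= eta ^+ 2] and the cross term is at most [16 eta ^+ 2 N], so the innovation's [4 eta]
    stays well below [8 eta]. *)
Lemma good_norm_step : N * (1 - 4 * eta) <= dot (w j.+1) (w j.+1) <= N * (1 + 4 * eta) ->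
  `|V j| <= 4 * eta * sN -> norm_ok (x j.+1).
Proof.
move=> /andP[w1 w2] Vj; have /andP[e0 e1] := eta0; have /andP[r00 r1] := r0.
have /andP[x1 x2] := xj_ok; have /andP[y1 y2] := norm_ok_bounds xj_ok.
have y0 := norm_ok_gt0 xj_ok.
have E : dot (x j.+1) (x j.+1) = r ^+ 2 * dot (x j) (x j) +
    2 * (r * s) * (norm2 (x j) * V j) + s ^+ 2 * dot (w j.+1) (w j.+1).
  have -> : norm2 (x j) * V j = dot (x j) (w j.+1).
    by rewrite dot_direction mulrC divfK// gt_eqF.
  rewrite dot_ar1S dotC [X in _ + s * X]dotC !dot_ar1S.
  by rewrite [dot (w j.+1) (ar1 _ _ _ _)]dotC; ring.
have C : `|2 * (r * s) * (norm2 (x j) * V j)| <= N * (16 * eta ^+ 2).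
  rewrite normrM (ger0_norm (_ : 0 <= 2 * (r * s))); last by rewrite !mulr_ge0// ltW.
  rewrite normrM (ger0_norm (norm2_ge0 _)) -sN2.
  apply: (@le_trans _ _ (2 * eta * (sN * 2 * (4 * eta * sN)))); last first.
    by rewrite le_eqVlt; apply/orP; left; apply/eqP; ring.
  apply: ler_pM.
  - by rewrite !mulr_ge0// ltW.
  - by rewrite mulr_ge0 ?norm2_ge0.
  - rewrite ler_pM2l//; apply: (@le_trans _ _ (r * 1)); last by rewrite mulr1.
    by rewrite ler_wpM2l.
  - apply: ler_pM => //; first exact: norm2_ge0.
    by apply: (le_trans y2); rewrite ler_pM2l//; lra.
have [c1 c2] : - (N * (16 * eta ^+ 2)) <= 2 * (r * s) * (norm2 (x j) * V j) /\
  2 * (r * s) * (norm2 (x j) * V j) <= N * (16 * eta ^+ 2).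
  by apply/andP; rewrite -ler_norml.
have ee : N * (eta ^+ 2) <= N * (100^-1 * eta).
  by rewrite ler_pM2l// expr2 ler_wpM2r.
have r2 : r ^+ 2 <= 100^-1 by rewrite expr2; apply: (@le_trans _ _ (100^-1 * 1)); [apply: ler_pM|] => //; lra.
have Neta : 0 <= N * eta by rewrite mulr_ge0// ltW.
have s2 : 0 <= s ^+ 2 by rewrite sqr_ge0.
have r20 : 0 <= r ^+ 2 by rewrite sqr_ge0.
have A1 : r ^+ 2 * dot (x j) (x j) <= r ^+ 2 * (N * (1 + 8 * eta)) by rewrite ler_wpM2l.
have A2 : r ^+ 2 * (N * (1 - 8 * eta)) <= r ^+ 2 * dot (x j) (x j) by rewrite ler_wpM2l.
have B1 : s ^+ 2 * dot (w j.+1) (w j.+1) <= s ^+ 2 * (N * (1 + 4 * eta)) by rewrite ler_wpM2l.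
have B2 : s ^+ 2 * (N * (1 - 4 * eta)) <= s ^+ 2 * dot (w j.+1) (w j.+1) by rewrite ler_wpM2l.
have RN : r ^+ 2 * (N * eta) <= 100^-1 * (N * eta) by rewrite ler_wpM2r.
have RN0 : 0 <= r ^+ 2 * (N * eta) by rewrite mulr_ge0.
have sE : s ^+ 2 = 1 - r ^+ 2 by rewrite -rs; ring.
rewrite sE in B1 B2 E.
by apply/andP; rewrite E; split; lra.
Qed.

Hypothesis xj1 : norm_ok (x j.+1).

(** The lower bound reproduces itself as well: in units of [sN] the part inherited from [x j] is at
    least [- eta], because of the factor [r <= eta], and the innovation part at least [- 4 eta].
    Dividing by the norm still leaves more than [- 10 eta]. *)
Lemma good_corr_step i : (i < j.+1)%N -> `|V i| <= 4 * eta * sN ->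
  - (10 * eta) <= corr (x i) (x j.+1).
Proof.
move=> ij; rewrite ler_norml => /andP[V1 V2].
have /andP[e0 e1] := eta0; have /andP[r00 r1] := r0.
have /andP[y1 y2] := norm_ok_bounds xj_ok.
have /andP[z1 z2] := norm_ok_bounds xj1.
have y0 := norm_ok_gt0 xj_ok; have z0 := norm_ok_gt0 xj1.
have se : 0 <= sN * eta by rewrite mulr_ge0// ltW.
have see : sN * eta * eta <= sN * eta * 100^-1 by rewrite ler_wpM2l.
have D : - (20 * (sN * eta)) <= dot (direction (x i)) (x j).
  move: ij; rewrite ltnS leq_eqVlt => /orP[/eqP ->|ij].
    by rewrite dot_direction_self//; lra.
  rewrite dot_direction_corr//.
  have /andP[h _] : corr_ok (x i) (x j) by apply xj.2.
  apply: (@le_trans _ _ (- (10 * eta) * norm2 (x j))); last by rewrite ler_pM2r.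
  have : eta * norm2 (x j) <= eta * (sN * (1 + 8 * eta)) by rewrite ler_wpM2l.
  by lra.
rewrite corrS ler_pdivlMr//.
have rD : - (sN * eta) <= r * dot (direction (x i)) (x j).
  have : r * - (20 * (sN * eta)) <= r * dot (direction (x i)) (x j) by rewrite ler_wpM2l.
  have : r * (sN * eta) <= 100^-1 * (sN * eta) by rewrite ler_wpM2r//; lra.
  by lra.
have sV : - (4 * eta * sN) <= s * V i.
  apply: (@le_trans _ _ (s * - (4 * eta * sN))); last by rewrite ler_wpM2l// ltW.
  have : s * (sN * eta) <= 1 * (sN * eta) by rewrite ler_wpM2r.
  by lra.
have : eta * (sN * (1 - 8 * eta)) <= eta * norm2 (x j.+1) by rewrite ler_wpM2l.
by lra.
Qed.

(* With [V i = <X_i / |X_i|, W_(j+1)>], a correlation [> u] forces [V i] above the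
   threshold [lo], and [V i] above [hi] forces a correlation [> u]; "near" is the
   adjacent pair [i = j], "far" every other pair. *)
Definition far_lo := u * sN * (1 - 8 * eta) - r * (u * sN) * (1 + 8 * eta).
Definition near_lo := u * sN * (1 - 8 * eta) - r * sN * (1 + 8 * eta).
Definition far_hi := (u * sN * (1 + 8 * eta) + r * (10 * eta) * sN * (1 + 8 * eta)) / s.
Definition near_hi := (u * sN * (1 + 8 * eta) - r * sN * (1 - 8 * eta)) / s.

(** An exceedance bounds [s * V i] from below by a nonnegative threshold. Hence [V i] is positive
    and [s * V i <= V i], which is why [far_lo] and [near_lo] contain no division by [s]. *)
Lemma corr_gt_lo i : (i < j.+1)%N -> 0 <= far_lo -> 0 <= near_lo ->
  u < corr (x i) (x j.+1) -> (if i == j then near_lo else far_lo) < V i.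
Proof.
move=> ij fl nl; have /andP[e0 e1] := eta0; have /andP[r00 r1] := r0.
have /andP[y1 y2] := norm_ok_bounds xj_ok.
have /andP[z1 z2] := norm_ok_bounds xj1.
have y0 := norm_ok_gt0 xj_ok; have z0 := norm_ok_gt0 xj1.
rewrite corrS ltr_pdivlMr// => h.
suff H : (if i == j then near_lo else far_lo) < s * V i.
  apply: (lt_le_trans H); rewrite ger_pMl//.
  have t0 : 0 < s * V i by apply: le_lt_trans H; case: ifP.
  by move: t0; rewrite pmulr_rgt0.
have uz : u * (sN * (1 - 8 * eta)) <= u * norm2 (x j.+1) by rewrite ler_wpM2l.
case: eqP => [ij'|/eqP ij'].
  rewrite /near_lo.
  have ry : r * norm2 (x j) <= r * (sN * (1 + 8 * eta)) by rewrite ler_wpM2l.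
  by move: h; rewrite ij' dot_direction_self//; lra.
rewrite /far_lo.
have ij2 : (i < j)%N by rewrite ltn_neqAle ij'.
have /andP[_ c] : corr_ok (x i) (x j) by apply xj.2.
have uy : u * norm2 (x j) <= u * (sN * (1 + 8 * eta)) by rewrite ler_wpM2l.
have cy : corr (x i) (x j) * norm2 (x j) <= u * norm2 (x j) by rewrite ler_pM2r.
have : r * (corr (x i) (x j) * norm2 (x j)) <= r * (u * (sN * (1 + 8 * eta))).
  by rewrite ler_wpM2l// (le_trans cy).
by move: h; rewrite dot_direction_corr//; lra.
Qed.

(** For a far pair the term [r * corr (x i) (x j)] could pull the new correlation down; the bound
    [- (10 * eta)] in [corr_ok] limits this to second order in [eta]. *)
Lemma corr_gt_hi i : (i < j.+1)%N ->
  (if i == j then near_hi else far_hi) < V i -> u < corr (x i) (x j.+1).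
Proof.
move=> ij; have /andP[e0 e1] := eta0; have /andP[r00 r1] := r0.
have /andP[y1 y2] := norm_ok_bounds xj_ok.
have /andP[z1 z2] := norm_ok_bounds xj1.
have y0 := norm_ok_gt0 xj_ok; have z0 := norm_ok_gt0 xj1.
rewrite corrS ltr_pdivlMr// => h.
have uz : u * norm2 (x j.+1) <= u * (sN * (1 + 8 * eta)) by rewrite ler_wpM2l.
case: eqP h => [ij'|/eqP ij'].
  rewrite /near_hi ltr_pdivrMr// ij' dot_direction_self//.
  have ry : r * (sN * (1 - 8 * eta)) <= r * norm2 (x j) by rewrite ler_wpM2l.
  by rewrite (mulrC _ s); lra.
rewrite /far_hi ltr_pdivrMr//.
have ij2 : (i < j)%N by rewrite ltn_neqAle ij'.
have /andP[c _] : corr_ok (x i) (x j) by apply xj.2.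
have uy : eta * norm2 (x j) <= eta * (sN * (1 + 8 * eta)) by rewrite ler_wpM2l.
have cy : - (10 * eta) * norm2 (x j) <= corr (x i) (x j) * norm2 (x j) by rewrite ler_pM2r.
have ruy : r * (eta * norm2 (x j)) <= r * (eta * (sN * (1 + 8 * eta))) by rewrite ler_wpM2l.
have : r * (- (10 * eta) * norm2 (x j)) <= r * (corr (x i) (x j) * norm2 (x j)).
  by rewrite ler_wpM2l.
by rewrite (mulrC _ s) (dot_direction_corr (x i) y0); lra.
Qed.

End step.

(* Two simultaneous exceedances are an exceedance of the sum of the two directions,
   which is short because the directions have correlation at most [u]. *)
Lemma good_pair x j i k : good x j -> (k < j.+1)%N -> (i < k)%N ->
  \sum_l (direction (x i) l + direction (x k) l) ^+ 2 <= 2 + 2 * u.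
Proof.
move=> xj kj ik; have ij : (i < j.+1)%N by rewrite (ltn_trans ik).
rewrite sum_direction_add_sqr; [|exact: norm_ok_gt0 (xj.1 i ij)|exact: norm_ok_gt0 (xj.1 k kj)].
by have /andP[_ h] := xj.2 k kj i ik; rewrite lerD2l ler_pM2l.
Qed.

End geometry.

(** * Measurability of the chain *)

Section measurable_ar1.
Context d (T : measurableType d) (R : realType) (n : nat).
Implicit Types f g : T -> 'I_n -> R.

Lemma measurable_inv_ge0 (h : T -> R) : (forall t, 0 <= h t) ->
  measurable_fun [set: T] h -> measurable_fun [set: T] (fun t => (h t)^-1).
Proof.
move=> h0 mh; rewrite (_ : (fun _ => _) = (fun t => h t `^ (-1))).
  by apply: (measurableT_comp (measurable_powR _) mh).
by apply/funext => t; rewrite powR_inv1.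
Qed.

Definition measurable_vec f := forall k, measurable_fun [set: T] (f ^~ k).

Lemma measurable_dot f g : measurable_vec f -> measurable_vec g ->
  measurable_fun [set: T] (fun t => dot (f t) (g t)).
Proof.
by move=> mf mg; apply: measurable_sum => k; apply: measurable_funM.
Qed.

Lemma measurable_norm2 f : measurable_vec f ->
  measurable_fun [set: T] (fun t => norm2 (f t)).
Proof.
move=> mf; apply: measurableT_comp; [exact: measurable_sqrt|exact: measurable_dot].
Qed.

Lemma measurable_direction f : measurable_vec f ->
  measurable_vec (fun t => direction (f t)).
Proof.
move=> mf k; apply: measurable_funM; first exact: mf.
by apply: measurable_inv_ge0 => [t|]; [exact: norm2_ge0|exact: measurable_norm2].
Qed.

Lemma measurable_corr f g : measurable_vec f -> measurable_vec g ->
  measurable_fun [set: T] (fun t => corr (f t) (g t)).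
Proof.
move=> mf mg; apply: measurable_funM; first exact: measurable_dot.
apply: measurable_inv_ge0 => [t|]; first exact: sqrtr_ge0.
apply: measurableT_comp; first exact: measurable_sqrt.
by apply: measurable_funM; exact: measurable_dot.
Qed.

Lemma measurable_between (a b : R) (h : T -> R) : measurable_fun [set: T] h ->
  measurable [set t | a <= h t <= b].
Proof.
move=> mh; rewrite (_ : [set t | _] = [set t | a <= h t] `&` [set t | h t <= b]).
  by apply: measurableI; exact: measurable_le.
by apply/seteqP; split => [t /andP[]//|t [h1 h2]] /=; apply/andP.
Qed.

Context (w : T -> nat -> 'I_n -> R) (j : nat) (r s N eta u : R).
Hypothesis mw : forall l, (l < j.+1)%N -> measurable_vec (w ^~ l).

Lemma measurable_ar1 l : (l < j.+1)%N -> measurable_vec (fun t => ar1 r s (w t) l).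
Proof.
elim: l => [l0|l IH lj] k /=; first exact: mw.
by apply: measurable_funD; apply: measurable_funM => //; [apply: IH; exact: ltnW|exact: mw].
Qed.

Lemma measurable_good : measurable [set t | good N eta u (ar1 r s (w t)) j].
Proof.
apply: measurableI.
  apply: (@measurable_forall_lt _ T) => l lj.
  by apply: measurable_between; apply: measurable_dot; exact: measurable_ar1.
apply: (@measurable_forall_lt _ T) => l lj; apply: (@measurable_forall_lt _ T) => i il.
apply: measurable_between; apply: measurable_corr; apply: measurable_ar1 => //.
exact: ltn_trans lj.
Qed.

Lemma measurable_below : measurable [set t | forall l, (l < j.+1)%N ->
  forall i, (i < l)%N -> corr (ar1 r s (w t) i) (ar1 r s (w t) l) <= u].
Proof.
apply: (@measurable_forall_lt _ T) => l lj; apply: (@measurable_forall_lt _ T) => i il.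
apply: measurable_le => //; apply: measurable_corr; apply: measurable_ar1 => //.
exact: ltn_trans lj.
Qed.

End measurable_ar1.

(** * Recursion for the probability that no correlation exceeds the level *)

Section chain.
Context d (T : measurableType d) (R : realType) (P : probability T R).
Context (n p : nat) (z : 'I_n * 'I_p -> T -> R) (Pz : iid_std_normal P z).
Let mz : forall i, measurable_fun [set: T] (z i) := Pz.1.

(** Indexed by [nat], with the value 0 from [p] on, so that the recursion [ar1] needs no bounds on
    its index. *)
Definition column (t : T) (l : nat) (k : 'I_n) : R :=
  oapp (fun l' : 'I_p => z (k, l') t) 0 (insub l).

Definition columns_upto (j : nat) : {set 'I_n * 'I_p} :=
  [set kl : 'I_n * 'I_p | (kl.2 < j.+1)%N]%SET.

Lemma columnE t l (lp : (l < p)%N) k : column t l k = z (k, Ordinal lp) t.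
Proof. by rewrite /column insubT. Qed.

Lemma measurable_column l : measurable_vec (column ^~ l).
Proof.
by move=> k; rewrite /column; case: insubP => [l' _ _|_] //=; exact: mz.
Qed.

Lemma measurable_column_past l j : (l < j.+1)%N ->
  measurable_vec (T := past z (columns_upto j)) (column ^~ l).
Proof.
move=> lj k; rewrite /column; case: insubP => [l' _ ll'|_] //=.
by apply: measurable_coord_past; rewrite finset.inE /= ll'.
Qed.

Section next_column.
Context (j : nat) (jp : (j.+1 < p)%N).
Let J := columns_upto j.
Let ks := [seq (k, Ordinal jp) | k <- enum 'I_n].

Let uks : uniq ks.
Proof. by rewrite map_inj_uniq ?enum_uniq// => a b []. Qed.

Let kJ k : k \in ks -> k \notin J.
Proof. by move=> /mapP[i _ ->]; rewrite finset.inE /= ltnn. Qed.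

Let sumE (Y : 'I_n -> R) t : \sum_(k <- ks) Y k.1 * z k t = dot Y (column t j.+1).
Proof.
rewrite /ks big_map big_enum /=; apply: eq_bigr => k _.
by rewrite columnE.
Qed.

Let sumE2 (Y : 'I_n -> R) : \sum_(k <- ks) Y k.1 ^+ 2 = \sum_k Y k ^+ 2.
Proof. by rewrite /ks big_map big_enum. Qed.

Context (E : set T) (mE : measurable (E : set (past z J))) (Y : T -> 'I_n -> R).
Hypothesis (mY : measurable_vec (T := past z J) Y).

Lemma next_column_eq (tau : R) : (forall t, E t -> \sum_k Y t k ^+ 2 = 1) ->
  pr P (E `&` [set t | tau < dot (Y t) (column t j.+1)]) = pr P E * gtail tau.
Proof.
move=> Y1.
have := past_functional_eq Pz uks kJ mE (y := fun kl t => Y t kl.1) (fun k => mY k.1)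
  tau (fun t Et => eq_trans (sumE2 (Y t)) (Y1 t Et)).
rewrite /pr => <-; congr (fine (P (_ `&` _))).
by apply/seteqP; split => t /=; rewrite sumE.
Qed.

Lemma next_column_le (tau v : R) : 0 <= tau -> 0 < v ->
  (forall t, E t -> \sum_k Y t k ^+ 2 <= v) ->
  pr P (E `&` [set t | tau < dot (Y t) (column t j.+1)]) <= gtail (tau / Num.sqrt v).
Proof.
move=> tau0 v0 Y1.
have Y1' t : E t -> \sum_(k <- ks) Y t k.1 ^+ 2 <= v by move=> Et; rewrite sumE2 Y1.
have := past_functional_le Pz uks kJ mE (y := fun kl t => Y t kl.1) (fun k => mY k.1)
  tau0 v0 Y1'.
apply: le_trans; rewrite /pr le_eqVlt; apply/orP; left; apply/eqP; congr (fine (P (_ `&` _))).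
by apply/seteqP; split => t /=; rewrite sumE.
Qed.

End next_column.

Variables (eta u r s : R).
Local Notation N := (n%:R : R).
Local Notation sN := (Num.sqrt N).
Hypotheses (N0 : 0 < N) (eta0 : 0 <= eta <= 100^-1).
Hypotheses (r0 : 0 <= r <= eta) (s0 : 0 < s) (rs : r ^+ 2 + s ^+ 2 = 1).
Hypotheses (u0 : 0 <= u).

Local Notation x t := (ar1 r s (column t)).
Local Notation Lam := (4 * eta * sN).
Local Notation lo := (fun i j => if i == j then near_lo N eta u r else far_lo N eta u r).
Local Notation hi := (fun i j => if i == j then near_hi N eta u r s else far_hi N eta u r s).
Local Notation V t i j := (dot (direction (x t i)) (column t j.+1)).

Definition good_set j := [set t | good N eta u (x t) j].

Definition below_set j := [set t | forall l, (l < j.+1)%N ->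
  forall i, (i < l)%N -> corr (x t i) (x t l) <= u].

Definition norm_bad j :=
  [set t | N * (1 + 4 * eta) <= dot (column t j) (column t j)] `|`
  [set t | dot (column t j) (column t j) <= N * (1 - 4 * eta)].

(** Restricted to [good_set j], where the direction is a unit vector, so that the probability is an
    exact Gaussian tail times that of [good_set j]. *)
Definition V_over j i := good_set j `&` [set t | Lam < V t i j].
Definition V_under j i := good_set j `&` [set t | Lam < - V t i j].

Definition step_bad j := norm_bad j.+1 `|`
  (\big[setU/set0]_(i < j.+1) V_over j i `|` \big[setU/set0]_(i < j.+1) V_under j i).

(** A bound on [step_bad] uniform in [j]: two chi-square deviations of relative size [4 eta], and
    two Gaussian tails at [Lam] for each of at most [p] directions. *)
Definition bad_prob : R := 2 * expR (- (2 * N * eta ^+ 2)) + 2 * p%:R * gtail Lam.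

Let mx l : measurable_vec (fun t => x t l).
Proof.
by apply: (@measurable_ar1 _ _ _ _ _ l) => // i _; exact: measurable_column.
Qed.

Let mgood_past j : measurable (good_set j : set (past z (columns_upto j))).
Proof. by apply: measurable_good => l lj; exact: measurable_column_past. Qed.

Let mgood j : measurable (good_set j).
Proof. by exact: (past_measurable mz (@mgood_past j)). Qed.

Let mbelow j : measurable (below_set j).
Proof. by apply: measurable_below => l _; exact: measurable_column. Qed.

Let mdir_past i j : (i < j.+1)%N ->
  measurable_vec (T := past z (columns_upto j)) (fun t => direction (x t i)).
Proof.
move=> ij; apply: measurable_direction; apply: measurable_ar1 ij => l lj.
exact: measurable_column_past.
Qed.

Let mV i j : measurable_fun [set: T] (fun t => V t i j).
Proof.
by apply: measurable_dot; [exact: measurable_direction|exact: measurable_column].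
Qed.

Let mnorm_bad j : measurable (norm_bad j).
Proof.
have mD : measurable_fun [set: T] (fun t => dot (column t j) (column t j)).
  by apply: measurable_dot; exact: measurable_column.
by apply: measurableU; exact: measurable_le.
Qed.

Let mVgt i j (c : R) : measurable (good_set j `&` [set t | c < V t i j]).
Proof. by apply: measurableI => //; exact: measurable_lt. Qed.

Let mVlt i j (c : R) : measurable (good_set j `&` [set t | c < - V t i j]).
Proof. by apply: measurableI => //; apply: measurable_lt => //; exact: measurable_funN. Qed.

Let mstep_bad j : measurable (step_bad j).
Proof.
by apply: measurableU => //; apply: measurableU; apply: bigsetU_measurable => i _;
  [exact: mVgt|exact: mVlt].
Qed.

Let dir1 i j t : (i < j.+1)%N -> good_set j t -> \sum_k direction (x t i) k ^+ 2 = 1.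
Proof.
move=> ij gt; apply: sum_direction_sqr.
exact: (good_gt0 N0 eta0 gt ij).
Qed.

Lemma pr_V_gt i j tau : (j.+1 < p)%N -> (i < j.+1)%N ->
  pr P (good_set j `&` [set t | tau < V t i j]) = pr P (good_set j) * gtail tau.
Proof.
move=> jp ij; apply: (next_column_eq jp (@mgood_past j) (mdir_past ij)) => t gt.
exact: dir1 ij gt.
Qed.

Lemma pr_norm_bad j : (j < p)%N -> pr P (norm_bad j) <= 2 * expR (- (2 * N * eta ^+ 2)).
Proof.
move=> jp; pose ks := [seq (k, Ordinal jp) | k <- enum 'I_n].
have uks : uniq ks by rewrite map_inj_uniq ?enum_uniq// => a b [].
have sks : size ks = n by rewrite size_map -cardE card_ord.
have sumE t : \sum_(k <- ks) z k t ^+ 2 = dot (column t j) (column t j).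
  rewrite /ks big_map big_enum /=; apply: eq_bigr => k _.
  by rewrite columnE expr2.
have e4 : 0 <= 4 * eta <= 2^-1.
  by move: eta0 => /andP[e1 e2]; apply/andP; split; lra.
have [] := chi_square_concentration Pz uks e4; rewrite sks.
have -> : N * (4 * eta) ^+ 2 / 8 = 2 * N * eta ^+ 2 by field.
have mD : measurable_fun [set: T] (fun t => dot (column t j) (column t j)).
  by apply: measurable_dot; exact: measurable_column.
under eq_set do rewrite sumE.
move=> h1; under eq_set do rewrite sumE.
move=> h2; rewrite /norm_bad; apply: (le_trans (prU_le _ _ _)).
- exact: measurable_le.
- exact: measurable_le.
- by apply: (le_trans (lerD h1 h2)); lra.
Qed.

Lemma pr_step_bad j : (j.+1 < p)%N -> pr P (step_bad j) <= bad_prob.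
Proof.
move=> jp; rewrite /step_bad /bad_prob.
have mO : measurable (\big[setU/set0]_(i < j.+1) V_over j i).
  by apply: bigsetU_measurable => i _; exact: mVgt.
have mU : measurable (\big[setU/set0]_(i < j.+1) V_under j i).
  by apply: bigsetU_measurable => i _; exact: mVlt.
apply: (le_trans (prU_le _ _ _)) => //; first exact: measurableU.
apply: lerD; first exact: pr_norm_bad.
apply: (le_trans (prU_le _ mO mU)).
have sum_natl (c : R) : j.+1%:R * c = \sum_(i < j.+1) c.
  by rewrite sumr_const card_ord mulr_natl.
have gl : pr P (good_set j) * gtail Lam <= gtail Lam.
  by rewrite ler_piMl ?gtail_ge0// pr_le1.
have jpR : (j.+1)%:R * gtail Lam <= p%:R * gtail Lam.
  by rewrite ler_wpM2r ?gtail_ge0// ler_nat ltnW.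
have -> : 2 * p%:R * gtail Lam = p%:R * gtail Lam + p%:R * gtail Lam by ring.
apply: lerD; apply: le_trans jpR.
  apply: (le_trans (@pr_bigU_le _ _ _ _ j.+1 (V_over j) _)) => [i _|]; first exact: mVgt.
  rewrite sum_natl; apply: ler_sum => i _.
  by rewrite pr_V_gt.
apply: (le_trans (@pr_bigU_le _ _ _ _ j.+1 (V_under j) _)) => [i _|]; first exact: mVlt.
rewrite sum_natl; apply: ler_sum => i _.
apply: le_trans gl; rewrite le_eqVlt; apply/orP; left; apply/eqP.
have mN : measurable_vec (T := past z (columns_upto j)) (fun t k => - direction (x t i) k).
  by move=> k; apply: measurable_funN; exact: mdir_past.
rewrite -(next_column_eq jp (@mgood_past j) mN).
  congr (pr P (_ `&` _)); apply/funext => t /=; congr (is_true (_ < _)).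
  by rewrite /dot -sumrN; apply: eq_bigr => k _; rewrite mulNr.
by move=> t gt; under eq_bigr do rewrite sqrrN; exact: (dir1 (ltn_ord i) gt).
Qed.

Lemma good_succ j t : good_set j t -> norm_ok N eta (x t j.+1) ->
  (forall i, (i < j.+1)%N -> corr_ok eta u (x t i) (x t j.+1)) -> good_set j.+1 t.
Proof.
move=> [gn gc] nj cj; split => l; rewrite ltnS leq_eqVlt => /orP[/eqP ->|lj] //.
- exact: gn.
- exact: gc.
Qed.

Lemma good_pred j t : good_set j.+1 t -> good_set j t.
Proof. by move=> [gn gc]; split => l lj; [apply: gn|apply: gc]; rewrite ltnS ltnW. Qed.

Lemma not_step_bad j t : good_set j t -> ~ step_bad j t ->
  norm_ok N eta (x t j.+1) /\
  forall i, (i < j.+1)%N -> - (10 * eta) <= corr (x t i) (x t j.+1).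
Proof.
move=> gj nb.
have V_le i : (i < j.+1)%N -> `|V t i j| <= Lam.
  move=> ij; rewrite leNgt; apply/negP => h; apply: nb; right.
  move: h; rewrite ltr_normr => /orP[h|h]; [left|right];
    by apply/(@bigsetU_ltP _ T); exists i.
have nok : norm_ok N eta (x t j.+1).
  apply: (good_norm_step N0 eta0 r0 s0 rs gj); last exact: V_le.
  apply/andP; split; rewrite leNgt; apply/negP => h; apply: nb; left.
    by right; exact: ltW.
  by left; exact: ltW.
split => // i ij; exact: (good_corr_step N0 eta0 r0 s0 rs gj nok ij (V_le i ij)).
Qed.

(** Column [j.+1] forms [j] far pairs and one adjacent pair with its predecessors. [lo_rate] and
    [hi_rate] enclose, up to errors, the conditional probability of an exceedance at this step. *)
Definition lo_rate j := j%:R * gtail (far_lo N eta u r) + gtail (near_lo N eta u r).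
Definition hi_rate j := j%:R * gtail (far_hi N eta u r s) + gtail (near_hi N eta u r s).

Let sum_two (a b : R) j : \sum_(i < j.+1) (if (i : nat) == j then a else b) = j%:R * b + a.
Proof.
rewrite big_ord_recr/= eqxx; congr (_ + _).
under eq_bigr => i _ do rewrite ltn_eqF//.
by rewrite sumr_const card_ord mulr_natl.
Qed.

(** From [good_set j] the chain stays good unless the step is bad or some projection passes its [lo]
    threshold; the union bound over the latter, each of exactly known probability, gives
    [lo_rate]. *)
Lemma good_step_lower j : (j.+1 < p)%N ->
  0 <= far_lo N eta u r -> 0 <= near_lo N eta u r ->
  (1 - lo_rate j) * pr P (good_set j) - bad_prob <= pr P (good_set j.+1).
Proof.
move=> jp fl nl; set B := fun i => good_set j `&` [set t | lo i j < V t i j].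
have mB : measurable (\big[setU/set0]_(i < j.+1) B i).
  by apply: bigsetU_measurable => i _; exact: mVgt.
have sub : good_set j `<=`
    good_set j.+1 `|` (step_bad j `|` \big[setU/set0]_(i < j.+1) B i).
  move=> t gj; have [|nb] := pselect (step_bad j t); first by right; left.
  have [|nB] := pselect ((\big[setU/set0]_(i < j.+1) B i) t); first by right; right.
  left; have [nok cok] := not_step_bad gj nb; apply: good_succ => // i ij.
  apply/andP; split; first exact: cok.
  rewrite leNgt; apply/negP => h; apply: nB; apply/(@bigsetU_ltP _ T _ B); exists i => //.
  split => //=.
  exact: (corr_gt_lo N0 eta0 r0 s0 rs u0 gj nok ij fl nl h).
have h1 : pr P (good_set j) <= pr P (good_set j.+1) +
    (pr P (step_bad j) + pr P (\big[setU/set0]_(i < j.+1) B i)).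
  have mSB : measurable (step_bad j `|` \big[setU/set0]_(i < j.+1) B i).
    exact: measurableU.
  apply: (le_trans (pr_le _ _ _ sub)) => //; first exact: measurableU.
  by apply: (le_trans (prU_le _ _ _)) => //; rewrite lerD2l prU_le.
have h2 : pr P (\big[setU/set0]_(i < j.+1) B i) <= lo_rate j * pr P (good_set j).
  apply: (le_trans (@pr_bigU_le _ _ _ _ j.+1 B _)) => [i _|]; first exact: mVgt.
  rewrite /lo_rate -sum_two mulr_suml; apply: ler_sum => i _.
  by rewrite /B pr_V_gt// mulrC; case: ifP.
by have h3 := pr_step_bad jp; lra.
Qed.

(** The correction term in Bonferroni's inequality: at most [p ^ 2] pairs of far indices, and at
    most [p] pairs that contain the adjacent index. *)
Definition pair_prob : R :=
  p%:R ^+ 2 * gtail ((far_hi N eta u r s + far_hi N eta u r s) / Num.sqrt (2 + 2 * u)) +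
  p%:R * gtail ((far_hi N eta u r s + near_hi N eta u r s) / Num.sqrt (2 + 2 * u)).

(** Inside [good_set j], the next good event is disjoint from every passage of a [hi] threshold. Two
    passages at once force the sum of two projections above the sum of the thresholds, and this sum
    has variance at most [2 + 2 u] by [good_pair]. *)
Lemma good_step_upper j : (j.+1 < p)%N ->
  0 <= far_hi N eta u r s -> 0 <= near_hi N eta u r s ->
  pr P (good_set j.+1) <= (1 - hi_rate j) * pr P (good_set j) + pair_prob.
Proof.
move=> jp fh nh; set B := fun i => good_set j `&` [set t | hi i j < V t i j].
have mBi i : measurable (B i) by exact: mVgt.
have mB : measurable (\big[setU/set0]_(i < j.+1) B i).
  by apply: bigsetU_measurable => i _; exact: mVgt.
have h1 : pr P (good_set j.+1) + pr P (\big[setU/set0]_(i < j.+1) B i) <= pr P (good_set j).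
  rewrite -prUI// (_ : _ `&` _ = set0) ?pr_set0 ?addr0; last first.
    apply/seteqP; split => // t [gS /bigsetU_ltP[i ij [gj /= Vi]]].
    have nok : norm_ok N eta (x t j.+1) by apply gS.1.
    have := corr_gt_hi N0 eta0 r0 s0 u0 gj nok ij Vi.
    by rewrite ltNge; have /andP[_ ->] := gS.2 j.+1 (ltnSn _) i ij.
  apply: pr_le => //; first exact: measurableU.
  by move=> t [/good_pred//|/bigsetU_ltP[i ij []]].
have h2 := @bonferroni _ _ _ P j.+1 B (fun i _ => mBi i).
have h3 : \sum_(i < j.+1) pr P (B i) = hi_rate j * pr P (good_set j).
  rewrite /hi_rate -sum_two mulr_suml; apply: eq_bigr => i _.
  by rewrite /B pr_V_gt// mulrC; case: ifP.
have u2 : 0 < 2 + 2 * u by rewrite ltr_pwDl// mulr_ge0.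
have jpR : (j%:R : R) <= p%:R by rewrite ler_nat ltnW// ltnW.
have h4 k : (k < j.+1)%N -> \sum_(i < k) pr P (B i `&` B k) <=
    p%:R * gtail ((far_hi N eta u r s + hi k j) / Num.sqrt (2 + 2 * u)).
  move=> kj; apply: (@le_trans _ _ (\sum_(i < k)
      gtail ((far_hi N eta u r s + hi k j) / Num.sqrt (2 + 2 * u)))); last first.
    rewrite sumr_const card_ord -[leLHS]mulr_natl ler_wpM2r ?gtail_ge0//.
    by rewrite ler_nat; apply: ltnW; apply: leq_ltn_trans jp; apply: leq_trans (ltnW kj) _.
  apply: ler_sum => i _; have ik := ltn_ord i.
  have ij : (i < j)%N by apply: leq_trans ik _.
  have mY : measurable_vec (T := past z (columns_upto j))
      (fun t l => direction (x t i) l + direction (x t k) l).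
    move=> l; apply: measurable_funD; apply: mdir_past => //.
    by rewrite ltnS ltnW.
  have hk0 : 0 <= far_hi N eta u r s + hi k j by rewrite addr_ge0//; case: ifP.
  apply: le_trans (next_column_le jp (@mgood_past j) mY hk0 u2 _); last first.
    by move=> t gj; apply: (good_pair N0 eta0 gj kj ik).
  apply: pr_le; first exact: measurableI.
    apply: measurableI => //; apply: measurable_lt => //; apply: measurable_dot.
      move=> l; apply: measurable_funD; exact: measurable_direction.
    exact: measurable_column.
  move=> t [[gj /= Vi] [_ /= Vk]]; split => //=.
  rewrite /dot; under eq_bigr do rewrite mulrDl.
  rewrite big_split/=; apply: ltrD; last exact: Vk.
  by move: Vi; rewrite (ltn_eqF ij).
have h5 : \sum_(k < j.+1) \sum_(i < k) pr P (B i `&` B k) <= pair_prob.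
  apply: (@le_trans _ _ (\sum_(k < j.+1) p%:R *
      gtail ((far_hi N eta u r s + hi (k : nat) j) / Num.sqrt (2 + 2 * u)))).
    by apply: ler_sum => k _; exact: h4.
  rewrite big_ord_recr/= eqxx /pair_prob; apply: lerD => //.
  rewrite -mulr_sumr expr2 -mulrA ler_wpM2l//.
  under eq_bigr => i _ do rewrite ltn_eqF//.
  by rewrite sumr_const card_ord -[leLHS]mulr_natl ler_wpM2r ?gtail_ge0.
by lra.
Qed.

Lemma bad_prob_ge0 : 0 <= bad_prob.
Proof. by rewrite addr_ge0// !mulr_ge0 ?expR_ge0 ?gtail_ge0. Qed.

Lemma pair_prob_ge0 : 0 <= pair_prob.
Proof. by rewrite addr_ge0// !mulr_ge0 ?gtail_ge0 ?exprn_ge0. Qed.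

Let good0 t : ~ norm_bad 0 t -> good_set 0 t.
Proof.
move=> nb; split => l; rewrite ltnS leqn0 => /eqP -> //=.
have /andP[e0 e1] := eta0.
have Ne : 0 <= N * eta by rewrite mulr_ge0.
apply/andP; split; rewrite leNgt; apply/negP => h; apply: nb.
  by right; rewrite /=; lra.
by left; rewrite /=; lra.
Qed.

Let norm_bad_le j : (j < p)%N -> pr P (norm_bad j) <= bad_prob.
Proof.
move=> jp; apply: (le_trans (pr_norm_bad jp)).
by rewrite /bad_prob lerDl !mulr_ge0 ?gtail_ge0.
Qed.

Lemma pr_good0 : (0 < p)%N -> 1 - bad_prob <= pr P (good_set 0).
Proof.
move=> p0; have h := norm_bad_le p0.
have : pr P [set: T] <= pr P (good_set 0) + pr P (norm_bad 0).
  apply: le_trans (prU_le _ _ _) => //; apply: pr_le => //; first exact: measurableU.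
  by move=> t _; have [nb|nb] := pselect (norm_bad 0 t); [right|left; exact: good0].
have -> : pr P [set: T] = 1 by rewrite /pr probability_setT.
by lra.
Qed.

Lemma good_below j : good_set j `<=` below_set j.
Proof. by move=> t [_ gc] l lj i il; have /andP[] := gc l lj i il. Qed.

(** As long as no correlation exceeds [u], the chain can lose goodness only through a bad norm or a
    bad step, so one exceptional event per column is enough. *)
Lemma below_good j : (j < p)%N ->
  pr P (below_set j) <= pr P (good_set j) + j.+1%:R * bad_prob.
Proof.
move=> jp.
suff [B [mB Ble sub]] : exists B, [/\ measurable B, pr P B <= j.+1%:R * bad_prob &
    below_set j `<=` good_set j `|` B].
  apply: (@le_trans _ _ (pr P (good_set j) + pr P B)); last by rewrite lerD2l.
  by apply: le_trans (prU_le _ _ _) => //; apply: pr_le => //; exact: measurableU.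
elim: j jp => [p0|j IH jp].
  exists (norm_bad 0); split; first exact: mnorm_bad.
    by rewrite mul1r norm_bad_le.
  by move=> t _; have [nb|nb] := pselect (norm_bad 0 t); [right|left; exact: good0].
have [B [mB Ble sub]] := IH (ltnW jp).
exists (B `|` step_bad j); split; first exact: measurableU.
  apply: (le_trans (prU_le _ _ _)) => //.
  rewrite -natr1 mulrDl mul1r; apply: lerD => //; exact: pr_step_bad.
move=> t bt.
have [gj|] : (good_set j `|` B) t; last by right; left.
  by apply: sub => l lj; apply: bt; rewrite ltnS ltnW.
have [|nb] := pselect (step_bad j t); first by right; right.
left; have [nok cok] := not_step_bad gj nb; apply: good_succ => // i ij.
by apply/andP; split; [exact: cok|exact: (bt j.+1)].
Qed.

Let sum_rate (a b : R) m : \sum_(j < m) (j%:R * a + b) = 'C(m, 2)%:R * a + m%:R * b.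
Proof.
rewrite big_split/= -mulr_suml sumr_const card_ord [X in _ = _ + X]mulr_natl.
by rewrite -natr_sum -(big_mkord xpredT id) bin2_sum.
Qed.

(** Among the columns [0, ..., m] there are ['C(m, 2)] far pairs and [m] adjacent ones; these are
    the sums of the one-step rates. *)
Lemma below_lower m Q : (m < p)%N -> Q < 1 ->
  0 <= far_lo N eta u r -> 0 <= near_lo N eta u r ->
  p%:R * gtail (far_lo N eta u r) + gtail (near_lo N eta u r) <= Q ->
  expR (- (('C(m, 2)%:R * gtail (far_lo N eta u r) +
            m%:R * gtail (near_lo N eta u r)) / (1 - Q))) - m.+1%:R * bad_prob <=
  pr P (below_set m).
Proof.
move=> mp Q1 fl nl qQ; apply: (@le_trans _ _ (pr P (good_set m))); last first.
  by apply: pr_le => //; exact: good_below.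
rewrite -sum_rate mulr_suml.
apply: (@recursion_lower _ (fun j => pr P (good_set j)) (fun j => lo_rate j)) => //.
- exact: bad_prob_ge0.
- move=> j jm; rewrite /lo_rate addr_ge0 ?mulr_ge0 ?gtail_ge0//=.
  apply: le_trans qQ; rewrite lerD2r ler_wpM2r ?gtail_ge0// ler_nat ltnW//.
  exact: ltn_trans mp.
- by apply: pr_good0; exact: leq_ltn_trans mp.
- by move=> j jm; apply: good_step_lower => //; exact: leq_ltn_trans mp.
Qed.

Lemma below_upper m : (m < p)%N ->
  0 <= far_hi N eta u r s -> 0 <= near_hi N eta u r s ->
  p%:R * gtail (far_hi N eta u r s) + gtail (near_hi N eta u r s) <= 1 ->
  pr P (below_set m) <=
  expR (- ('C(m, 2)%:R * gtail (far_hi N eta u r s) +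
           m%:R * gtail (near_hi N eta u r s))) + m%:R * pair_prob + m.+1%:R * bad_prob.
Proof.
move=> mp fh nh q1; apply: (le_trans (below_good mp)); rewrite lerD2r -sum_rate.
apply: (@recursion_upper _ (fun j => pr P (good_set j)) (fun j => hi_rate j)) => //.
- exact: pair_prob_ge0.
- move=> j jm; rewrite /hi_rate addr_ge0 ?mulr_ge0 ?gtail_ge0//=.
  apply: le_trans q1; rewrite lerD2r ler_wpM2r ?gtail_ge0// ler_nat ltnW//.
  exact: ltn_trans mp.
- exact: pr_le1.
- by move=> j jm; apply: good_step_upper => //; exact: leq_ltn_trans mp.
Qed.

End chain.

(** * The Gaussian sample as an autoregression *)

Section innovations.
Context {R : realType} (p : nat) (r s : R) (M : 'M[R]_p).
Hypotheses (s0 : 0 < s) (rs : r ^+ 2 + s ^+ 2 = 1) (MM : M *m M^T = ar1_cov p r).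

Definition mx_row (l : nat) (j : 'I_p) : R := oapp (fun l' => M l' j) 0 (insub l).

(** The autoregression solved for its innovations, on the rows of [M]. In matrix form this is
    [L^-1 M] with [L] the Cholesky factor of the covariance, which is orthogonal for every [M] with
    [M *m M^T] equal to that covariance. *)
Definition innovation_row (l : nat) (j : 'I_p) : R :=
  if l is l'.+1 then (mx_row l j - r * mx_row l' j) / s else mx_row 0 j.

Lemma mx_rowE (i : 'I_p) j : mx_row i j = M i j.
Proof. by rewrite /mx_row valK. Qed.

(** In truncated subtraction one of the two differences is 0, so the exponent is the distance of the
    indices. *)
Lemma dot_mx_row i j : (i < p)%N -> (j < p)%N ->
  \sum_l mx_row i l * mx_row j l = r ^+ ((i - j) + (j - i)).
Proof.
move=> ip jp; have /matrixP/(_ (Ordinal ip) (Ordinal jp)) := MM; rewrite !mxE /=.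
have -> : `|(i : int) - (j : int)|%N = ((i - j) + (j - i))%N by lia.
move=> <-; apply: eq_bigr => l _; rewrite !mxE.
by rewrite -(mx_rowE (Ordinal ip)) -(mx_rowE (Ordinal jp)).
Qed.

Let dotBB (a b c e : 'I_p -> R) :
  \sum_l ((a l - r * b l) / s) * ((c l - r * e l) / s) =
  (\sum_l a l * c l - r * \sum_l a l * e l - r * \sum_l b l * c l +
   r ^+ 2 * \sum_l b l * e l) / s ^+ 2.
Proof.
rewrite !mulr_sumr -!sumrB -big_split/= mulr_suml; apply: eq_bigr => l _.
by field; rewrite gt_eqF.
Qed.

Let dotB (a c e : 'I_p -> R) :
  \sum_l a l * ((c l - r * e l) / s) =
  (\sum_l a l * c l - r * \sum_l a l * e l) / s.
Proof.
rewrite !mulr_sumr -!sumrB mulr_suml; apply: eq_bigr => l _.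
by field; rewrite gt_eqF.
Qed.

Let innovation_lt i j : (i < j)%N -> (j < p)%N ->
  \sum_l innovation_row i l * innovation_row j l = 0.
Proof.
case: j => // j ij jp; have ip : (i < p)%N by apply: ltn_trans jp.
have jp' := ltnW jp.
case: i => [|i] in ij ip *.
  rewrite /innovation_row dotB !dot_mx_row// !sub0n !add0n !subn0.
  by rewrite exprS subrr mul0r.
rewrite ltnS in ij; have ip' := ltnW ip.
rewrite /innovation_row dotBB !dot_mx_row//.
have [k ->] : exists k, j = (i + k.+1)%N.
  by exists (j - i.+1)%N; rewrite addnS -addSn subnKC.
have -> : (i.+1 - (i + k.+1).+1 + ((i + k.+1).+1 - i.+1) = k.+1)%N by lia.
have -> : (i.+1 - (i + k.+1) + ((i + k.+1) - i.+1) = k)%N by lia.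
have -> : (i - (i + k.+1).+1 + ((i + k.+1).+1 - i) = k.+2)%N by lia.
by rewrite !exprS; ring.
Qed.

Lemma innovation_orthonormal : orthonormal_rows (fun i : 'I_p => innovation_row i).
Proof.
move=> i j; have [ij|ji|ij] := ltngtP i j.
- rewrite innovation_lt//; have -> // : (i == j) = false.
  by apply/eqP => h; move: ij; rewrite h ltnn.
- under eq_bigr do rewrite mulrC.
  rewrite innovation_lt//; have -> // : (i == j) = false.
  by apply/eqP => h; move: ji; rewrite h ltnn.
have -> : i = j by exact: val_inj.
rewrite eqxx; case: j {i ij} => -[|i] ip /=.
  by rewrite /innovation_row dot_mx_row.
have ip' := ltnW ip.
rewrite dotBB !dot_mx_row//.
have -> : (i.+1 - i.+1 + (i.+1 - i.+1) = 0)%N by lia.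
have -> : (i.+1 - i + (i - i.+1) = 1)%N by lia.
have -> : (i - i.+1 + (i.+1 - i) = 1)%N by lia.
rewrite expr0 expr1 !mulr1 (_ : 1 - r * r - r * r + r ^+ 2 = s ^+ 2); last first.
  by rewrite -rs; ring.
by rewrite divff// expf_neq0// gt_eqF.
Qed.

Context d (T : measurableType d) (P : probability T R) (n : nat).
Context (z : 'I_n * 'I_p -> T -> R) (Pz : iid_std_normal P z).

Definition innovations (kj : 'I_n * 'I_p) (t : T) : R :=
  \sum_l innovation_row kj.2 l * z (kj.1, l) t.

Lemma innovations_iid : iid_std_normal P innovations.
Proof. exact: (iid_preserving_orthogonal innovation_orthonormal Pz). Qed.

Lemma gauss_sample_ar1 t (l : 'I_p) k :
  gauss_sample M (z ^~ t) k l = ar1 r s (column innovations t) l k.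
Proof.
case: l => l lp; rewrite /gauss_sample.
transitivity (\sum_j mx_row l j * z (k, j) t).
  by apply: eq_bigr => j _; rewrite -(mx_rowE (Ordinal lp)).
elim: l lp => [|l IH] lp.
  by rewrite /= columnE.
rewrite [RHS]/= columnE /innovations /= -IH; last exact: ltnW.
rewrite !mulr_sumr -big_split/=; apply: eq_bigr => j _.
by field; rewrite gt_eqF.
Qed.

(** The condition [-1 <= u] makes the starting value of the maximum harmless; [p.-1] is the index of
    the last column. *)
Lemma Lmax_le_below (u : R) : -1 <= u -> (0 < p)%N ->
  [set t | Lmax (gauss_sample M (z ^~ t)) <= u] = below_set innovations u r s p.-1.
Proof.
move=> u1 p0.
have rhoE t (i j : 'I_p) : rho_hat (gauss_sample M (z ^~ t)) i j =
    corr (ar1 r s (column innovations t) i) (ar1 r s (column innovations t) j).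
  rewrite /rho_hat /corr /dot; congr (_ / Num.sqrt (_ * _)); apply: eq_bigr => k _;
  by rewrite ?expr2 !gauss_sample_ar1.
apply/seteqP; split => t /=.
  move=> /bigmax_leP[_ H] l lp i il.
  rewrite prednK// in lp; have ip := ltn_trans il lp.
  have /bigmax_leP[_ /(_ (Ordinal lp) il)] := H (Ordinal ip) isT.
  by rewrite rhoE.
move=> H; apply/bigmax_leP; split => // i _; apply/bigmax_leP; split => // j ij.
by rewrite rhoE; apply: H => //; rewrite prednK.
Qed.

End innovations.

(** * Gaussian tails along sequences of thresholds *)

Section mills.
Context {R : realType}.
Local Notation mu := (@lebesgue_measure R).

Definition gauss_density (x : R) : R := (Num.sqrt (2 * pi))^-1 * expR (- (x ^+ 2 / 2)).

Lemma normal_pdf_gauss_density : normal_pdf 0 1 = gauss_density.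
Proof.
apply/funext => x; rewrite normal_pdf01 /gauss_density /normal_peak expr1n mul1r mulNr.
by rewrite -mulr_natl.
Qed.

Lemma gauss_density_gt0 x : 0 < gauss_density x.
Proof. by rewrite mulr_gt0 ?expR_gt0// invr_gt0 sqrtr_gt0 mulr_gt0// pi_gt0. Qed.

(** [F] is a primitive of [f]. On the half-line from [t], [f] lies between the density and
    [1 + t ^- 2] times the density, so the single integral of [f] yields both Mills bounds. *)
Let f (x : R) : R := gauss_density x * (1 + (x ^+ 2)^-1).
Let F (x : R) : R := - (gauss_density x / x).

Let is_derive_density (x : R) :
  is_derive x 1 gauss_density (- x * gauss_density x).
Proof.
rewrite /gauss_density.
apply: is_derive_eq; rewrite /GRing.scale/=; field.
by rewrite gt_eqF// sqrtr_gt0 mulr_gt0// pi_gt0.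
Qed.

Let is_derive_F (x : R) : x != 0 -> is_derive x 1 F (f x).
Proof.
move=> x0; rewrite /F /f; have dg := is_derive_density x.
have dV : is_derive x 1 (fun y : R => y^-1) (- x ^- 2).
  apply: DeriveDef; first exact: derivableV.
  by rewrite deriveV// derive_id /GRing.scale/= mulr1.
by apply: is_derive_eq; rewrite /GRing.scale/=; field.
Qed.

Let cvg_F : F x @[x --> +oo] --> (0 : R).
Proof.
have V0 : x^-1 @[x --> +oo] --> (0 : R).
  by apply/gtr0_cvgV0 => //; exact: nbhs_pinfty_gt.
rewrite -oppr0; apply: cvgN; pose c : R := (Num.sqrt (2 * pi))^-1.
have c0 : 0 <= c by rewrite invr_ge0 sqrtr_ge0.
apply: (@squeeze_cvgr _ _ _ _ (cst 0) (fun x => c * x^-1)).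
- near=> x; have x0 : 0 < x by near: x; exact: nbhs_pinfty_gt.
  apply/andP; split; first by rewrite /= divr_ge0 ?ltW ?gauss_density_gt0.
  rewrite ler_pM2r ?invr_gt0// /gauss_density -/c ler_piMr//.
  by rewrite -expR0 ler_expR oppr_le0 divr_ge0 ?sqr_ge0.
- exact: cvg_cst.
- by rewrite -(mulr0 c); apply: cvgM; [exact: cvg_cst|].
Unshelve. all: by end_near.
Qed.

Let continuous_f (x : R) : x != 0 -> {for x, continuous f}.
Proof.
move=> x0; apply: continuousM.
  apply: differentiable_continuous; apply/derivable1_diffP.
  by have [] := is_derive_density x.
apply: continuousD; first exact: cvg_cst.
apply: continuousV; first by rewrite expf_neq0.
exact: exprn_continuous.
Qed.

Lemma integral_mills (t : R) : 0 < t ->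
  (\int[mu]_(x in `[t, +oo[) (f x)%:E = (gauss_density t / t)%:E)%E.
Proof.
move=> t0.
have gt_neq0 x : t <= x -> x != 0 by move=> tx; rewrite gt_eqF// (lt_le_trans t0).
have f_ge0 x : t <= x -> 0 <= f x.
  move=> tx; rewrite /f mulr_ge0 ?ltW ?gauss_density_gt0// addr_gt0//.
  by rewrite invr_gt0 exprn_gt0// (lt_le_trans t0).
have cf : {within `[t, +oo[, continuous f}.
  apply: continuous_in_subspaceT => x; rewrite inE /= in_itv/= andbT => tx.
  exact: continuous_f (gt_neq0 _ tx).
have dF x : t < x -> derivable F x 1.
  by move=> tx; have [] := is_derive_F (gt_neq0 _ (ltW tx)).
have Ft : F x @[x --> t^'+] --> F t.
  apply: cvg_at_right_filter; apply: differentiable_continuous; apply/derivable1_diffP.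
  by have [] := is_derive_F (gt_neq0 _ (lexx t)).
have dFE : {in `]t, +oo[, derive1 F =1 f}.
  move=> x; rewrite in_itv/= andbT => tx; rewrite derive1E.
  by have [] := is_derive_F (gt_neq0 _ (ltW tx)).
rewrite (ge0_continuous_FTC2y f_ge0 cf cvg_F dF Ft dFE).
by rewrite /F EFinN oppeK add0e.
Qed.

Lemma EFin_gtail_integral (t : R) :
  ((gtail t)%:E = \int[mu]_(x in `[t, +oo[) (gauss_density x)%:E)%E.
Proof.
rewrite EFin_gtail /normal_prob normal_pdf_gauss_density -integral_itv_obnd_cbnd.
  by rewrite set_itvoy.
apply/measurable_EFinP; apply: measurable_funTS; rewrite -normal_pdf_gauss_density.
exact: measurable_normal_pdf.
Qed.

Lemma mills_upper (t : R) : 0 < t -> gtail t <= gauss_density t / t.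
Proof.
move=> t0; rewrite -lee_fin -integral_mills// EFin_gtail_integral.
have mg : measurable_fun [set: R] gauss_density.
  by rewrite -normal_pdf_gauss_density; exact: measurable_normal_pdf.
apply: ge0_le_integral => //.
- by move=> x _; rewrite lee_fin ltW ?gauss_density_gt0.
- by apply/measurable_EFinP; exact: measurable_funTS.
- apply/measurable_EFinP; apply: measurable_funTS; apply: measurable_funM => //.
  apply: measurable_funD => //; apply: measurable_inv_ge0 => // x; exact: sqr_ge0.
- move=> x _; rewrite lee_fin /f -[leLHS]mulr1 ler_pM2l ?gauss_density_gt0// lerDl.
  by rewrite invr_ge0 sqr_ge0.
Qed.

Lemma mills_lower (t : R) : 0 < t ->
  gauss_density t / t <= (1 + t ^- 2) * gtail t.
Proof.
move=> t0; rewrite -lee_fin -integral_mills// EFinM EFin_gtail_integral.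
have mg : measurable_fun [set: R] gauss_density.
  by rewrite -normal_pdf_gauss_density; exact: measurable_normal_pdf.
have mgE : measurable_fun `[t, +oo[ (fun x => (gauss_density x)%:E).
  by apply/measurable_EFinP; exact: measurable_funTS.
have t2 : 0 <= 1 + t ^- 2 by rewrite addr_ge0// invr_ge0 sqr_ge0.
rewrite -ge0_integralZl//; last first.
  by move=> x _; rewrite lee_fin ltW ?gauss_density_gt0.
apply: ge0_le_integral => //.
- move=> x _; rewrite lee_fin mulr_ge0 ?ltW ?gauss_density_gt0//.
  by rewrite ltr_pwDl// invr_ge0 sqr_ge0.
- apply/measurable_EFinP; apply: measurable_funTS; apply: measurable_funM => //.
  apply: measurable_funD => //; apply: measurable_inv_ge0 => // x; exact: sqr_ge0.
- exact: emeasurable_funM.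
- move=> x /=; rewrite in_itv/= andbT => tx; rewrite -EFinM lee_fin.
  rewrite /f [leRHS]mulrC ler_pM2l ?gauss_density_gt0//.
  rewrite lerD2l lef_pV2 ?posrE ?exprn_gt0// ?(lt_le_trans t0)//.
  by rewrite lerXn2r// nnegrE ltW// (lt_le_trans t0).
Qed.

End mills.

(** * Limits of sequences and of Gaussian tails *)

Section sequence_limits.
Context {R : realType}.
Implicit Types f g l t tau A : nat -> R.

Lemma near_cvg f g (a : R) : (\forall n \near \oo, f n = g n) ->
  f @ \oo --> a -> g @ \oo --> a.
Proof.
by move=> fg fa; apply: cvg_trans fa; apply: near_eq_cvg; apply: filterS fg => n ->.
Qed.

Lemma near_ge f (B : R) : f @ \oo --> +oo -> \forall n \near \oo, B <= f n.
Proof. by move=> /cvgryPge; apply. Qed.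

Lemma near_gt f (B : R) : f @ \oo --> +oo -> \forall n \near \oo, B < f n.
Proof. by move=> /cvgryPgt; apply. Qed.

Lemma near_lim_gt f (a b : R) : f @ \oo --> a -> b < a ->
  \forall n \near \oo, b < f n.
Proof. by move=> /cvgr_gt + ba; apply. Qed.

Lemma near_lim_lt f (a b : R) : f @ \oo --> a -> a < b ->
  \forall n \near \oo, f n < b.
Proof. by move=> /cvgr_lt + ba; apply. Qed.

Lemma cvg_sumr f g (a b c : R) : c = a + b -> f @ \oo --> a -> g @ \oo --> b ->
  (fun n => f n + g n) @ \oo --> c.
Proof. by move=> -> fa gb; exact: cvgD. Qed.

Lemma cvg_addl f (k a : R) : f @ \oo --> a -> (fun n => k + f n) @ \oo --> k + a.
Proof. by move=> fa; apply: cvg_sumr fa; [reflexivity|exact: cvg_cst]. Qed.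

Lemma cvg_subr f g (a b c : R) : c = a - b -> f @ \oo --> a -> g @ \oo --> b ->
  (fun n => f n - g n) @ \oo --> c.
Proof. by move=> -> fa gb; exact: cvgB. Qed.

Lemma cvg_prodr f g (a b c : R) : c = a * b -> f @ \oo --> a -> g @ \oo --> b ->
  (fun n => f n * g n) @ \oo --> c.
Proof. by move=> -> fa gb; exact: cvgM. Qed.

Lemma cvg_scale f (k a c : R) : c = k * a -> f @ \oo --> a ->
  (fun n => k * f n) @ \oo --> c.
Proof. by move=> -> fa; apply: cvg_prodr fa => //; exact: cvg_cst. Qed.

Lemma cvg_inv f (a c : R) : c = a^-1 -> a != 0 -> f @ \oo --> a ->
  (fun n => (f n)^-1) @ \oo --> c.
Proof. by move=> -> a0 fa; exact: cvgV. Qed.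

Lemma cvg_exp f (a c : R) : c = expR a -> f @ \oo --> a ->
  (fun n => expR (f n)) @ \oo --> c.
Proof. by move=> -> fa; apply: continuous_cvg => //; exact: continuous_expR. Qed.

Lemma cvg_sqrtr f (a c : R) : c = Num.sqrt a -> f @ \oo --> a ->
  (fun n => Num.sqrt (f n)) @ \oo --> c.
Proof. by move=> -> fa; apply: continuous_cvg => //; exact: sqrt_continuous. Qed.

Lemma cvg_infty_inv f : f @ \oo --> +oo -> (fun n => (f n)^-1) @ \oo --> (0 : R).
Proof.
move=> fy; apply/gtr0_cvgV0 => //.
by move/cvgryPgt : fy; apply.
Qed.

Lemma cvg_exp_Ny f : f @ \oo --> -oo -> (fun n => expR (f n)) @ \oo --> (0 : R).
Proof.
move=> fN; have -> : (fun n => expR (f n)) = (fun n => (expR (- f n))^-1).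
  by apply/funext => n; rewrite expRN invrK.
apply: cvg_infty_inv; apply/cvgryPge => B.
move/cvgrNyPle: fN => /(_ (- B)); apply: filterS => n h.
by apply: le_trans (expR_ge1Dx _); lra.
Qed.

Lemma cvg_addl_Ny f (k : R) : f @ \oo --> -oo -> (fun n => k + f n) @ \oo --> -oo.
Proof.
move=> /cvgrNyPle fN; apply/cvgrNyPle => B; have := fN (B - k); apply: filterS => n.
by rewrite -lerBrDl.
Qed.

Lemma cvg_mul_infty f l (a : R) : 0 < a -> f @ \oo --> a -> l @ \oo --> +oo ->
  (fun n => f n * l n) @ \oo --> +oo.
Proof.
move=> a0 fa ly; apply/cvgryPge => B.
have a2 : a / 2 < a by lra.
have F := near_lim_gt fa a2.
have L0 := near_ge 0 ly; have L := near_ge (2 * B / a) ly.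
near=> n; have fn : a / 2 < f n by near: n.
have ln0 : 0 <= l n by near: n.
have lB : 2 * B / a <= l n by near: n.
apply: (@le_trans _ _ (a / 2 * l n)); last by rewrite ler_wpM2r// ltW.
by rewrite -[leLHS](_ : a / 2 * (2 * B / a) = B); [rewrite ler_pM2l//; lra|field; rewrite gt_eqF].
Unshelve. all: by end_near. Qed.

Lemma gauss_density_le (t : R) : gauss_density t <= expR (- (t ^+ 2 / 2)).
Proof.
have p2 : (1 : R) <= 2 * pi by have := pi_ge2 R; lra.
have s1 : (1 : R) <= Num.sqrt (2 * pi) by rewrite -[leLHS]sqrtr1 ler_wsqrtr.
rewrite /gauss_density ler_piMl ?expR_ge0// invf_le1//.
exact: lt_le_trans s1.
Qed.

Lemma gtail_le_expR (t : R) : 1 <= t -> gtail t <= expR (- (t ^+ 2 / 2)).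
Proof.
move=> t1; have t0 : 0 < t by lra.
apply: (le_trans (mills_upper t0)); apply: le_trans (gauss_density_le t).
by rewrite ler_pdivrMr// ler_peMr// ltW// gauss_density_gt0.
Qed.

Variable l : nat -> R.
Hypothesis ly : l @ \oo --> +oo.

Let l_gt0 : \forall n \near \oo, 0 < l n.
Proof. exact: near_gt. Qed.

Lemma cvg_sqrt_infty : (fun n => Num.sqrt (l n)) @ \oo --> +oo.
Proof.
apply/cvgryPge => B; have := near_ge (B ^+ 2) ly; apply: filterS => n h.
by rewrite (le_trans (ler_norm B))// -sqrtr_sqr ler_wsqrtr.
Qed.

Lemma cvg_ratio_infty tau (k : R) : 0 < k ->
  (fun n => tau n / Num.sqrt (l n)) @ \oo --> k -> tau @ \oo --> +oo.
Proof.
move=> k0 tk; have H := cvg_mul_infty k0 tk cvg_sqrt_infty.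
apply: cvg_trans H; apply: near_eq_cvg; near=> n.
have ln : 0 < l n by near: n.
by rewrite divfK// gt_eqF// sqrtr_gt0.
Unshelve. all: by end_near. Qed.

(** The factor [1 / tau] of Mills' ratio behaves like [expR (- ln (l n) / 2) / k]: hence the
    logarithm in the exponent and the [k] in the limit. *)
Lemma tail_rate A tau (k m : R) : 0 < k ->
  (fun n => tau n / Num.sqrt (l n)) @ \oo --> k ->
  (fun n => expR (A n - tau n ^+ 2 / 2 - ln (l n) / 2)) @ \oo --> m ->
  (fun n => expR (A n) * gtail (tau n)) @ \oo --> m / (k * Num.sqrt (2 * pi)).
Proof.
move=> k0 tk Gm; have k_neq0 : k != 0 by rewrite gt_eqF.
have ty := cvg_ratio_infty k0 tk.
have t_gt0 : \forall n \near \oo, 0 < tau n by exact: near_gt.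
pose U n := expR (A n) * (gauss_density (tau n) / tau n).
have Ulim : U @ \oo --> m / (k * Num.sqrt (2 * pi)).
  apply: (@near_cvg (fun n => (Num.sqrt (2 * pi))^-1 *
    (expR (A n - tau n ^+ 2 / 2 - ln (l n) / 2) * (tau n / Num.sqrt (l n))^-1))).
    near=> n; have ln0 : 0 < l n by near: n.
    have tn0 : 0 < tau n by near: n.
    have sl : Num.sqrt (l n) = expR (ln (l n) / 2).
      by rewrite -powR12_sqrt ?ltW// /powR gt_eqF// mulrC.
    rewrite /U /gauss_density sl !expRD !expRN; field.
    by apply/and4P; split; rewrite gt_eqF ?expR_gt0// sqrtr_gt0 mulr_gt0// pi_gt0.
  apply: cvg_scale; last first.
    by apply: (cvg_prodr _ Gm); [reflexivity|apply: cvg_inv tk].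
  by rewrite invfM; ring.
have inv2 : (fun n => tau n ^- 2) @ \oo --> (0 : R).
  rewrite (_ : (fun n => tau n ^- 2) = (fun n => (tau n)^-1 * (tau n)^-1)).
    by apply: cvg_prodr; [|exact: cvg_infty_inv ty|exact: cvg_infty_inv ty]; rewrite mulr0.
  by apply/funext => n; rewrite expr2 invfM.
apply: (@squeeze_cvgr _ _ _ _ (fun n => U n * (1 + tau n ^- 2)^-1) U) => //.
- near=> n; have tn0 : 0 < tau n by near: n.
  have p0 : 0 < 1 + tau n ^- 2 by rewrite ltr_pwDl// invr_ge0 sqr_ge0.
  apply/andP; split.
    rewrite /U -mulrA ler_pM2l ?expR_gt0// ler_pdivrMr// [leRHS]mulrC.
    exact: mills_lower.
  by rewrite /U ler_pM2l ?expR_gt0//; exact: mills_upper.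
- apply: cvg_prodr Ulim _; first by rewrite -[LHS]mulr1; reflexivity.
  apply: (@cvg_inv _ 1); rewrite ?invr1 ?oner_neq0//.
  by apply: cvg_sumr inv2; [rewrite addr0|exact: cvg_cst].
Unshelve. all: by end_near. Qed.

Lemma ratio_perturb t tau (k : R) :
  (fun n => t n / Num.sqrt (l n)) @ \oo --> k ->
  (fun n => (tau n - t n) * Num.sqrt (l n)) @ \oo --> (0 : R) ->
  (fun n => tau n / Num.sqrt (l n)) @ \oo --> k.
Proof.
move=> tk d0.
apply: (@near_cvg (fun n => t n / Num.sqrt (l n) +
    (tau n - t n) * Num.sqrt (l n) * (l n)^-1)).
  near=> n; have ln0 : 0 < l n by near: n.
  have s0 : Num.sqrt (l n) != 0 by rewrite gt_eqF// sqrtr_gt0.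
  have -> : (l n)^-1 = Num.sqrt (l n) ^- 2 by rewrite sqr_sqrtr// ltW.
  by field.
apply: cvg_sumr tk _; first by rewrite -[LHS]addr0; reflexivity.
by apply: cvg_prodr d0 (cvg_infty_inv ly); rewrite mulr0.
Unshelve. all: by end_near. Qed.

(** As [tau] and [t] are of order [sqrt l], a difference of [o(1 / sqrt l)] changes the exponent by
    o(1) only. This measures how much tolerance the thresholds can bear. *)
Lemma tail_limit A t tau (k m : R) : 0 < k ->
  (fun n => t n / Num.sqrt (l n)) @ \oo --> k ->
  (fun n => (tau n - t n) * Num.sqrt (l n)) @ \oo --> (0 : R) ->
  (fun n => expR (A n - t n ^+ 2 / 2 - ln (l n) / 2)) @ \oo --> m ->
  (fun n => expR (A n) * gtail (tau n)) @ \oo --> m / (k * Num.sqrt (2 * pi)).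
Proof.
move=> k0 tk d0 Gm; have tauk := ratio_perturb tk d0.
apply: (tail_rate k0 tauk).
apply: (@near_cvg (fun n => expR (A n - t n ^+ 2 / 2 - ln (l n) / 2) *
   expR (- (2^-1 * ((tau n - t n) * Num.sqrt (l n) *
     (tau n / Num.sqrt (l n) + t n / Num.sqrt (l n))))))).
  near=> n; have ln0 : 0 < l n by near: n.
  have s0 : Num.sqrt (l n) != 0 by rewrite gt_eqF// sqrtr_gt0.
  by rewrite -expRD; congr expR; field.
apply: cvg_prodr Gm _; first by rewrite -[LHS]mulr1; reflexivity.
apply: (@cvg_exp _ (- (2^-1 * (0 * (k + k))))); first by rewrite mul0r mulr0 oppr0 expR0.
apply: cvgN; apply: cvg_scale; first reflexivity.
by apply: cvg_prodr d0 _; [reflexivity|apply: cvg_sumr tauk tk].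
Unshelve. all: by end_near. Qed.

(** The strict inequality leaves a factor exponentially small in [l], so the crude tail bound
    without [1 / tau] suffices. *)
Lemma tail_small tau (k c : R) : 0 < k -> c < k ^+ 2 / 2 ->
  (fun n => tau n / Num.sqrt (l n)) @ \oo --> k ->
  (fun n => expR (c * l n) * gtail (tau n)) @ \oo --> (0 : R).
Proof.
move=> k0 ck tk; have ty := cvg_ratio_infty k0 tk.
have t_ge1 : \forall n \near \oo, 1 <= tau n by exact: near_ge.
apply: (@squeeze_cvgr _ _ _ _ (fun=> 0)
  (fun n => expR (- ((2^-1 * (tau n / Num.sqrt (l n)) ^+ 2 - c) * l n)))).
- near=> n; have ln0 : 0 < l n by near: n.
  have tn : 1 <= tau n by near: n.
  have s0 : Num.sqrt (l n) != 0 by rewrite gt_eqF// sqrtr_gt0.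
  rewrite mulr_ge0 ?expR_ge0 ?gtail_ge0//=.
  apply: (@le_trans _ _ (expR (c * l n) * expR (- (tau n ^+ 2 / 2)))).
    by rewrite ler_pM2l ?expR_gt0// gtail_le_expR.
  rewrite -expRD ler_expR le_eqVlt; apply/orP; left; apply/eqP.
  have la : l n = Num.sqrt (l n) ^+ 2 by rewrite sqr_sqrtr// ltW.
  have -> : - ((2^-1 * (tau n / Num.sqrt (l n)) ^+ 2 - c) * l n) =
    c * l n - 2^-1 * (tau n / Num.sqrt (l n)) ^+ 2 * l n by ring.
  by rewrite [X in _ = _ - _ * X]la; field.
- exact: cvg_cst.
- apply: cvg_exp_Ny; apply/cvgNry; rewrite (_ : - _ = (fun n =>
      (2^-1 * (tau n / Num.sqrt (l n)) ^+ 2 - c) * l n)); last first.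
    by apply/funext => n /=; rewrite -[LHS]/(- _) opprK.
  apply: (@cvg_mul_infty _ _ (2^-1 * k ^+ 2 - c)) => //; first by lra.
  apply: cvg_subr (cvg_cst c); first reflexivity.
  apply: cvg_scale; first reflexivity.
  by rewrite expr2; under eq_fun do rewrite expr2; exact: (cvg_prodr erefl tk tk).
Unshelve. all: by end_near. Qed.

End sequence_limits.

(** * The perturbed thresholds have the same limits *)

Section thresholds.
Context {R : realType} (r t l eta s : nat -> R).
Local Notation w := (fun n => r n * Num.sqrt n%:R).
Local Notation u := (fun n => t n / Num.sqrt n%:R).
Hypotheses (ly : l @ \oo --> +oo) (s_gt0 : forall n, 0 < s n).
Hypothesis r_s_sqr : forall n, r n ^+ 2 + s n ^+ 2 = 1.
Hypothesis near_eta : \forall n \near \oo,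
  [/\ 0 < Num.sqrt n%:R :> R, 0 < eta n, Num.sqrt (l n) = eta n * Num.sqrt n%:R &
      l n = (eta n * Num.sqrt n%:R) ^+ 2].
Hypothesis leta : (fun n => l n * eta n) @ \oo --> (0 : R).
Hypothesis wlim : (fun n => w n / Num.sqrt (l n)) @ \oo --> 2 - Num.sqrt 2.
Hypothesis tlim : (fun n => t n / Num.sqrt (l n)) @ \oo --> (2 : R).

Let l_gt0 : \forall n \near \oo, 0 < l n. Proof. exact: near_gt ly. Qed.

Lemma eta_cvg0 : eta @ \oo --> (0 : R).
Proof.
apply: (@near_cvg _ (fun n => l n * eta n * (l n)^-1)).
  near=> n; have l0 : 0 < l n by near: n.
  by rewrite mulrAC mulfV ?mul1r// gt_eqF.
by apply: cvg_prodr leta (cvg_infty_inv ly); rewrite mulr0.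
Unshelve. all: by end_near. Qed.

Local Notation a := (fun n => t n / Num.sqrt (l n)).
Local Notation b := (fun n => w n / Num.sqrt (l n)).
Local Notation c := (fun n => l n * eta n).

Lemma r_eta : \forall n \near \oo, r n = b n * eta n.
Proof.
apply: filterS near_eta => n [n0 e0 h _].
by rewrite h; field; rewrite !gt_eqF.
Qed.

Lemma r_cvg0 : r @ \oo --> (0 : R).
Proof.
apply: (@near_cvg _ (fun n => b n * eta n)).
  by apply: filterS r_eta => n h; exact: esym h.
by apply: cvg_prodr wlim eta_cvg0; rewrite mulr0.
Qed.

Lemma s_cvg1 : s @ \oo --> (1 : R).
Proof.
apply: (@near_cvg _ (fun n => Num.sqrt (1 - r n ^+ 2))).
  near=> n; rewrite -(r_s_sqr n) addrC addKr sqrtr_sqr gtr0_norm//.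
apply: (@cvg_sqrtr _ _ 1); first by rewrite sqrtr1.
apply: (@cvg_subr _ _ _ 1 0); [by rewrite subr0|exact: cvg_cst|].
under eq_fun do rewrite expr2.
by apply: (@cvg_prodr _ _ _ 0 0); rewrite ?mulr0//; exact: r_cvg0.
Unshelve. all: by end_near. Qed.

Let sV : (fun n => (s n)^-1) @ \oo --> (1 : R).
Proof. by apply: cvg_inv s_cvg1; rewrite ?invr1 ?oner_neq0. Qed.

Let sVV : (fun n => (s n)^-1 * (1 + s n)^-1) @ \oo --> (1 * (1 + 1)^-1 : R).
Proof.
apply: (cvg_prodr erefl sV); apply: cvg_inv erefl _ _.
  by rewrite gt_eqF// addr_gt0.
exact: (cvg_addl s_cvg1).
Qed.

Lemma adjacent_ratio : (fun n => (t n - w n) / Num.sqrt (l n)) @ \oo --> (Num.sqrt 2 : R).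
Proof.
under eq_fun do rewrite mulrBl.
by apply: cvg_subr tlim wlim; ring.
Qed.

(** Here and in the three other differences, expressing [t], [w] and [r] through their ratios to
    [sqrt l] and through [eta] leaves [l * eta] times a convergent factor. *)
Lemma far_lo_diff :
  (fun n => (far_lo n%:R (eta n) (u n) (r n) - t n) * Num.sqrt (l n)) @ \oo --> (0 : R).
Proof.
apply: (@near_cvg _ (fun n => c n * (- 8 * a n - b n * a n * (1 + 8 * eta n)))).
  apply: filterS near_eta => n [n0 e0 h lE].
  by rewrite /far_lo h lE; field; rewrite !gt_eqF.
apply: cvg_prodr leta _; last first.
  apply: cvg_subr; [reflexivity|exact: (cvg_scale erefl tlim)|].
  apply: (cvg_prodr erefl (cvg_prodr erefl wlim tlim)).
  exact: (cvg_addl (cvg_scale erefl eta_cvg0)).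
by rewrite mul0r.
Qed.

Lemma near_lo_diff :
  (fun n => (near_lo n%:R (eta n) (u n) (r n) - (t n - w n)) * Num.sqrt (l n))
  @ \oo --> (0 : R).
Proof.
apply: (@near_cvg _ (fun n => c n * (- 8 * (a n + b n)))).
  apply: filterS near_eta => n [n0 e0 h lE].
  by rewrite /near_lo h lE; field; rewrite !gt_eqF.
apply: cvg_prodr leta (cvg_scale erefl (cvg_sumr erefl tlim wlim)).
by rewrite mul0r.
Qed.

(** Exhibits [(s n)^-1 - 1] as a multiple of [r n ^+ 2], hence of second order in [eta]. *)
Let s_expand n : (s n)^-1 = 1 + r n ^+ 2 * ((s n)^-1 * (1 + s n)^-1).
Proof.
move: (s_gt0 n) (r_s_sqr n); move: (s n) => s' s0 rs.
have -> : r n ^+ 2 = 1 - s' ^+ 2 by apply/eqP; rewrite eq_sym subr_eq rs.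
by field; rewrite !gt_eqF// addr_gt0.
Qed.

Lemma far_hi_diff :
  (fun n => (far_hi n%:R (eta n) (u n) (r n) (s n) - t n) * Num.sqrt (l n))
  @ \oo --> (0 : R).
Proof.
apply: (@near_cvg _ (fun n => c n * (a n * (b n * b n) * eta n * ((s n)^-1 * (1 + s n)^-1) +
   (8 * a n + 10 * b n * (1 + 8 * eta n)) * (s n)^-1))).
  apply: filterS near_eta => n [n0 e0 h lE].
  have -> : (far_hi n%:R (eta n) (u n) (r n) (s n) - t n) * Num.sqrt (l n) =
    (t n * ((s n)^-1 - 1) + (8 * eta n * t n + 10 * eta n * w n * (1 + 8 * eta n)) * (s n)^-1)
    * Num.sqrt (l n).
    by rewrite /far_hi divfK ?gt_eqF//; ring.
  rewrite h lE; have := s_expand n; move: (s n)^-1 (1 + s n)^-1 => s1 s2 sE.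
  by rewrite [X in _ = (_ * (X - 1) + _) * _]sE; field; rewrite !gt_eqF.
apply: cvg_prodr leta _; last first.
  apply: cvg_sumr; [reflexivity| |].
    exact: (cvg_prodr erefl (cvg_prodr erefl (cvg_prodr erefl tlim
      (cvg_prodr erefl wlim wlim)) eta_cvg0) sVV).
  apply: (fun h => cvg_prodr erefl h sV).
  apply: (cvg_sumr erefl (cvg_scale erefl tlim)).
  apply: (cvg_prodr erefl (cvg_scale erefl wlim)).
  exact: (cvg_addl (cvg_scale erefl eta_cvg0)).
by rewrite mul0r.
Qed.

Lemma near_hi_diff :
  (fun n => (near_hi n%:R (eta n) (u n) (r n) (s n) - (t n - w n)) * Num.sqrt (l n))
  @ \oo --> (0 : R).
Proof.
apply: (@near_cvg _ (fun n => c n * ((a n - b n) * (b n * b n) * eta n * ((s n)^-1 * (1 + s n)^-1) +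
   8 * (a n + b n) * (s n)^-1))).
  apply: filterS near_eta => n [n0 e0 h lE].
  have -> : (near_hi n%:R (eta n) (u n) (r n) (s n) - (t n - w n)) * Num.sqrt (l n) =
    ((t n - w n) * ((s n)^-1 - 1) + 8 * eta n * (t n + w n) * (s n)^-1) * Num.sqrt (l n).
    by rewrite /near_hi divfK ?gt_eqF//; ring.
  rewrite h lE; have := s_expand n; move: (s n)^-1 (1 + s n)^-1 => s1 s2 sE.
  by rewrite [X in _ = (_ * (X - 1) + _) * _]sE; field; rewrite !gt_eqF.
apply: cvg_prodr leta _; last first.
  apply: cvg_sumr; [reflexivity| |].
    exact: (cvg_prodr erefl (cvg_prodr erefl (cvg_prodr erefl (cvg_subr erefl tlim wlim)
      (cvg_prodr erefl wlim wlim)) eta_cvg0) sVV).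
  apply: (fun h => cvg_prodr erefl h sV).
  exact: (cvg_scale erefl (cvg_sumr erefl tlim wlim)).
by rewrite mul0r.
Qed.

End thresholds.

(** * Numbers of pairs against one-pair probabilities *)

Section counting_limits.
Context {R : realType} (p : nat -> nat).
Local Notation pn := (fun n => (p n)%:R : R).
Hypothesis py : pn @ \oo --> +oo.

Lemma natr_bin2 m : 'C(m, 2)%:R = m%:R * (m%:R - 1) / 2 :> R.
Proof.
elim: m => [|m IH]; first by rewrite bin0n mul0r mul0r.
by rewrite binS natrD IH bin1 -natr1; field.
Qed.

Lemma natr_pred m : (0 : R) < m%:R -> (m.-1)%:R = m%:R - 1 :> R.
Proof. by case: m => [|m]; rewrite ?ltxx// => _; rewrite -[in RHS]natr1 addrK. Qed.

Lemma ln_cvg_infty : (fun n => ln (pn n)) @ \oo --> +oo.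
Proof.
apply/cvgryPge => B; have := near_ge (expR B) py; apply: filterS => n h.
by rewrite -[leLHS]expRK ler_ln ?posrE ?expR_gt0// (lt_le_trans (expR_gt0 B)).
Qed.

Lemma expR_2ln_sub (x : R) : 0 < x -> expR (2 * ln x - ln 2) = x * x / 2.
Proof.
move=> x0; have two0 : (0 : R) < 2 by [].
by rewrite expRD expRN (lnK two0) mulr_natl mulr2n expRD lnK ?posrE.
Qed.

Context (gF gN : nat -> R) (mu1 mu2 : R).
Hypothesis F1 : (fun n => expR (2 * ln (pn n) - ln 2) * gF n) @ \oo --> mu1.
Hypothesis N1 : (fun n => expR (ln (pn n)) * gN n) @ \oo --> mu2.

Let pV : (fun n => (pn n)^-1) @ \oo --> (0 : R). Proof. exact: cvg_infty_inv. Qed.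

Lemma rate_sum_cvg :
  (fun n => 'C((p n).-1, 2)%:R * gF n + ((p n).-1)%:R * gN n) @ \oo --> mu1 + mu2.
Proof.
apply: (@near_cvg _ (fun n =>
  (1 - (pn n)^-1) * (1 - 2 * (pn n)^-1) * (expR (2 * ln (pn n) - ln 2) * gF n) +
  (1 - (pn n)^-1) * (expR (ln (pn n)) * gN n))).
  near=> n; have p0 : 0 < pn n by near: n; exact: near_gt.
  have pE : ((p n).-1)%:R = pn n - 1 by exact: natr_pred.
  by rewrite natr_bin2 pE expR_2ln_sub// lnK ?posrE//; field; exact: lt0r_neq0.
have c1 : (fun n => 1 - (pn n)^-1) @ \oo --> (1 : R).
  by apply: (@cvg_subr _ _ _ 1 0); [rewrite subr0|exact: cvg_cst|exact: pV].
have c2 : (fun n => 1 - 2 * (pn n)^-1) @ \oo --> (1 : R).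
  apply: (@cvg_subr _ _ _ 1 0); [by rewrite subr0|exact: cvg_cst|].
  by apply: cvg_scale pV; rewrite mulr0.
apply: cvg_sumr; [reflexivity| |].
  by apply: cvg_prodr (cvg_prodr erefl c1 c2) F1; rewrite !mul1r.
by apply: cvg_prodr c1 N1; rewrite mul1r.
Unshelve. all: by end_near. Qed.

(** This bounds every one-step rate and serves as the [Q] of the lower recursion; it vanishes
    because it is of the order of a convergent total divided by [p]. *)
Lemma rate_max_cvg0 : (fun n => pn n * gF n + gN n) @ \oo --> (0 : R).
Proof.
apply: (@near_cvg _ (fun n =>
  2 * (pn n)^-1 * (expR (2 * ln (pn n) - ln 2) * gF n) +
  (pn n)^-1 * (expR (ln (pn n)) * gN n))).
  near=> n; have p0 : 0 < pn n by near: n; exact: near_gt.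
  by rewrite expR_2ln_sub// lnK ?posrE//; field; exact: lt0r_neq0.
apply: (@cvg_sumr _ _ _ 0 0); first by rewrite addr0.
  by apply: cvg_prodr (cvg_scale erefl pV) F1; rewrite mulr0 mul0r.
by apply: cvg_prodr pV N1; rewrite mul0r.
Unshelve. all: by end_near. Qed.

End counting_limits.

(** * The limit law of the maximal correlation *)

Section maximum_limit.
Context (R : realType) (d : measure_display) (T : nat -> measurableType d)
  (P : forall n, probability (T n) R) (r : nat -> R) (p : nat -> nat)
  (M : forall n, 'M[R]_(p n)) (z : forall n, 'I_n * 'I_(p n) -> T n -> R).
Hypotheses (r01 : forall n, 0 <= r n < 1)
  (MM : forall n, M n *m (M n)^T = ar1_cov (p n) (r n))
  (Pz : forall n, iid_std_normal (P n) (@z n)).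
Let pn n : R := (p n)%:R.
Let l n : R := ln (pn n).
Let eta n : R := Num.sqrt (l n / n%:R).
Let s n : R := Num.sqrt (1 - r n ^+ 2).
Let w n : R := r n * Num.sqrt n%:R.
Variables (t : nat -> R) (m1 m2 : R).
Let u n : R := t n / Num.sqrt n%:R.
Hypothesis py : pn @ \oo --> +oo.
Hypothesis leta : (fun n => l n * eta n) @ \oo --> (0 : R).
Hypothesis wlim : (fun n => w n / Num.sqrt (l n)) @ \oo --> 2 - Num.sqrt 2.
Hypothesis tlim : (fun n => t n / Num.sqrt (l n)) @ \oo --> (2 : R).
Hypothesis far_lim :
  (fun n => expR (2 * l n - ln 2 - t n ^+ 2 / 2 - ln (l n) / 2)) @ \oo --> m1.
Hypothesis near_lim :
  (fun n => expR (l n - (t n - w n) ^+ 2 / 2 - ln (l n) / 2)) @ \oo --> m2.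

Let ly : l @ \oo --> +oo. Proof. exact: ln_cvg_infty. Qed.
Let pV : (fun n => (pn n)^-1) @ \oo --> (0 : R). Proof. exact: cvg_infty_inv. Qed.

Let s_gt0 n : 0 < s n.
Proof.
by have /andP[r0 r1] := r01 n; rewrite sqrtr_gt0 subr_gt0 expr_lt1.
Qed.

Let r_s_sqr n : r n ^+ 2 + s n ^+ 2 = 1.
Proof.
have /andP[r0 r1] := r01 n.
have r2 : 0 <= 1 - r n ^+ 2 by rewrite subr_ge0 expr_le1// ltW.
by rewrite sqr_sqrtr// addrC subrK.
Qed.

Let near_eta : \forall n \near \oo,
  [/\ 0 < Num.sqrt n%:R :> R, 0 < eta n, Num.sqrt (l n) = eta n * Num.sqrt n%:R &
      l n = (eta n * Num.sqrt n%:R) ^+ 2].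
Proof.
near=> n; have n0 : (0 : R) < n%:R by rewrite ltr0n; near: n; exact: nbhs_infty_gt.
have l0 : 0 < l n by near: n; exact: near_gt.
have h : eta n * Num.sqrt n%:R = Num.sqrt (l n).
  by rewrite -sqrtrM ?divr_ge0 ?ltW// divfK// gt_eqF.
split; rewrite ?sqrtr_gt0 ?divr_gt0//.
by rewrite h sqr_sqrtr// ltW.
Unshelve. all: by end_near. Qed.

Let fl n := far_lo n%:R (eta n) (u n) (r n).
Let nl n := near_lo n%:R (eta n) (u n) (r n).
Let fh n := far_hi n%:R (eta n) (u n) (r n) (s n).
Let nh n := near_hi n%:R (eta n) (u n) (r n) (s n).

Let fl_diff : (fun n => (fl n - t n) * Num.sqrt (l n)) @ \oo --> (0 : R).
Proof. exact: far_lo_diff. Qed.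
Let nl_diff : (fun n => (nl n - (t n - w n)) * Num.sqrt (l n)) @ \oo --> (0 : R).
Proof. exact: near_lo_diff. Qed.
Let fh_diff : (fun n => (fh n - t n) * Num.sqrt (l n)) @ \oo --> (0 : R).
Proof. exact: far_hi_diff. Qed.
Let nh_diff : (fun n => (nh n - (t n - w n)) * Num.sqrt (l n)) @ \oo --> (0 : R).
Proof. exact: near_hi_diff. Qed.
Let tw : (fun n => (t n - w n) / Num.sqrt (l n)) @ \oo --> (Num.sqrt 2 : R).
Proof. exact: adjacent_ratio. Qed.

Let sqrt2 : 0 < Num.sqrt 2 :> R. Proof. by rewrite sqrtr_gt0. Qed.
Let mu1 : R := m1 / (2 * Num.sqrt (2 * pi)).
Let mu2 : R := m2 / (Num.sqrt 2 * Num.sqrt (2 * pi)).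

Let two_gt0 : 0 < 2 :> R. Proof. by []. Qed.

Let flim := tail_limit ly two_gt0 tlim fl_diff far_lim.
Let fhim := tail_limit ly two_gt0 tlim fh_diff far_lim.
Let nlim := tail_limit ly sqrt2 tw nl_diff near_lim.
Let nhim := tail_limit ly sqrt2 tw nh_diff near_lim.

(** By the choice of [eta], [bad_prob] is [2 p^-2] plus [2 p] times the tail at [4 sqrt l], which is
    at most [p^-8]. *)
Let bad_cvg0 : (fun n => pn n * bad_prob n (p n) (eta n)) @ \oo --> (0 : R).
Proof.
apply: (@near_cvg _ (fun n => 2 * (pn n)^-1 +
    2 * (expR (2 * l n) * gtail (4 * eta n * Num.sqrt n%:R)))).
  near=> n; have p0 : 0 < pn n by near: n; exact: near_gt.
  have [n0 e0 h lE] : [/\ 0 < Num.sqrt n%:R :> R, 0 < eta n,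
      Num.sqrt (l n) = eta n * Num.sqrt n%:R & l n = (eta n * Num.sqrt n%:R) ^+ 2].
    by near: n; exact: near_eta.
  have e2l : expR (2 * l n) = pn n * pn n.
    by rewrite mulr_natl mulr2n expRD lnK ?posrE.
  rewrite /bad_prob (_ : 2 * n%:R * eta n ^+ 2 = 2 * l n); last first.
    by rewrite lE exprMn [Num.sqrt n%:R ^+ 2]sqr_sqrtr//; ring.
  by rewrite expRN e2l; field; exact: lt0r_neq0.
apply: (@cvg_sumr _ _ _ 0 0); first by rewrite addr0.
  by apply: cvg_scale pV; rewrite mulr0.
apply: (@cvg_scale _ _ _ 0); first by rewrite mulr0.
apply: (tail_small ly (k := 4)) => //; first by lra.
apply: (@near_cvg _ (fun=> 4)); last exact: cvg_cst.
apply: filterS near_eta => n [n0 e0 h _].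
by rewrite h; field; rewrite !gt_eqF.
Unshelve. all: by end_near. Qed.

Let u_cvg0 : u @ \oo --> (0 : R).
Proof.
apply: (@near_cvg _ (fun n => t n / Num.sqrt (l n) * eta n)).
  apply: filterS near_eta => n [n0 e0 h _].
  by rewrite /u h; field; rewrite !gt_eqF.
by apply: (cvg_prodr _ tlim (eta_cvg0 ly leta)); rewrite mulr0.
Qed.

Let uV : (fun n => (Num.sqrt (2 + 2 * u n))^-1) @ \oo --> ((Num.sqrt 2)^-1 : R).
Proof.
apply: (@cvg_inv _ _ (Num.sqrt 2)); [by []|by rewrite gt_eqF|].
apply: (@cvg_sqrtr _ _ 2); [by []|]; apply: (@cvg_sumr _ _ _ 2 0); rewrite ?addr0//.
  exact: cvg_cst.
by apply: cvg_scale u_cvg0; rewrite mulr0.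
Qed.

Let pair_lim (f g : nat -> R) (a b : R) :
  (fun n => f n / Num.sqrt (l n)) @ \oo --> a ->
  (fun n => g n / Num.sqrt (l n)) @ \oo --> b ->
  (fun n => (f n + g n) / Num.sqrt (2 + 2 * u n) / Num.sqrt (l n)) @ \oo -->
  (a + b) / Num.sqrt 2.
Proof.
move=> fa gb; under eq_fun do rewrite mulrAC mulrDl.
exact: (cvg_prodr erefl (cvg_sumr erefl fa gb) uV).
Qed.

(** The two sums of thresholds, divided by [sqrt 2], are asymptotic to [2 sqrt 2 sqrt l] and
    [(1 + sqrt 2) sqrt l]. Half the squared coefficients are [4] and [3 / 2 + sqrt 2], above the
    exponents 3 and 2 of the numbers of triples. *)
Let pair_cvg0 :
  (fun n => pn n * pair_prob n (p n) (eta n) (u n) (r n) (s n)) @ \oo --> (0 : R).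
Proof.
apply: (@near_cvg _ (fun n =>
    expR (3 * l n) * gtail ((fh n + fh n) / Num.sqrt (2 + 2 * u n)) +
    expR (2 * l n) * gtail ((fh n + nh n) / Num.sqrt (2 + 2 * u n)))).
  near=> n; have p0 : 0 < pn n by near: n; exact: near_gt.
  have e2l : expR (2 * l n) = pn n * pn n.
    by rewrite mulr_natl mulr2n expRD lnK ?posrE.
  have -> : 3 * l n = 2 * l n + l n by ring.
  rewrite expRD e2l lnK ?posrE// /pair_prob -/(pn n) -/(fh n) -/(nh n); ring.
have fk := ratio_perturb ly tlim fh_diff.
have nk := ratio_perturb ly tw nh_diff.
have q2 : (Num.sqrt 2 : R) ^+ 2 = 2 by rewrite sqr_sqrtr.
apply: (@cvg_sumr _ _ _ 0 0); first by rewrite addr0.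
  apply: (tail_small ly (k := (2 + 2) / Num.sqrt 2)); last exact: pair_lim.
    by rewrite divr_gt0.
  by rewrite exprMn exprVn q2; lra.
apply: (tail_small ly (k := (2 + Num.sqrt 2) / Num.sqrt 2)); last exact: pair_lim.
  by rewrite divr_gt0// addr_gt0.
have q1 : (1 : R) < Num.sqrt 2 by rewrite -[ltLHS]sqrtr1 ltr_sqrt ?ltr1n.
by rewrite exprMn exprVn q2 sqrrD q2; lra.
Unshelve. all: by end_near. Qed.

Let sum_lo := rate_sum_cvg py flim nlim.
Let sum_hi := rate_sum_cvg py fhim nhim.
Let max_lo := rate_max_cvg0 py flim nlim.
Let max_hi := rate_max_cvg0 py fhim nhim.

Let lower n := expR (- (('C((p n).-1, 2)%:R * gtail (fl n) +
  ((p n).-1)%:R * gtail (nl n)) / (1 - (pn n * gtail (fl n) + gtail (nl n))))) -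
  pn n * bad_prob n (p n) (eta n).

Let upper n := expR (- ('C((p n).-1, 2)%:R * gtail (fh n) +
  ((p n).-1)%:R * gtail (nh n))) +
  ((p n).-1)%:R * pair_prob n (p n) (eta n) (u n) (r n) (s n) +
  pn n * bad_prob n (p n) (eta n).

Let lower_cvg : lower @ \oo --> expR (- (mu1 + mu2)).
Proof.
apply: cvg_subr bad_cvg0; first by rewrite subr0; reflexivity.
apply: cvg_exp; first reflexivity.
apply: cvgN; apply: (cvg_prodr _ sum_lo); last first.
  apply: (@cvg_inv _ _ 1); [reflexivity|by rewrite oner_neq0|].
  apply: (@cvg_subr _ _ _ 1 0); [by rewrite subr0|exact: cvg_cst|exact: max_lo].
by rewrite invr1 mulr1.
Qed.

Let upper_cvg : upper @ \oo --> expR (- (mu1 + mu2)).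
Proof.
apply: cvg_sumr bad_cvg0; first by rewrite addr0; reflexivity.
apply: (@cvg_sumr _ _ _ _ 0); first by rewrite addr0; reflexivity.
  by apply: cvg_exp; [reflexivity|apply: cvgN; exact: sum_hi].
apply: (@near_cvg _ (fun n => (1 - (pn n)^-1) *
    (pn n * pair_prob n (p n) (eta n) (u n) (r n) (s n)))).
  near=> n; have p0 : 0 < pn n by near: n; exact: near_gt.
  have pE : ((p n).-1)%:R = pn n - 1 by exact: natr_pred.
  by rewrite pE; field; exact: lt0r_neq0.
apply: (@cvg_prodr _ _ _ 1 0); [by rewrite mulr0| |exact: pair_cvg0].
by apply: (@cvg_subr _ _ _ 1 0); [rewrite subr0|exact: cvg_cst|exact: pV].
Unshelve. all: by end_near. Qed.

Let near_pos (f : nat -> R) (k : R) : 0 < k ->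
  (fun n => f n / Num.sqrt (l n)) @ \oo --> k -> \forall n \near \oo, 0 <= f n.
Proof. by move=> k0 fk; apply: near_ge; exact: cvg_ratio_infty fk. Qed.

(* The factors are [exp (- p^2/2 * gtail t_n)] for the far pairs and
   [exp (- p * gtail (t_n - r sqrt n))] for the adjacent ones. *)
Lemma Lmax_limit :
  P n [set x | Lmax (gauss_sample (M n) (fun kj => z kj x)) <= u n] @[n --> \oo] -->
  (expR (- (m1 / (2 * Num.sqrt (2 * pi)) + m2 / (Num.sqrt 2 * Num.sqrt (2 * pi)))))%:E.
Proof.
pose W n := innovations (r n) (s n) (M n) (@z n).
have PW n : iid_std_normal (P n) (W n) := innovations_iid (s_gt0 n) (r_s_sqr n) (MM n) (Pz n).
pose B n := below_set (W n) (u n) (r n) (s n) (p n).-1.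
have mB n : measurable (B n).
  apply: measurable_below => j _; exact: measurable_column (PW n) j.
have near_u : \forall n \near \oo, 0 <= u n.
  by have := near_pos two_gt0 tlim; apply: filterS => n t0; rewrite divr_ge0// sqrtr_ge0.
have H : (fun n => pr (P n) (B n)) @ \oo --> expR (- (mu1 + mu2)).
  apply: (squeeze_cvgr _ lower_cvg upper_cvg); near=> n.
  have n0 : (0 : R) < n%:R by rewrite ltr0n; near: n; exact: nbhs_infty_gt.
  have p0 : (0 < p n)%N by rewrite -(ltr0n R); near: n; exact: near_gt.
  have eta1 : 0 <= eta n <= 100^-1.
    rewrite sqrtr_ge0/= ltW//; near: n; apply: near_lim_lt (eta_cvg0 ly leta) _.
    by rewrite invr_gt0.
  have r1 : 0 <= r n <= eta n.
    have /andP[-> _] /= := r01 n.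
    have [sn e0 h _] : [/\ 0 < Num.sqrt n%:R :> R, 0 < eta n,
      Num.sqrt (l n) = eta n * Num.sqrt n%:R & l n = (eta n * Num.sqrt n%:R) ^+ 2].
      by near: n; exact: near_eta.
    (* Since [eta = sqrt (l / n)], this ratio is [r n / eta n], and its limit [2 - sqrt 2] is below
       1. *)
    have : w n / Num.sqrt (l n) < 1.
      near: n; apply: near_lim_lt wlim _.
      have : (1 : R) < Num.sqrt 2 by rewrite -[ltLHS]sqrtr1 ltr_sqrt ?ltr1n.
      by lra.
    by rewrite h ltr_pdivrMr ?mulr_gt0// mul1r ltr_pM2r// => /ltW.
  have u0 : 0 <= u n by near: n.
  have pm : ((p n).-1 < p n)%N by rewrite prednK.
  have pe : (p n).-1.+1 = p n by rewrite prednK.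
  apply/andP; split.
    rewrite /lower -{4}/(pn n).
    have := below_lower (PW n) n0 eta1 r1 (s_gt0 n) (r_s_sqr n) u0 pm.
    rewrite pe; apply => //.
    - by near: n; apply: near_lim_lt max_lo _.
    - by near: n; exact: near_pos two_gt0 (ratio_perturb ly tlim fl_diff).
    - by near: n; exact: near_pos sqrt2 (ratio_perturb ly tw nl_diff).
  have := below_upper (PW n) n0 eta1 r1 (s_gt0 n) (r_s_sqr n) u0 pm.
  rewrite pe; apply => //.
  - by near: n; exact: near_pos two_gt0 (ratio_perturb ly tlim fh_diff).
  - by near: n; exact: near_pos sqrt2 (ratio_perturb ly tw nh_diff).
  - by apply: ltW; near: n; apply: near_lim_lt max_hi _.
have E : \forall n \near \oo, B n =
    [set x | Lmax (gauss_sample (M n) (fun kj => z kj x)) <= u n].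
  near=> n; have p0 : (0 < p n)%N by rewrite -(ltr0n R); near: n; exact: near_gt.
  have u0 : 0 <= u n by near: n.
  apply/esym; apply: (Lmax_le_below (r n) (M n) (s_gt0 n) (@z n) _ p0).
  by apply: le_trans u0; lra.
apply: cvg_EFin.
  by apply: filterS E => n <-; apply: fin_num_measure; exact: mB.
by apply: near_cvg H; apply: filterS E => n; rewrite /pr /= => ->.
Unshelve. all: by end_near. Qed.

End maximum_limit.

(** * Exponents of the far and adjacent tails at the two normalisations *)

Section threshold_exponents.
Context {R : realType} (l w r : nat -> R) (x : R).
Hypothesis ly : l @ \oo --> +oo.
Hypothesis wlim : (fun n => w n / Num.sqrt (l n)) @ \oo --> 2 - Num.sqrt 2.
Hypothesis rl : (fun n => r n ^+ 2 * l n) @ \oo --> (0 : R).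
Local Notation q := (Num.sqrt 2 : R).
Local Notation sl := (fun n => Num.sqrt (l n)).
Local Notation c4 := (ln (4 * pi) : R).
Local Notation g := (fun n => x - 2^-1 * (ln (l n) + c4)).
Local Notation kappa := (fun n => w n / sl n - (2 - q)).
Local Notation lambda := (fun n => q * l n * kappa n + ((Num.sqrt 8)^-1 - 2^-1) * ln (l n)).

Let q0 : 0 < q. Proof. by rewrite sqrtr_gt0. Qed.
Let qq : q * q = 2. Proof. by rewrite -expr2 sqr_sqrtr. Qed.
Let qV : q^-1 = q / 2.
Proof.
by apply: (mulfI (lt0r_neq0 q0)); rewrite mulfV ?lt0r_neq0// mulrA qq divff.
Qed.
Let sqrt8V : (Num.sqrt 8)^-1 = q / 4.
Proof.
have -> : (8 : R) = 2 ^+ 2 * 2 by rewrite expr2; lra.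
by rewrite sqrtrM ?sqr_ge0// sqrtr_sqr ger0_norm// invfM qV; field.
Qed.

Let near_l : \forall n \near \oo, 0 < sl n /\ l n = sl n * sl n.
Proof.
apply: filterS (near_gt 0 ly) => n l0; rewrite sqrtr_gt0; split => //.
by rewrite -expr2 sqr_sqrtr// ltW.
Qed.

Let slV : (fun n => (sl n)^-1) @ \oo --> (0 : R).
Proof. by apply: cvg_infty_inv; exact: cvg_sqrt_infty. Qed.

(** With [v = l^(1/4)], [ln l = 4 ln v <= 4 v] while [sqrt l = v^2]. *)
Lemma ln_over_sqrt_cvg0 : (fun n => ln (l n) / sl n) @ \oo --> (0 : R).
Proof.
have sy : (fun n => Num.sqrt (sl n)) @ \oo --> +oo.
  exact: cvg_sqrt_infty (cvg_sqrt_infty ly).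
apply: (@squeeze_cvgr _ _ _ _ (fun=> 0) (fun n => 4 * (Num.sqrt (sl n))^-1)).
- near=> n; have l1 : 1 <= l n by near: n; exact: near_ge.
  have ss0 : 0 < Num.sqrt (sl n) by rewrite !sqrtr_gt0; lra.
  have sE : sl n = Num.sqrt (sl n) ^+ 2 by rewrite sqr_sqrtr// sqrtr_ge0.
  have lE : l n = Num.sqrt (sl n) ^+ 4.
    rewrite (_ : 4 = 2 * 2)%N// exprM sqr_sqrtr ?sqrtr_ge0// sqr_sqrtr//; lra.
  apply/andP; split; first by rewrite divr_ge0 ?ln_ge0 ?sqrtr_ge0.
  have s0 : 0 < sl n by rewrite sqrtr_gt0; lra.
  rewrite [X in ln X]lE lnXn// ler_pdivrMr//.
  have -> : 4 / Num.sqrt (sl n) * sl n = Num.sqrt (sl n) *+ 4.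
    by rewrite -mulr_natl [X in _ * X = _]sE; field; rewrite gt_eqF.
  by rewrite lerMn2r /= ltW // ln_sublinear.
- exact: cvg_cst.
- by apply: cvg_scale (cvg_infty_inv sy); rewrite mulr0.
Unshelve. all: by end_near. Qed.

Lemma g_cvg0 : (fun n => g n / sl n) @ \oo --> (0 : R).
Proof.
apply: (@near_cvg _ (fun n => (x - 2^-1 * c4) * (sl n)^-1 - 2^-1 * (ln (l n) / sl n))).
  by apply: nearW => n; ring.
apply: (@cvg_subr _ _ _ 0 0); first by rewrite subr0.
  by apply: cvg_scale slV; rewrite mulr0.
by apply: cvg_scale ln_over_sqrt_cvg0; rewrite mulr0.
Qed.

Let gg_cvg0 (k : R) : (fun n => k * ((g n / sl n) * (g n / sl n))) @ \oo --> (0 : R).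
Proof.
apply: (@cvg_scale _ _ _ 0); first by rewrite mulr0.
by apply: (@cvg_prodr _ _ _ 0 0); [rewrite mulr0|exact: g_cvg0|exact: g_cvg0].
Qed.

(* [pooled_threshold / sqrt n] is the level [(x + b_n) / a_n] of cases (i) and (ii);
   below, [adjacent_threshold / sqrt n] is the level [(x + d_n) / c_n] of case (iii). *)
Definition pooled_threshold n : R := (x + (4 * l n - 2^-1 * (ln (l n) + c4))) / (2 * sl n).

Let pooled_thresholdE : \forall n \near \oo, pooled_threshold n = 2 * sl n + 2^-1 * (g n / sl n).
Proof.
apply: filterS near_l => n [s0 lE]; rewrite /pooled_threshold [X in 4 * X]lE.
by field; rewrite gt_eqF.
Qed.

Lemma pooled_threshold_ratio : (fun n => pooled_threshold n / sl n) @ \oo --> (2 : R).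
Proof.
apply: (@near_cvg _ (fun n => 2 + 2^-1 * (g n / sl n) * (sl n)^-1)).
  apply: filterS2 pooled_thresholdE near_l => n -> [s0 _]; field; exact: lt0r_neq0.
apply: (@cvg_sumr _ _ _ 2 0); [by rewrite addr0|exact: cvg_cst|].
by apply: cvg_prodr (cvg_scale erefl g_cvg0) slV; rewrite mulr0.
Qed.

(** Half the square of the threshold is [2 l + g + o(1)], and the logarithm inside [g] cancels the
    one from Mills' ratio. *)
Lemma pooled_threshold_far :
  (fun n => expR (2 * l n - ln 2 - pooled_threshold n ^+ 2 / 2 - ln (l n) / 2)) @ \oo -->
  expR (- ln 2 - x + c4 / 2).
Proof.
apply: cvg_exp; first reflexivity.
apply: (@near_cvg _ (fun n => (- ln 2 - x + c4 / 2) - 8^-1 * ((g n / sl n) * (g n / sl n)))).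
  apply: filterS2 pooled_thresholdE near_l => n -> [s0 lE].
  by rewrite [X in _ = 2 * X - _ - _ - _]lE; field; rewrite gt_eqF.
by apply: (@cvg_subr _ _ _ _ 0); [rewrite subr0|exact: cvg_cst|exact: gg_cvg0].
Qed.

(** The deviation of the adjacent threshold [pooled_threshold - w] from its leading term
    [q * sl]. *)
Let D n := 2^-1 * (g n / sl n) - kappa n * sl n.

(** This is the origin of [lambda]: the cross term of [(q * sl + D) ^+ 2 / 2], together with the
    logarithm from Mills' ratio, is [lambda] up to constants. The remainder [D * D] tends to 0 if
    [lambda] converges, and only its sign is used if [lambda] tends to [-oo]. *)
Lemma pooled_threshold_near_exponent : \forall n \near \oo,
  l n - (pooled_threshold n - w n) ^+ 2 / 2 - ln (l n) / 2 =
  - x / q + (Num.sqrt 8)^-1 * c4 + lambda n - 2^-1 * (D n * D n).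
Proof.
apply: filterS2 pooled_thresholdE near_l => n tE [s0 lE].
have wE : w n = (kappa n + (2 - q)) * sl n by rewrite subrK divfK// gt_eqF.
have -> : pooled_threshold n - w n = q * sl n + D n.
  by rewrite tE /D {1}wE; ring.
have -> : (q * sl n + D n) ^+ 2 / 2 = q * q * (sl n * sl n) / 2 + q * (sl n * D n) + D n * D n / 2.
  by field.
have -> : sl n * D n = 2^-1 * g n - kappa n * l n.
  by rewrite /D [X in _ = _ - _ * X]lE; field; rewrite gt_eqF.
by rewrite qq -lE qV sqrt8V; field; rewrite gt_eqF.
Qed.

Lemma pooled_threshold_near_lim (lam : R) : lambda @ \oo --> lam ->
  (fun n => expR (l n - (pooled_threshold n - w n) ^+ 2 / 2 - ln (l n) / 2)) @ \oo -->
  expR (- x / q + (Num.sqrt 8)^-1 * c4 + lam).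
Proof.
move=> ll; apply: cvg_exp; first reflexivity.
apply: (@near_cvg _ (fun n => - x / q + (Num.sqrt 8)^-1 * c4 + lambda n - 2^-1 * (D n * D n))).
  by apply: filterS pooled_threshold_near_exponent => n ->.
apply: (@cvg_subr _ _ _ _ 0); first by rewrite subr0.
  by apply: cvg_sumr ll; [reflexivity|exact: cvg_cst].
have D0 : D @ \oo --> (0 : R).
  apply: (@cvg_subr _ _ _ 0 0); first by rewrite subr0.
    by apply: cvg_scale g_cvg0; rewrite mulr0.
  (* A convergent [lambda] forces [kappa = O(ln l / l)] and hence [kappa * sl] to vanish. *)
  apply: (@near_cvg _ (fun n => q^-1 * (lambda n * (sl n)^-1 -
      ((Num.sqrt 8)^-1 - 2^-1) * (ln (l n) / sl n)))).
    apply: filterS near_l => n [s0 lE]; rewrite [X in q * X * _]lE.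
    by field; rewrite !gt_eqF// sqrtr_gt0.
  apply: (@cvg_scale _ _ _ 0); first by rewrite mulr0.
  apply: (@cvg_subr _ _ _ 0 0); first by rewrite subr0.
    by apply: cvg_prodr ll slV; rewrite mulr0.
  by apply: cvg_scale ln_over_sqrt_cvg0; rewrite mulr0.
apply: (@cvg_scale _ _ _ 0); first by rewrite mulr0.
by apply: (@cvg_prodr _ _ _ 0 0); rewrite ?mulr0.
Qed.

Let exp_le_cvg0 (f h : nat -> R) : (\forall n \near \oo, f n <= h n) ->
  h @ \oo --> -oo -> (fun n => expR (f n)) @ \oo --> (0 : R).
Proof.
move=> fh hN; apply: (@squeeze_cvgr _ _ _ _ (fun=> 0) (fun n => expR (h n))).
- by apply: filterS fh => n h1; rewrite expR_ge0 ler_expR.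
- exact: cvg_cst.
- exact: cvg_exp_Ny.
Qed.

Lemma pooled_threshold_near_Ny : lambda @ \oo --> -oo ->
  (fun n => expR (l n - (pooled_threshold n - w n) ^+ 2 / 2 - ln (l n) / 2)) @ \oo --> (0 : R).
Proof.
move=> lN; apply: (@exp_le_cvg0 _ (fun n => - x / q + (Num.sqrt 8)^-1 * c4 + lambda n)).
  apply: filterS pooled_threshold_near_exponent => n ->.
  have : 0 <= D n * D n by rewrite -expr2 sqr_ge0.
  by lra.
by apply: cvg_addl_Ny.
Qed.

Definition adjacent_threshold n : R :=
  w n + (1 - r n ^+ 2) * (x + (2 * l n - 2^-1 * (ln (l n) + c4))) / (q * sl n).

Let y n := q * sl n + q / 2 * (g n / sl n).

Let adjacent_thresholdE : \forall n \near \oo, adjacent_threshold n = w n + (1 - r n ^+ 2) * y n.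
Proof.
apply: filterS near_l => n [s0 lE]; rewrite /adjacent_threshold /y invfM qV [X in 2 * X]lE.
by field; rewrite gt_eqF.
Qed.

Let y_ratio : (fun n => y n / sl n) @ \oo --> q.
Proof.
apply: (@near_cvg _ (fun n => q + q / 2 * (g n / sl n) * (sl n)^-1)).
  apply: filterS near_l => n [s0 _]; rewrite /y; field; exact: lt0r_neq0.
apply: (@cvg_sumr _ _ _ q 0); [by rewrite addr0|exact: cvg_cst|].
by apply: cvg_prodr (cvg_scale erefl g_cvg0) slV; rewrite mulr0.
Qed.

Let r2_cvg0 : (fun n => r n ^+ 2) @ \oo --> (0 : R).
Proof.
apply: (@near_cvg _ (fun n => r n ^+ 2 * l n * (l n)^-1)).
  by apply: filterS (near_gt 0 ly) => n l0; rewrite mulfK// gt_eqF.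
by apply: cvg_prodr rl (cvg_infty_inv ly); rewrite mulr0.
Qed.

Lemma adjacent_threshold_ratio : (fun n => adjacent_threshold n / sl n) @ \oo --> (2 : R).
Proof.
apply: (@near_cvg _ (fun n => w n / sl n + (1 - r n ^+ 2) * (y n / sl n))).
  by apply: filterS adjacent_thresholdE => n ->; ring.
apply: (@cvg_sumr _ _ _ (2 - q) q); [by rewrite subrK|exact: wlim|].
apply: (@cvg_prodr _ _ _ 1 q); [by rewrite mul1r| |exact: y_ratio].
by apply: (@cvg_subr _ _ _ 1 0); [rewrite subr0|exact: cvg_cst|exact: r2_cvg0].
Qed.

(** The normalisation makes [y ^+ 2 / 2 = l + g + o(1)]; the factor [1 - r ^+ 2] costs only a
    multiple of [r ^+ 2 * l]. *)
Lemma adjacent_threshold_near :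
  (fun n => expR (l n - (adjacent_threshold n - w n) ^+ 2 / 2 - ln (l n) / 2)) @ \oo -->
  expR (- x + c4 / 2).
Proof.
apply: cvg_exp; first reflexivity.
apply: (@near_cvg _ (fun n => (- x + c4 / 2) - 4^-1 * ((g n / sl n) * (g n / sl n)) +
   2^-1 * ((2 - r n ^+ 2) * (r n ^+ 2 * l n) * (y n / sl n * (y n / sl n))))).
  apply: filterS2 adjacent_thresholdE near_l => n tE [s0 lE].
  have -> : adjacent_threshold n - w n = (1 - r n ^+ 2) * y n by rewrite tE addrAC subrr add0r.
  have -> : ((1 - r n ^+ 2) * y n) ^+ 2 / 2 =
      y n * y n / 2 - 2^-1 * ((2 - r n ^+ 2) * r n ^+ 2 * (y n * y n)) by field.
  have -> : r n ^+ 2 * l n = r n ^+ 2 * (sl n * sl n) by rewrite -lE.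
  have yy : y n * y n / 2 = l n + g n + 4^-1 * (g n / sl n * (g n / sl n)).
    transitivity (q * q * (sl n * sl n / 2 + g n / 2 + 8^-1 * (g n / sl n * (g n / sl n)))).
      by rewrite /y; field; rewrite gt_eqF.
    by rewrite qq -lE; field; rewrite gt_eqF.
  by rewrite yy; field; rewrite gt_eqF.
apply: (@cvg_sumr _ _ _ _ 0); first by rewrite addr0; reflexivity.
  by apply: (@cvg_subr _ _ _ _ 0); [rewrite subr0|exact: cvg_cst|exact: gg_cvg0].
apply: (@cvg_scale _ _ _ 0); first by rewrite mulr0.
apply: (@cvg_prodr _ _ _ 0 (q * q)); first by rewrite mul0r.
  apply: (@cvg_prodr _ _ _ 2 0); [by rewrite mulr0| |exact: rl].
  by apply: (@cvg_subr _ _ _ 2 0); [rewrite subr0|exact: cvg_cst|exact: r2_cvg0].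
exact: (cvg_prodr erefl y_ratio y_ratio).
Qed.

(** With [F] the excess of the threshold over [2 * sl], the cross term [2 * sl * F] turns the
    exponent into [- q * lambda] plus bounded terms, and [F * F / 2] only helps. The correction [e]
    stems from the factor [1 - r ^+ 2]. *)
Lemma adjacent_threshold_far_Ny : lambda @ \oo --> +oo ->
  (fun n => expR (2 * l n - ln 2 - adjacent_threshold n ^+ 2 / 2 - ln (l n) / 2)) @ \oo --> (0 : R).
Proof.
move=> lN; pose e n := 2 * (r n ^+ 2 * l n * (y n / sl n)).
have e0 : e @ \oo --> (0 : R).
  apply: (@cvg_scale _ _ _ 0); first by rewrite mulr0.
  by apply: (cvg_prodr _ rl y_ratio); rewrite mul0r.
apply: (@exp_le_cvg0 _ (fun n => (- ln 2 - q * x + c4 * (q / 2) + 1) + - (q * lambda n))).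
  have e1 : \forall n \near \oo, e n < 1 by apply: near_lim_lt e0 _.
  apply: filterS3 adjacent_thresholdE near_l e1 => n tE [s0 lE] e1.
  have wE : w n = (kappa n + (2 - q)) * sl n by rewrite subrK divfK// gt_eqF.
  pose F := adjacent_threshold n - 2 * sl n.
  have FE : F = kappa n * sl n + q / 2 * (g n / sl n) - r n ^+ 2 * y n.
    by rewrite /F tE {1}wE /y; ring.
  have -> : adjacent_threshold n ^+ 2 / 2 = 2 * (sl n * sl n) + 2 * (sl n * F) + F * F / 2.
    by rewrite /F; field.
  have -> : sl n * F = kappa n * l n + q / 2 * g n - 2^-1 * e n.
    have E1 : r n ^+ 2 * l n = r n ^+ 2 * (sl n * sl n) by rewrite -lE.
    have E2 : kappa n * l n = kappa n * (sl n * sl n) by rewrite -lE.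
    by rewrite FE /e E1 E2; field; rewrite gt_eqF.
  have FF : 0 <= F * F by rewrite -expr2 sqr_ge0.
  rewrite -lE.
  have -> : q * lambda n = q * q * (l n * kappa n) + (q * q / 4 - q / 2) * ln (l n).
    by rewrite sqrt8V; field; rewrite gt_eqF.
  by rewrite qq; lra.
apply: cvg_addl_Ny; apply/cvgNry; rewrite (_ : - _ = (fun n => q * lambda n)); last first.
  by apply/funext => n; rewrite /= -[LHS]/(- - _) opprK.
by apply: (cvg_mul_infty q0) lN; exact: cvg_cst.
Qed.

End threshold_exponents.

(** * The growth condition and the constants of the limit laws *)

Section growth.
Context {R : realType}.

(** The left side is [sqrt (l^3 / n)], and [n] is at least the cube of its fifth root [m], so
    [sqrt ((l / m)^3)] dominates it. *)
Lemma ln_growth (l : nat -> R) : l @ \oo --> +oo ->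
  (fun n => l n / (n%:R `^ (5^-1))) @ \oo --> (0 : R) ->
  (fun n => l n * Num.sqrt (l n / n%:R)) @ \oo --> (0 : R).
Proof.
move=> ly l0; pose m n : R := n%:R `^ 5^-1.
have q0 : (fun n => Num.sqrt (l n / m n * (l n / m n) * (l n / m n))) @ \oo --> (0 : R).
  apply: (@cvg_sqrtr _ _ 0); first by rewrite sqrtr0.
  apply: (@cvg_prodr _ _ _ 0 0); [by rewrite mulr0| |exact: l0].
  by apply: (@cvg_prodr _ _ _ 0 0); [rewrite mulr0|exact: l0|exact: l0].
apply: (squeeze_cvgr _ (cvg_cst 0) q0).
near=> n; have n1 : (1 : R) <= n%:R by rewrite ler1n; near: n; exact: nbhs_infty_gt.
have n0 : (0 : R) < n%:R by exact: lt_le_trans n1.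
have ln0 : 0 < l n by near: n; exact: near_gt.
have m1 : 1 <= m n by rewrite -[leLHS](powRr0 n%:R); apply: ler_powR.
have m0 : 0 < m n by exact: lt_le_trans m1.
have m5 : m n ^+ 5 = n%:R.
  by rewrite -powR_mulrn ?ltW// -powRrM mulVf// powRr1// ltW.
apply/andP; split; first by rewrite mulr_ge0 ?sqrtr_ge0 ?ltW.
rewrite -{1}(gtr0_norm ln0) -sqrtr_sqr -sqrtrM ?sqr_ge0// ler_wsqrtr//.
have -> : l n ^+ 2 * (l n / n%:R) = l n ^+ 3 / n%:R by ring.
have -> : l n / m n * (l n / m n) * (l n / m n) = l n ^+ 3 / m n ^+ 3 by field; rewrite gt_eqF.
rewrite ler_pM2l ?exprn_gt0// lef_pV2 ?posrE ?exprn_gt0//.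
by rewrite -m5 ler_weXn2l.
Unshelve. all: by end_near. Qed.

End growth.

Section limit_constants.
Context {R : realType}.

Lemma below_threshold (a b L u x : R) : 0 < a -> (x + b) / a = u ->
  (a * L - b <= x) = (L <= u).
Proof. by move=> a0 <-; rewrite lerBlDr ler_pdivlMr// mulrC. Qed.

Lemma weak_constant (x : R) :
  expR (- ln 2 - x + ln (4 * pi) / 2) / (2 * Num.sqrt (2 * pi)) =
  (2 * Num.sqrt 2)^-1 * expR (- x).
Proof.
have p0 : (0 : R) < pi := pi_gt0 R.
have h : expR (ln (4 * pi) / 2) = 2 * Num.sqrt (pi : R).
  have -> : ln (4 * pi) / 2 = ln (2 * Num.sqrt (pi : R)).
    have -> : 4 * pi = (2 * Num.sqrt (pi : R)) ^+ 2.
      by rewrite exprMn sqr_sqrtr ?ltW// expr2; ring.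
    by rewrite lnXn ?mulr_gt0 ?sqrtr_gt0// -mulr_natr; field.
  by rewrite lnK// posrE mulr_gt0// sqrtr_gt0.
have two0 : (0 : R) < 2 by [].
rewrite !expRD h [expR (- ln 2)]expRN (lnK two0) sqrtrM//; field.
by rewrite !gt_eqF ?sqrtr_gt0.
Qed.

Lemma adjacent_constant (y : R) :
  expR (y + ln (4 * pi) / 2) / (Num.sqrt 2 * Num.sqrt (2 * pi)) = expR y.
Proof.
have p0 : (0 : R) < pi := pi_gt0 R.
have -> : Num.sqrt 2 * Num.sqrt (2 * pi) = expR (ln (4 * pi) / 2) :> R.
  rewrite -sqrtrM// -powR12_sqrt ?mulr_ge0 ?ltW// /powR gt_eqF ?mulr_gt0// mulrC.
  by rewrite mulrA (_ : 2 * 2 = 4)//; lra.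
by rewrite expRD mulfK// gt_eqF// expR_gt0.
Qed.

End limit_constants.

Theorem theorem2 (R : realType) (d : measure_display)
  (T : nat -> measurableType d) (P : forall n, probability (T n) R)
  (r : nat -> R) (p : nat -> nat)
  (M : forall n, 'M[R]_(p n))
  (z : forall n, 'I_n * 'I_(p n) -> T n -> R) :
  (forall n, 0 <= r n < 1) ->
  (forall n, M n *m (M n)^T = ar1_cov (p n) (r n)) ->
  (forall n, iid_std_normal (P n) (z n)) ->
  ((p n)%:R : R) @[n --> \oo] --> +oo ->
  (ln ((p n)%:R : R) / (n%:R `^ (5^-1))) @[n --> \oo] --> (0 : R) ->
  limn_sup r < 1 ->
  (r n * Num.sqrt n%:R / Num.sqrt (ln (p n)%:R)) @[n --> \oo]
     --> (2 - Num.sqrt 2 : R) ->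
  let L n (t : T n) : R :=
    Lmax (gauss_sample (M n) (fun kj => z n kj t)) in
  let lp n : R := ln (p n)%:R in
  let kappa n : R := r n * Num.sqrt n%:R / Num.sqrt (lp n) - (2 - Num.sqrt 2) in
  let lambda n : R := Num.sqrt 2 * lp n * kappa n
                      + ((Num.sqrt 8)^-1 - 2^-1) * ln (lp n) in
  let a n : R := 2 * Num.sqrt (n%:R * lp n) in
  let b n : R := 4 * lp n - 2^-1 * (ln (lp n) + ln (4 * pi)) in
  let K1 : R := (2 * Num.sqrt 2)^-1 in
  let c n : R := Num.sqrt (2 * n%:R * lp n) / (1 - r n ^+ 2) in
  let d' n : R := r n * Num.sqrt (2 * n%:R * lp n) / (1 - r n ^+ 2)
                  + 2 * lp n - 2^-1 * (ln (lp n) + ln (4 * pi)) in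
  let K2 : R := (2^-1 - (Num.sqrt 8)^-1) * ln (4 * pi) in
  (* (i) *)
  (lambda n @[n --> \oo] --> -oo ->
    forall x : R,
      P n [set t | a n * L n t - b n <= x] @[n --> \oo]
        --> (expR (- (K1 * expR (- x))))%:E) /\
  (* (ii) *)
  (forall lam : R, lambda n @[n --> \oo] --> lam ->
    forall x : R,
      P n [set t | a n * L n t - b n <= x] @[n --> \oo]
        --> (expR (- (K1 * expR (- x)))
             * expR (- expR (- x / Num.sqrt 2 - K2 + lam)))%:E) /\
  (* (iii) *)
  (lambda n @[n --> \oo] --> +oo ->
    forall x : R,
      P n [set t | c n * L n t - d' n <= x] @[n --> \oo]
        --> (expR (- expR (- x)))%:E).
Proof.
move=> r01 MM Pz py lpn _ wlim L lp kappa lambda a b K1 c d' K2.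
have ly : lp @ \oo --> +oo := ln_cvg_infty py.
have leta := ln_growth ly lpn.
have near_pos : \forall n \near \oo, [/\ (0 : R) < n%:R, 0 < lp n,
    0 < Num.sqrt n%:R :> R & 0 < Num.sqrt (lp n)].
  near=> n; have n0 : (0 : R) < n%:R by rewrite ltr0n; near: n; exact: nbhs_infty_gt.
  have l0 : 0 < lp n by near: n; exact: near_gt.
  by rewrite !sqrtr_gt0.
pose w n := r n * Num.sqrt n%:R.
have wlim' : (fun n => w n / Num.sqrt (lp n)) @ \oo --> 2 - Num.sqrt 2 by exact: wlim.
(* With [eta = sqrt (lp / n)], the product is [(w / sqrt lp)^2] times [lp * eta] times [eta]: a
   convergent factor and two vanishing ones. *)
have rl : (fun n => r n ^+ 2 * lp n) @ \oo --> (0 : R).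
  apply: (@near_cvg _ (fun n => (w n / Num.sqrt (lp n)) * (w n / Num.sqrt (lp n)) *
     (lp n * Num.sqrt (lp n / n%:R) * Num.sqrt (lp n / n%:R)))).
    apply: filterS near_pos => n [n0 l0 sn sl].
    have e2 : Num.sqrt (lp n / n%:R) * Num.sqrt (lp n / n%:R) = lp n / n%:R.
      by rewrite -expr2 sqr_sqrtr// divr_ge0 ?ltW.
    rewrite -(mulrA (lp n)) e2 /w.
    have -> : lp n / n%:R = (Num.sqrt (lp n) * Num.sqrt (lp n)) / (Num.sqrt n%:R * Num.sqrt n%:R).
      by rewrite -!expr2 !sqr_sqrtr// ltW.
    by field; rewrite !gt_eqF.
  apply: (@cvg_prodr _ _ _ ((2 - Num.sqrt 2) * (2 - Num.sqrt 2)) 0); first by rewrite mulr0.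
    exact: (cvg_prodr erefl wlim' wlim').
  apply: (@cvg_prodr _ _ _ 0 0); [by rewrite mulr0|exact: leta|].
  exact: (eta_cvg0 ly leta).
have limit t m1 m2 := @Lmax_limit R d T P r p M z r01 MM Pz t m1 m2 py leta wlim'.
(* The normalised event is rewritten, for large [n], as [L n] lying below a level of the form
   [t / sqrt n]. *)
have transfer (al be t : nat -> R) (x : R) e :
    (\forall n \near \oo, 0 < al n /\ (x + be n) / al n = t n / Num.sqrt n%:R) ->
    P n [set y | L n y <= t n / Num.sqrt n%:R] @[n --> \oo] --> e ->
    P n [set y | al n * L n y - be n <= x] @[n --> \oo] --> e.
  move=> H; apply: cvg_trans; apply: near_eq_cvg; apply: filterS H => n [a0 h].
  by congr (P n _); apply/seteqP; split => y /=; rewrite (below_threshold _ a0 h).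
have ab x : \forall n \near \oo, 0 < a n /\ (x + b n) / a n = pooled_threshold lp x n / Num.sqrt n%:R.
  apply: filterS near_pos => n [n0 l0 sn sl].
  rewrite /a /b /pooled_threshold sqrtrM ?ltW//; split; first by rewrite !mulr_gt0.
  by field; rewrite !gt_eqF.
have cd x : \forall n \near \oo, 0 < c n /\ (x + d' n) / c n = adjacent_threshold lp w r x n / Num.sqrt n%:R.
  apply: filterS near_pos => n [n0 l0 sn sl].
  have s2 : (0 : R) < Num.sqrt 2 by rewrite sqrtr_gt0.
  have r2 : 0 < 1 - r n ^+ 2.
    by have /andP[r0 r1] := r01 n; rewrite subr_gt0 expr_lt1.
  have E : Num.sqrt (2 * n%:R * lp n) = Num.sqrt 2 * Num.sqrt n%:R * Num.sqrt (lp n).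
    by rewrite !sqrtrM ?mulr_ge0 ?ltW.
  rewrite /c /d' /adjacent_threshold /w E; split; first by rewrite divr_gt0 ?mulr_gt0.
  by field; rewrite !gt_eqF.
split; [|split].
- move=> lN x; apply: transfer (ab x) _.
  have := limit _ _ _ (pooled_threshold_ratio x ly)
    (pooled_threshold_far (x := x) ly) (pooled_threshold_near_Ny x ly lN).
  by rewrite mul0r addr0 weak_constant.
- move=> lam ll x; apply: transfer (ab x) _.
  have := limit _ _ _ (pooled_threshold_ratio x ly)
    (pooled_threshold_far (x := x) ly) (pooled_threshold_near_lim (x := x) ly ll).
  (* The summand [ln (4 pi) / 2] is absorbed by the constant of the Gaussian tail; [- K2] is what
     remains of [ln (4 pi) / sqrt 8]. *)
  rewrite weak_constant (_ : - x / Num.sqrt 2 + (Num.sqrt 8)^-1 * ln (4 * pi) + lam =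
    (- x / Num.sqrt 2 - K2 + lam) + ln (4 * pi) / 2); last by rewrite /K2; lra.
  by rewrite adjacent_constant opprD expRD.
- move=> lP x; apply: transfer (cd x) _.
  have := limit _ _ _ (adjacent_threshold_ratio x ly wlim' rl)
    (adjacent_threshold_far_Ny x ly rl lP) (adjacent_threshold_near w ly rl).
  by rewrite mul0r add0r adjacent_constant.
Unshelve. all: by end_near. Qed.
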